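(* Let $\varepsilon\neq 0$ be a real number and let $S^3_\varepsilon$ be the Berger 3-sphere. A constant mean curvature surface in $S^3_\varepsilon$ is proper biharmonic if and only if it is a part of one of the following: (i) $S^2(1/\sqrt{2})$ in $S^3$ (the standard unit sphere, i.e. the case $\varepsilon^2=1$); or (ii) a Hopf torus in $S^3_\varepsilon$, namely the inverse image under the Hopf fibration $\psi:S^3_\varepsilon\to S^2(\tfrac12)$ of a circle of radius $r=\frac{1}{2\sqrt{2-\varepsilon^2}}$ in the base sphere $S^2(\tfrac12)$, with $\varepsilon^2<1$.
   Context: All manifolds and maps are smooth. Let $g$ be the standard metric on the unit sphere $S^3\subset\mathbb{R}^4$, and let $S^2(\tfrac12)\subset\mathbb{R}^3$ be the 2-sphere of radius $\tfrac12$ (Gauss curvature $4$). The Hopf map $\psi:S^3\to S^2(\tfrac12)$ is $$\psi(x^1,x^2,x^3,x^4)=\tfrac12\big(2x^1x^3+2x^2x^4,\;2x^2x^3-2x^1x^4,\;(x^1)^2+(x^2)^2-(x^3)^2-(x^4)^2\big).$$ Let $T^VS^3=\ker d\psi$ and let $T^HS^3$ be its $g$-orthogonal complement. For real $\varepsilon\ne0$ the Berger sphere is $S^3_\varepsilon=(S^3,g_\varepsilon)$, where $g_\varepsilon=g$ on $T^HS^3\times T^HS^3$, $g_\varepsilon=\varepsilon^2 g$ on $T^VS^3\times T^VS^3$, and $g_\varepsilon=0$ on $T^HS^3\times T^VS^3$. The map $\psi:S^3_\varepsilon\to S^2(\tfrac12)$ is a Riemannian submersion (the Hopf fibration). For $\varepsilon^2=1$,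 $S^3_\varepsilon$ is the standard unit sphere $S^3$, and $S^2(1/\sqrt2)$ in $S^3$ denotes the small hypersphere of radius $1/\sqrt2$. The radius of a circle in $S^2(\tfrac12)$ is its Euclidean radius as a circle in $\mathbb{R}^3$. For a map $\varphi:(M,g_M)\to(N,h)$ of Riemannian manifolds, the tension field is $\tau(\varphi)=\mathrm{Trace}_{g_M}\nabla d\varphi$; $\varphi$ is harmonic if $\tau(\varphi)=0$, and biharmonic if $\mathrm{Trace}_{g_M}(\nabla^\varphi\nabla^\varphi-\nabla^\varphi_{\nabla^M})\tau(\varphi)-\mathrm{Trace}_{g_M}R^N(d\varphi,\tau(\varphi))d\varphi=0$, where $R^N(X,Y)Z=[\nabla^N_X,\nabla^N_Y]Z-\nabla^N_{[X,Y]}Z$. A surface is biharmonic if the isometric immersion defining it is a biharmonic map; it is proper biharmonic if it is biharmonic and not harmonic (i.e. not minimal). *)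

(* Defs.v *)
From mathcomp Require Import all_boot all_order all_algebra.
From mathcomp Require Import all_classical all_reals topology normedtype derive.

Set Implicit Arguments.
Unset Strict Implicit.
Unset Printing Implicit Defensive.

Import Order.TTheory GRing.Theory Num.Theory.
Import numFieldNormedType.Exports.

Local Open Scope classical_set_scope.
Local Open Scope ring_scope.

Section EuclideanSpace.
Variable R : realType.

Definition dot n (u v : 'rV[R]_n) : R := (u *m v^T) 0 0.

Definition enorm n (u : 'rV[R]_n) : R := Num.sqrt (dot u u).

Definition sphere n (rho : R) : set 'rV[R]_n := [set x | enorm x = rho].

(* [S] is a round sphere of codimension 2 in R^n with Euclidean radius [r]:
   a circle if n = 3, a round 2-sphere if n = 4. *)
Definition round_sphere n (r : R) (S : set 'rV[R]_n) : Prop :=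
  exists c nu : 'rV[R]_n, nu != 0 /\
    S = [set x | dot (x - c) nu = 0 /\ enorm (x - c) = r].

Definition basis_vector n (i : 'I_n) : 'rV[R]_n := delta_mx 0 i.

(* C^infinity on an open set: all iterated partial derivatives are
   (Frechet) differentiable. *)
Definition smooth_on m n (U : set 'rV[R]_m) (f : 'rV[R]_m -> 'rV[R]_n) : Prop :=
  forall (s : seq 'I_m) (x : 'rV[R]_m), U x ->
    differentiable (foldr (fun i g => 'D_(basis_vector i) g) f s) x.

End EuclideanSpace.

Section Manifold.
Variables (R : realType) (M : topologicalType) (n : nat).

Record chart := Chart {
  chart_dom : set M;
  chart_map : M -> 'rV[R]_n;
  chart_inv : 'rV[R]_n -> M }.

Definition chart_cod (x : chart) : set 'rV[R]_n := chart_map x @` chart_dom x.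

Definition is_chart (x : chart) : Prop :=
  [/\ open (chart_dom x), open (chart_cod x),
      forall p, chart_dom x p -> chart_inv x (chart_map x p) = p,
      {within chart_dom x, continuous (chart_map x)} &
      {within chart_cod x, continuous (chart_inv x)}].

Definition smooth_atlas (A : set chart) : Prop :=
  [/\ forall x, A x -> is_chart x,
      forall p : M, exists2 x, A x & chart_dom x p &
      forall x y, A x -> A y ->
        smooth_on (chart_cod x `&` chart_inv x @^-1` chart_dom y)
                  (chart_map y \o chart_inv x)].

Definition smooth_manifold (A : set chart) : Prop :=
  [/\ hausdorff_space M, second_countable (T := M) & smooth_atlas A].

End Manifold.

(* Riemannian geometry in coordinates. A metric on (an open part of) R^n is a
   matrix-valued function; vectors are row vectors of components. *)
Section LocalGeometry.
Variable R : realType.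

Definition metric n (H : 'rV[R]_n -> 'M[R]_n) (y X Y : 'rV[R]_n) : R :=
  (X *m H y *m Y^T) 0 0.

Definition christoffel n (H : 'rV[R]_n -> 'M[R]_n) (k i j : 'I_n)
    (y : 'rV[R]_n) : R :=
  2^-1 * \sum_(l < n) invmx (H y) k l *
    ('D_(basis_vector R i) (fun z => H z j l : R^o) y
     + 'D_(basis_vector R j) (fun z => H z i l : R^o) y
     - 'D_(basis_vector R l) (fun z => H z i j : R^o) y).

(* For constant fields X and Y this is the Levi-Civita derivative of Y along
   X at y. *)
Definition Gamma n (H : 'rV[R]_n -> 'M[R]_n) (y X Y : 'rV[R]_n) : 'rV[R]_n :=
  \row_k \sum_(i < n) \sum_(j < n) christoffel H k i j y * X 0 i * Y 0 j.

(* Pull-back connection: covariant derivative in the direction v of a vector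
   field W along F; H is the metric of the target. *)
Definition covD m n (H : 'rV[R]_n -> 'M[R]_n) (F : 'rV[R]_m -> 'rV[R]_n)
    (v : 'rV[R]_m) (W : 'rV[R]_m -> 'rV[R]_n) : 'rV[R]_m -> 'rV[R]_n :=
  fun x => 'D_v W x + Gamma H (F x) ('D_v F x) (W x).

(* R(X,Y)Z at y, computed with the constant extensions of X, Y and Z, for
   which [X,Y] = 0. *)
Definition curvature n (H : 'rV[R]_n -> 'M[R]_n) (y X Y Z : 'rV[R]_n) :
    'rV[R]_n :=
  covD H id X (covD H id Y (cst Z)) y - covD H id Y (covD H id X (cst Z)) y.

Definition trace_metric m (V : lmodType R) (G : 'rV[R]_m -> 'M[R]_m)
    (x : 'rV[R]_m) (B : 'rV[R]_m -> 'rV[R]_m -> V) : V :=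
  \sum_(i < m) \sum_(j < m)
    invmx (G x) i j *: B (basis_vector R i) (basis_vector R j).

Section Map.
Variables (m n : nat) (G : 'rV[R]_m -> 'M[R]_m) (H : 'rV[R]_n -> 'M[R]_n).
Variable F : 'rV[R]_m -> 'rV[R]_n.

(* (nabla dF)(v, w) *)
Definition second_fundamental_form (x v w : 'rV[R]_m) : 'rV[R]_n :=
  covD H F v ('D_w F) x - 'D_(Gamma G x v w) F x.

Definition tension (x : 'rV[R]_m) : 'rV[R]_n :=
  trace_metric G x (second_fundamental_form x).

Definition bitension (x : 'rV[R]_m) : 'rV[R]_n :=
  trace_metric G x (fun v w =>
    covD H F v (covD H F w tension) x - covD H F (Gamma G x v w) tension x)
  - trace_metric G x (fun v w =>
      curvature H (F x) ('D_v F x) (tension x) ('D_w F x)).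

Definition unit_normal_at (xi : 'rV[R]_m -> 'rV[R]_n) (x : 'rV[R]_m) : Prop :=
  metric H (F x) (xi x) (xi x) = 1 /\
  forall v : 'rV[R]_m, metric H (F x) (xi x) ('D_v F x) = 0.

Definition mean_curvature (xi : 'rV[R]_m -> 'rV[R]_n) (x : 'rV[R]_m) : R :=
  m%:R^-1 * trace_metric G x (fun v w =>
    metric H (F x) (second_fundamental_form x v w) (xi x) : R^o).

End Map.

End LocalGeometry.

Section BergerSphere.
Variable R : realType.

Definition hopf (x : 'rV[R]_4) : 'rV[R]_3 :=
  let x1 := x 0 0 in let x2 := x 0 1 in let x3 := x 0 2 in let x4 := x 0 3 in
  2^-1 *: \row_(i < 3)
    [:: 2 * x1 * x3 + 2 * x2 * x4;
        2 * x2 * x3 - 2 * x1 * x4;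
        x1 ^+ 2 + x2 ^+ 2 - x3 ^+ 2 - x4 ^+ 2]`_i.

(* Subspaces of R^4 are encoded as row spaces; kermx p^T is the tangent space
   of the sphere at p. *)
Definition vertical (p : 'rV[R]_4) : 'M[R]_4 :=
  (kermx p^T :&: kermx ('J hopf p))%MS.

Definition horizontal (p : 'rV[R]_4) : 'M[R]_4 :=
  (kermx p^T :&: kermx (vertical p)^T)%MS.

Definition berger_metric (eps : R) (p X Y : 'rV[R]_4) : R :=
  let h := proj_mx (horizontal p) (vertical p) in
  let v := proj_mx (vertical p) (horizontal p) in
  dot (X *m h) (Y *m h) + eps ^+ 2 * dot (X *m v) (Y *m v).

Definition pullback_metric m (eps : R) (f : 'rV[R]_m -> 'rV[R]_4)
    (u : 'rV[R]_m) : 'M[R]_m :=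
  \matrix_(i < m, j < m) berger_metric eps (f u)
    ('D_(basis_vector R i) f u) ('D_(basis_vector R j) f u).

(* Stereographic projections from the poles (0, 0, 0, (-1)^s). *)
Definition stereo_dom (s : bool) : set 'rV[R]_4 :=
  [set p | sphere 1 p /\ p 0 ord_max != (-1) ^+ s].

Definition stereo (s : bool) (p : 'rV[R]_4) : 'rV[R]_3 :=
  \row_(a < 3) (p 0 (lift ord_max a) / (1 - (-1) ^+ s * p 0 ord_max)).

Definition stereo_inv (s : bool) (u : 'rV[R]_3) : 'rV[R]_4 :=
  (dot u u + 1)^-1 *: \row_(i < 4)
    (if unlift ord_max i is Some a then 2 * u 0 a
     else (-1) ^+ s * (dot u u - 1)).

Definition berger_coord_metric (eps : R) (s : bool) : 'rV[R]_3 -> 'M[R]_3 :=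
  pullback_metric eps (stereo_inv s).

End BergerSphere.

Section SurfaceInBergerSphere.
Variables (R : realType) (eps : R) (M : topologicalType).
Variables (A : set (chart R M 2)) (phi : M -> 'rV[R]_4).

Let param (x : chart R M 2) : 'rV[R]_2 -> 'rV[R]_4 := phi \o chart_inv x.

Let local_map (x : chart R M 2) (s : bool) : 'rV[R]_2 -> 'rV[R]_3 :=
  stereo s \o param x.

Let local_dom (x : chart R M 2) (s : bool) : set 'rV[R]_2 :=
  chart_cod x `&` param x @^-1` stereo_dom s.

Definition immersion_in_S3 : Prop :=
  [/\ forall p, sphere 1 (phi p),
      forall x, A x -> smooth_on (chart_cod x) (param x) &
      forall x u, A x -> chart_cod x u -> injective ('d (param x) u)].

(* The surface carries the metric induced by phi, so that phi is an isometric
   immersion into the Berger sphere. *)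
Definition harmonic : Prop :=
  forall x s u, A x -> local_dom x s u ->
    tension (pullback_metric eps (param x)) (berger_coord_metric eps s)
      (local_map x s) u = 0.

Definition biharmonic : Prop :=
  forall x s u, A x -> local_dom x s u ->
    bitension (pullback_metric eps (param x)) (berger_coord_metric eps s)
      (local_map x s) u = 0.

Definition proper_biharmonic : Prop := biharmonic /\ ~ harmonic.

(* The mean curvature function is taken with respect to local unit normal
   fields, as M is not assumed to be orientable. *)
Definition constant_mean_curvature : Prop :=
  exists c : R, forall x s u, A x -> local_dom x s u ->
    exists (U : set 'rV[R]_2) (xi : 'rV[R]_2 -> 'rV[R]_3),
      [/\ open U, U u, U `<=` local_dom x s, smooth_on U xi &
        forall w, U w ->
          unit_normal_at (berger_coord_metric eps s) (local_map x s) xi w /\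
          mean_curvature (pullback_metric eps (param x))
            (berger_coord_metric eps s) (local_map x s) xi w = c].

End SurfaceInBergerSphere.

(* Main.v *)
(** Stereographic projection trivialises the left-invariant orthonormal frame of
the Berger sphere given by the Hopf fields, and in this frame the Levi-Civita
connection is nabla_v w = D_v w + (L theta_v) x w with L = diag(eps, eps, 2/eps - eps)
and the curvature operator is Q = diag(-eps^2, -eps^2, 3 eps^2 - 4). For a surface
with unit normal n, mean curvature h/2 = const <> 0 and shape determinant d,
biharmonicity becomes 2 Q n = (h^2 - 2 d + n.Qn + tr Q) n.

If eps^2 = 1 this says that the principal curvatures are constant, and the Codazzi
and Ricci equations exclude distinct ones; the surface is umbilic with h^2 = 4 and the
vector 2 f + h n of R^4 is constant. If eps^2 <> 1 then n is horizontal (the case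
of a vertical n contradicts the structure equation, as the horizontal distribution
is not integrable), d = -eps^2 and h^2 = 4 - 4 eps^2; writing B1, B2 for the images
under d hopf of the first two Hopf fields, h (n_1 B1 + n_2 B2) + h^2 hopf(f) is a
constant vector of R^3. In both cases the constant vector is the normal of the plane
cutting out the round sphere, and it is independent of the chart because two distinct
candidates at a point would force f, respectively hopf(f), to be locally constant. *)
Require Import Defs.
From mathcomp Require Import all_boot all_order all_algebra ring lra.
From mathcomp Require Import all_classical all_reals interval_inference topology normedtype landau derive realfun.
Set Implicit Arguments.
Unset Strict Implicit.
Unset Printing Implicit Defensive.
Import Order.TTheory GRing.Theory Num.Theory.
Import numFieldNormedType.Exports.
Local Open Scope classical_set_scope.
Local Open Scope ring_scope.

(** * Calculus on normed modules *)

(** [tension] and [bitension] carry two sets of Christoffel symbols, and each is removed once and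
    for all. Those of the sphere disappear through the Koszul formula: in the Hopf frame a
    connection that is metric and torsion free is recognised as the Levi-Civita one. Those of the
    induced metric disappear because the trace of a covariant derivative is a divergence,
    [laplace_div], whose fluxes on a surface in 3-space are cross products with the unit normal.
    What is left is vector algebra in R^3, within reach of [ring] and [field]. The surface is not
    oriented, so the normal and h of a chart agree with those of the hypothesis only up to sign.
    Only h^2 is known to be constant; where it is non-zero the derivative of h vanishes, and h n, on
    which the constant vectors depend, does not see the sign. Distinct principal curvatures are
    treated without eigenvector fields, whose smoothness would have to be proved: images of the
    coordinate fields under the shifted shape operator replace them. For the converse, the equation
    of the plane is differentiated, which yields the curvatures directly. *)

Section Differentiability.
Variables (R : realType) (V W : normedModType R).

Lemma near_eq_differentiable (f g : V -> W) (x : V) :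
  (\near x, f x = g x) -> differentiable f x -> differentiable g x.
Proof.
move=> fg df.
have fgx : f x = g x := nbhs_singleton fg.
have fg0 : \forall h \near (0 : V), f (h + x) = g (h + x).
  by move/nbhs0P: fg; apply: filter_app; near=> h; rewrite addrC.
have H : g \o shift x = cst (g x) + 'd f x +o_ (0 : V) id.
  apply/eqaddoP => _/posnumP[e].
  have /diff_locally /eqaddoP /(_ e%:num) /(_ [gt0 of e%:num]) := df.
  move: fg0; apply: filter_app2; near=> h => fgh.
  by rewrite !fctE /= fgh -fgx.
have dfc : continuous ('d f x) by exact: diff_continuous.
by apply/diff_locallyP; rewrite (diff_unique dfc H).
Unshelve. all: by end_near. Qed.

Lemma differentiable_bound (f : V -> W) (x : V) (e : R) :
  differentiable f x -> 0 < e ->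
  \forall h \near (0 : V), `|f (h + x) - f x - 'd f x h| <= e * `|h|.
Proof.
move=> /diff_locally /eqaddoP + e0 => /(_ e e0).
apply: filter_app; near=> h.
by rewrite !fctE /= opprD addrA.
Unshelve. all: by end_near. Qed.

Lemma deriveDv (f : V -> W) (x u v : V) : differentiable f x ->
  'D_(u + v) f x = 'D_u f x + 'D_v f x.
Proof. by move=> df; rewrite !deriveE // linearD. Qed.

Lemma deriveZv (f : V -> W) (x v : V) k : differentiable f x ->
  'D_(k *: v) f x = k *: 'D_v f x.
Proof. by move=> df; rewrite !deriveE // linearZ. Qed.

End Differentiability.

Section AlongLines.
Variables (R : realType) (V W : normedModType R).

Lemma is_derive_line (f : V -> W) (y u : V) (t : R) :
  differentiable f (t *: u + y) ->
  is_derive t (1 : R) (fun s : R => f (s *: u + y)) ('D_u f (t *: u + y)).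
Proof.
move=> df; have dfu : derivable f (t *: u + y) u by exact: diff_derivable.
have E : (fun h : R => h^-1 *: (((fun s : R => f (s *: u + y)) \o shift t) (h *: 1)
            - f (t *: u + y)))
       = (fun h : R => h^-1 *: ((f \o shift (t *: u + y)) (h *: u) - f (t *: u + y))).
  by apply/funext => h /=; rewrite scalerDl -scalerA scale1r addrA.
by split; [rewrite /derivable E | rewrite /derive E].
Qed.

End AlongLines.

(** * Mean values and the symmetry of second derivatives *)

Section MeanValue.
Variables (R : realType) (V : normedModType R).

Lemma mean_value_line (f : V -> R) (y u : V) (h : R) : 0 <= h ->
  (forall t, t \in `[0, h] -> differentiable f (t *: u + y)) ->
  exists2 c, c \in `[0, h] & f (h *: u + y) - f y = h * 'D_u f (c *: u + y).
Proof.
move=> h0 df.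
have [] := @MVT_segment R (fun s : R => f (s *: u + y)) (fun s : R => 'D_u f (s *: u + y)) 0 h h0.
- by move=> t th; apply: is_derive_line; apply: df; apply: subset_itv_oo_cc th.
- apply: derivable_within_continuous => t th.
  by have [] := is_derive_line (df _ th).
- by move=> c ch; rewrite scale0r add0r subr0 mulrC => E; exists c.
Qed.

Lemma derive0_ball_cst (f : V -> R) (x : V) (r : R) :
  (forall y, ball x r y -> differentiable f y /\ forall v, 'D_v f y = 0) ->
  forall y, ball x r y -> f y = f x.
Proof.
move=> df y xy.
have H t : t \in `[0, 1] -> ball x r (t *: (y - x) + x).
  rewrite in_itv /= => /andP[t0 t1]; move: xy; rewrite -!ball_normE /=.
  rewrite opprD addrCA subrr addr0 normrN normrZ ger0_norm // -[`|y - x|]normrN opprB.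
  by apply: le_lt_trans; rewrite ler_piMl.
have [|c c01] := @mean_value_line f x (y - x) 1 ler01; first by move=> t /H /df [].
by rewrite (df _ (H _ c01)).2 mulr0 scale1r subrK => /subr0_eq.
Qed.

(** Differencing in the direction v first and applying the mean value theorem along u leaves a
    difference of two values of ['D_u f]; differentiability of ['D_u f] at the single point x then
    controls it up to o(h^2). *)
Lemma second_difference (f : V -> R) (x u v : V) (e : R) : 0 < e ->
  (\near x, differentiable f x) -> differentiable ('D_u f) x ->
  exists2 d : R, 0 < d & forall h, 0 < h < d ->
  `|f (h *: u + (h *: v + x)) - f (h *: v + x) - (f (h *: u + x) - f x)
     - h ^+ 2 * 'D_v ('D_u f) x| <= e * h ^+ 2.
Proof.
move=> e0 ndf dg.
(* All points of the parallelogram lie within [h * K] of x; the tolerance is [e / (2 * K)] because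
   two values of ['D_u f] are compared with the linearisation. *)
pose K := `|u| + `|v| + 1.
have K0 : 0 < K by rewrite /K ltr_wpDl // addr_ge0.
have ek0 : 0 < e / (2 * K) by rewrite divr_gt0 // mulr_gt0.
have := differentiable_bound dg ek0.
have fg : \forall h \near (0 : V), differentiable f (h + x).
  by move/nbhs0P: ndf; apply: filter_app; near=> h; rewrite addrC.
move=> /(filterI fg) /nbhs_ballP[r /= r0 Hr].
exists (r / K); first by rewrite divr_gt0.
move=> h /andP[h0 hd].
have hK : h * K < r by rewrite -ltr_pdivlMr.
have nb t s : 0 <= t <= h -> 0 <= s <= h -> `|t *: u + s *: v| <= h * K.
  move=> /andP[t0 th] /andP[s0 sh]; apply: (le_trans (ler_normD _ _)).
  rewrite !normrZ !ger0_norm // /K !mulrDr mulr1 -addrA.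
  by rewrite lerD ?ler_wpM2r // ler_wpDr ?(ltW h0) // ler_wpM2r.
have inb t s : 0 <= t <= h -> 0 <= s <= h ->
    differentiable f (t *: u + (s *: v + x)) /\
    `|'D_u f (t *: u + (s *: v + x)) - 'D_u f x - 'd ('D_u f) x (t *: u + s *: v)|
      <= e / (2 * K) * (h * K).
  move=> th sh; have /Hr[A B] : ball (0 : V) r (t *: u + s *: v).
    by rewrite -ball_normE /= sub0r normrN (le_lt_trans (nb _ _ th sh)).
  rewrite addrA; split => //; apply: (le_trans B).
  by rewrite ler_wpM2l ?(ltW ek0) // nb.
have h00 : 0 <= h <= h by rewrite (ltW h0) lexx.
have z00 : 0 <= (0:R) <= h by rewrite (ltW h0) lexx.
pose phi y := f (h *: v + y) - f y.
have dphi t : 0 <= t <= h -> is_derive (t *: u + x) u phi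
    ('D_u f (h *: v + (t *: u + x)) - 'D_u f (t *: u + x)).
  move=> th; rewrite /phi.
  have A1 : differentiable f (t *: u + x) by have := (inb t 0 th z00).1; rewrite scale0r add0r.
  have A2 : differentiable f (h *: v + (t *: u + x)).
    by rewrite addrCA; exact: (inb t h th h00).1.
  have A3 : is_derive (t *: u + x) u (fun y => f (h *: v + y)) ('D_u f (h *: v + (t *: u + x))).
    have E : (fun k : R => k^-1 *: (((fun y => f (h *: v + y)) \o shift (t *: u + x)) (k *: u)
            - f (h *: v + (t *: u + x))))
       = (fun k : R => k^-1 *: ((f \o shift (h *: v + (t *: u + x))) (k *: u) - f (h *: v + (t *: u + x)))).
      by apply/funext => k /=; rewrite [_ *: v + (_ *: u + _)]addrCA.
    by split; [rewrite /derivable E; exact: diff_derivable | rewrite /derive E].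
  have A4 : is_derive (t *: u + x) u f ('D_u f (t *: u + x)).
    by apply: derivableP; exact: diff_derivable.
  exact: is_deriveB.
have dphi' t : 0 <= t <= h -> is_derive t (1 : R) (fun s : R => phi (s *: u + x))
    ('D_u f (t *: u + (h *: v + x)) - 'D_u f (t *: u + x)).
  move=> th; have [d1 d2] := dphi _ th; rewrite addrCA in d2.
  have E : (fun h : R => h^-1 *: (((fun s : R => phi (s *: u + x)) \o shift t) (h *: 1)
            - phi (t *: u + x)))
       = (fun h : R => h^-1 *: ((phi \o shift (t *: u + x)) (h *: u) - phi (t *: u + x))).
    by apply/funext => k /=; rewrite scalerDl -scalerA scale1r addrA.
  by split; [rewrite /derivable E | rewrite /derive E -d2].
have [||c ch] := @MVT_segment R (fun s : R => phi (s *: u + x))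
    (fun t => 'D_u f (t *: u + (h *: v + x)) - 'D_u f (t *: u + x)) 0 h (ltW h0).
- by move=> t /subset_itv_oo_cc; rewrite in_itv; exact: dphi'.
- by apply: derivable_within_continuous => t; rewrite in_itv => /dphi' [].
have {}ch : 0 <= c <= h by move: ch; rewrite in_itv.
have -> : f (h *: u + (h *: v + x)) - f (h *: v + x) - (f (h *: u + x) - f x)
  = phi (h *: u + x) - phi (0 *: u + x).
  by rewrite /phi scale0r add0r [h *: v + (h *: u + x)]addrCA; ring.
move=> ->; rewrite subr0.
have [_ b1] := inb c h ch h00; have [_] := inb c 0 ch z00.
rewrite scale0r add0r addr0 => b2.
have -> : 'D_v ('D_u f) x = 'd ('D_u f) x v by rewrite deriveE.
move: b1 b2; rewrite linearD /= [in 'd _ _ (h *: v)]linearZ /=.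
set D1 := 'D_u f (c *: u + (h *: v + x)); set D2 := 'D_u f (c *: u + x); set D0 := 'D_u f x.
set L1 := 'd _ _ (c *: u); set L2 := 'd _ _ v => b1 b2.
have -> : (D1 - D2) * h - h ^+ 2 * L2 = h * ((D1 - D0 - (L1 + h *: L2)) - (D2 - D0 - L1)).
  by rewrite /GRing.scale /=; ring.
rewrite normrM gtr0_norm // expr2 mulrCA ler_pM2l //.
apply: (le_trans (ler_normB _ _)); apply: (le_trans (lerD b1 b2)).
rewrite le_eqVlt; apply/orP; left; apply/eqP; field.
by rewrite gt_eqF.
Unshelve. all: by end_near. Qed.

(** The second difference is symmetric in u and v, so both mixed derivatives are the limit of its
    quotient by h^2. *)
Theorem schwarz (f : V -> R) (x u v : V) :
  (\near x, differentiable f x) -> differentiable ('D_u f) x ->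
  differentiable ('D_v f) x -> 'D_u ('D_v f) x = 'D_v ('D_u f) x.
Proof.
move=> ndf du dv; apply/eqP; rewrite -subr_eq0 -normr_le0.
apply/ler_addgt0Pr => e e0; rewrite add0r.
have e20 : 0 < e / 2 by rewrite divr_gt0.
have [d1 d10 H1] := second_difference v e20 ndf du.
have [d2 d20 H2] := second_difference u e20 ndf dv.
pose h := Num.min d1 d2 / 2.
have m0 : 0 < Num.min d1 d2 by rewrite lt_min d10.
have h0 : 0 < h by rewrite divr_gt0.
have hm : h < Num.min d1 d2 by rewrite ltr_pdivrMr // ltr_pMr // ltr1n.
have /andP[hd1 hd2] : (h < d1) && (h < d2) by rewrite -lt_min.
have b1 := H1 h (introT andP (conj h0 hd1)); have b2 := H2 h (introT andP (conj h0 hd2)).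
have h20 : 0 < h ^+ 2 by rewrite exprn_gt0.
rewrite -(ler_pM2l h20) -{1}(gtr0_norm h20) -normrM.
set A := 'D_v _ x in b1 *; set B := 'D_u _ x in b2 *.
move: b1 b2; rewrite [h *: u + (h *: v + x)]addrCA.
set a := f (h *: v + (h *: u + x)); set b := f (h *: v + x); set c := f (h *: u + x).
move=> b1 b2.
have -> : h ^+ 2 * (B - A) = (a - b - (c - f x) - h ^+ 2 * A) - (a - c - (b - f x) - h ^+ 2 * B).
  by ring.
apply: (le_trans (ler_normB _ _)); apply: (le_trans (lerD b1 b2)).
by rewrite -mulrDl -splitr mulrC.
Qed.

End MeanValue.

(** * Smooth scalar functions on an open set *)

Section ScalarRules.
Variables (R : realType) (V : normedModType R).
Implicit Types (f g : V -> R) (x v : V).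

Lemma differentiable_add f g x : differentiable f x -> differentiable g x ->
  differentiable (fun z => f z + g z) x.
Proof. exact: differentiableD. Qed.

Lemma differentiable_opp f x : differentiable f x ->
  differentiable (fun z => - f z) x.
Proof. exact: differentiableN. Qed.

Lemma differentiable_mul f g x : differentiable f x -> differentiable g x ->
  differentiable (fun z => f z * g z) x.
Proof. exact: differentiableM. Qed.

Lemma differentiable_inv f x : differentiable f x -> f x != 0 ->
  differentiable (fun z => (f z)^-1) x.
Proof. exact: differentiableV. Qed.

Lemma differentiable_sqrt f x : differentiable f x -> 0 < f x ->
  differentiable (fun z => Num.sqrt (f z)) x.
Proof.
move=> df f0; apply: (@differentiable_comp _ _ _ _ f Num.sqrt) => //.
by apply/derivable1_diffP; have [] := is_derive1_sqrt f0.
Qed.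

Lemma derive_add f g x v : differentiable f x -> differentiable g x ->
  'D_v (fun z => f z + g z) x = 'D_v f x + 'D_v g x.
Proof. by move=> df dg; apply: deriveD; exact: diff_derivable. Qed.

Lemma derive_opp f x v : differentiable f x ->
  'D_v (fun z => - f z) x = - 'D_v f x.
Proof. by move=> df; apply: deriveN; exact: diff_derivable. Qed.

Lemma derive_mul f g x v : differentiable f x -> differentiable g x ->
  'D_v (fun z => f z * g z) x = 'D_v f x * g x + f x * 'D_v g x.
Proof.
move=> df dg; have H := deriveM (@diff_derivable _ _ _ f x v df) (@diff_derivable _ _ _ g x v dg).
by apply: (etrans H); rewrite addrC; congr (_ + _); rewrite /GRing.scale /= mulrC.
Qed.

Lemma derive_inv f x v : differentiable f x -> f x != 0 ->
  'D_v (fun z => (f z)^-1) x = - 'D_v f x * ((f x)^-1 * (f x)^-1).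
Proof.
move=> df f0; have H := deriveV f0 (@diff_derivable _ _ _ f x v df).
by apply: (etrans H); rewrite /GRing.scale /= expr2 invfM mulrC mulrN mulNr.
Qed.

Lemma derive_Sqrt f x v : differentiable f x -> 0 < f x ->
  'D_v (fun z => Num.sqrt (f z)) x = 'D_v f x * (2^-1 * (Num.sqrt (f x))^-1).
Proof.
move=> df f0.
have ds : differentiable (Num.sqrt : R -> R) (f x).
  by apply/derivable1_diffP; have [] := is_derive1_sqrt f0.
rewrite deriveE; last exact: differentiable_sqrt.
have H := @diff_comp _ _ _ _ f Num.sqrt x df ds.
apply: (etrans (congr1 (fun h : V -> R => h v) H)); rewrite (deriveE v df).
by rewrite /= (diff1E ds) derive1E derive_sqrt // /GRing.scale /= invfM.
Qed.

(** Follows [smooth_on] in asking iterated derivatives to be differentiable, but along all vectors,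
    so that it makes sense on every normed module and passes through the algebraic operations by
    induction on n. *)
Fixpoint Ck (U : set V) n f : Prop :=
  if n is n'.+1 then
    (forall x, U x -> differentiable f x) /\ forall v, Ck U n' ('D_v f)
  else True.

Definition Cinf (U : set V) f := forall n, Ck U n f.

Variable U : set V.
Hypothesis openU : open U.

Lemma near_open (P : V -> Prop) x : U x -> (forall z, U z -> P z) -> \near x, P x.
Proof. by move=> Ux H; apply: filterS (open_nbhs_nbhs (conj openU Ux)) => z /H. Qed.

Lemma eq_on_derive f g x v : (forall z, U z -> f z = g z) -> U x ->
  'D_v f x = 'D_v g x.
Proof. by move=> fg Ux; apply: near_eq_derive; exact: near_open. Qed.

Lemma Ck_ext n f g : (forall z, U z -> f z = g z) -> Ck U n f -> Ck U n g.
Proof.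
elim: n f g => [//|n IH] f g fg [df cf]; split=> [x Ux|v].
  by apply: near_eq_differentiable (df x Ux); exact: near_open.
by apply: IH (cf v) => z Uz; exact: eq_on_derive.
Qed.

Lemma CkW n f : Ck U n.+1 f -> Ck U n f.
Proof.
by elim: n f => [//|n IH] f [df cf]; split=> // v; apply: IH.
Qed.

Lemma Ck_cst n (c : R) : Ck U n (fun=> c).
Proof.
elim: n c => [//|n IH] c; split=> [x _|v]; first exact: differentiable_cst.
by apply: Ck_ext (IH 0) => z _; rewrite (derive_cst c).
Qed.

Lemma Ck_add n f g : Ck U n f -> Ck U n g -> Ck U n (fun z => f z + g z).
Proof.
elim: n f g => [//|n IH] f g [df cf] [dg cg]; split=> [x Ux|v].
  by apply: differentiable_add; [exact: df|exact: dg].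
by apply: Ck_ext (IH _ _ (cf v) (cg v)) => z Uz; rewrite derive_add //; [exact: df|exact: dg].
Qed.

Lemma Ck_opp n f : Ck U n f -> Ck U n (fun z => - f z).
Proof.
elim: n f => [//|n IH] f [df cf]; split=> [x Ux|v].
  by apply: differentiable_opp; exact: df.
by apply: Ck_ext (IH _ (cf v)) => z Uz; rewrite derive_opp //; exact: df.
Qed.

Lemma Ck_mul n f g : Ck U n f -> Ck U n g -> Ck U n (fun z => f z * g z).
Proof.
elim: n f g => [//|n IH] f g cf0 cg0.
have [df cf] := cf0; have [dg cg] := cg0; split=> [x Ux|v].
  by apply: differentiable_mul; [exact: df|exact: dg].
have H := Ck_add (IH _ _ (cf v) (CkW cg0)) (IH _ _ (CkW cf0) (cg v)).
by apply: Ck_ext H => z Uz; rewrite derive_mul //; [exact: df|exact: dg].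
Qed.

Lemma Ck_inv n f : (forall z, U z -> f z != 0) -> Ck U n f ->
  Ck U n (fun z => (f z)^-1).
Proof.
move=> f0; elim: n => [//|n IH] cf0; have [df cf] := cf0; split=> [x Ux|v].
  by apply: differentiable_inv; [exact: df|exact: f0].
have I := IH (CkW cf0).
apply: Ck_ext (Ck_mul (Ck_opp (cf v)) (Ck_mul I I)) => z Uz.
by rewrite derive_inv //; [exact: df|exact: f0].
Qed.

Lemma Ck_sqrt n f : (forall z, U z -> 0 < f z) -> Ck U n f ->
  Ck U n (fun z => Num.sqrt (f z)).
Proof.
move=> f0; elim: n => [//|n IH] cf0; have [df cf] := cf0; split=> [x Ux|v].
  by apply: differentiable_sqrt; [exact: df|exact: f0].
have s0 z : U z -> Num.sqrt (f z) != 0 by move=> /f0 fz; rewrite gt_eqF ?sqrtr_gt0.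
apply: Ck_ext (Ck_mul (cf v) (Ck_mul (Ck_cst n 2^-1) (Ck_inv s0 (IH (CkW cf0))))) => z Uz.
by rewrite derive_Sqrt //; [exact: df|exact: f0].
Qed.

Lemma Cinf_ext f g : (forall z, U z -> f z = g z) -> Cinf U f -> Cinf U g.
Proof. by move=> fg cf n; exact: Ck_ext (cf n). Qed.

Lemma Cinf_cst (c : R) : Cinf U (fun=> c).
Proof. by move=> n; exact: Ck_cst. Qed.

Lemma Cinf_add f g : Cinf U f -> Cinf U g -> Cinf U (fun z => f z + g z).
Proof. by move=> cf cg n; exact: Ck_add. Qed.

Lemma Cinf_opp f : Cinf U f -> Cinf U (fun z => - f z).
Proof. by move=> cf n; exact: Ck_opp. Qed.

Lemma Cinf_mul f g : Cinf U f -> Cinf U g -> Cinf U (fun z => f z * g z).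
Proof. by move=> cf cg n; exact: Ck_mul. Qed.

Lemma Cinf_exp f k : Cinf U f -> Cinf U (fun z => f z ^+ k).
Proof.
move=> cf; elim: k => [|k IH]; first exact: Cinf_cst.
by apply: Cinf_ext (Cinf_mul cf IH) => z _; rewrite exprS.
Qed.

Lemma Cinf_inv f : (forall z, U z -> f z != 0) -> Cinf U f ->
  Cinf U (fun z => (f z)^-1).
Proof. by move=> f0 cf n; exact: Ck_inv. Qed.

Lemma Cinf_sqrt f : (forall z, U z -> 0 < f z) -> Cinf U f ->
  Cinf U (fun z => Num.sqrt (f z)).
Proof. by move=> f0 cf n; exact: Ck_sqrt. Qed.

Lemma Cinf_sum (I : Type) (r : seq I) (P : pred I) (F : I -> V -> R) :
  (forall i, P i -> Cinf U (F i)) -> Cinf U (fun z => \sum_(i <- r | P i) F i z).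
Proof.
move=> cF; elim: r => [|i r IH].
  by apply: Cinf_ext (Cinf_cst 0) => z _; rewrite big_nil.
case Pi : (P i); last by apply: Cinf_ext IH => z _; rewrite big_cons Pi.
by apply: Cinf_ext (Cinf_add (cF i Pi) IH) => z _; rewrite big_cons Pi.
Qed.

Lemma Cinf_differentiable f x : Cinf U f -> U x -> differentiable f x.
Proof. by move=> cf Ux; have [+ _] := cf 1%N; apply. Qed.

Lemma Cinf_derive f v : Cinf U f -> Cinf U ('D_v f).
Proof. by move=> cf n; have [_] := cf n.+1; apply. Qed.

Lemma Cinf_schwarz f x u v : Cinf U f -> U x ->
  'D_u ('D_v f) x = 'D_v ('D_u f) x.
Proof.
move=> cf Ux; apply: schwarz; last 2 first.
- by apply: Cinf_differentiable => //; exact: Cinf_derive.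
- by apply: Cinf_differentiable => //; exact: Cinf_derive.
by apply: near_open => // z Uz; exact: Cinf_differentiable.
Qed.

End ScalarRules.

(** * Vectors of R^3 and R^4 *)

Section Vec.
Variable R : realType.

Lemma ord3_ind (P : 'I_3 -> Prop) : P 0 -> P 1 -> P 2 -> forall i, P i.
Proof.
move=> P0 P1 P2 [[|[|[|//]]] i3].
- by rewrite (_ : Ordinal i3 = 0) //; exact/val_inj.
- by rewrite (_ : Ordinal i3 = 1) //; exact/val_inj.
- by rewrite (_ : Ordinal i3 = 2) //; exact/val_inj.
Qed.

Lemma ord4_ind (P : 'I_4 -> Prop) : P 0 -> P 1 -> P 2 -> P 3 -> forall i, P i.
Proof.
move=> P0 P1 P2 P3 [[|[|[|[|//]]]] i4].
- by rewrite (_ : Ordinal i4 = 0) //; exact/val_inj.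
- by rewrite (_ : Ordinal i4 = 1) //; exact/val_inj.
- by rewrite (_ : Ordinal i4 = 2) //; exact/val_inj.
- by rewrite (_ : Ordinal i4 = 3) //; exact/val_inj.
Qed.

Lemma ord2_ind (P : 'I_2 -> Prop) : P 0 -> P 1 -> forall i, P i.
Proof.
move=> P0 P1 [[|[|//]] i2].
- by rewrite (_ : Ordinal i2 = 0) //; exact/val_inj.
- by rewrite (_ : Ordinal i2 = 1) //; exact/val_inj.
Qed.

Lemma sum2E (V : nmodType) (F : 'I_2 -> V) : \sum_(i < 2) F i = F 0 + F 1.
Proof.
rewrite 2!big_ord_recr big_ord0 /= add0r.
by congr (F _ + F _); exact/val_inj.
Qed.

Lemma sum3E (V : nmodType) (F : 'I_3 -> V) : \sum_(i < 3) F i = F 0 + F 1 + F 2.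
Proof.
rewrite 3!big_ord_recr big_ord0 /= add0r.
by congr (F _ + F _ + F _); exact/val_inj.
Qed.

Lemma sum4E (V : nmodType) (F : 'I_4 -> V) :
  \sum_(i < 4) F i = F 0 + F 1 + F 2 + F 3.
Proof.
rewrite 4!big_ord_recr big_ord0 /= add0r.
by congr (F _ + F _ + F _ + F _); exact/val_inj.
Qed.

Definition vec3 (a b c : R) : 'rV[R]_3 := \row_i [:: a; b; c]`_i.
Definition vec4 (a b c d : R) : 'rV[R]_4 := \row_i [:: a; b; c; d]`_i.

Lemma vec3_0 a b c : vec3 a b c 0 0 = a. Proof. by rewrite mxE. Qed.
Lemma vec3_1 a b c : vec3 a b c 0 1 = b. Proof. by rewrite mxE. Qed.
Lemma vec3_2 a b c : vec3 a b c 0 2 = c. Proof. by rewrite mxE. Qed.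
Lemma vec4_0 a b c d : vec4 a b c d 0 0 = a. Proof. by rewrite mxE. Qed.
Lemma vec4_1 a b c d : vec4 a b c d 0 1 = b. Proof. by rewrite mxE. Qed.
Lemma vec4_2 a b c d : vec4 a b c d 0 2 = c. Proof. by rewrite mxE. Qed.
Lemma vec4_3 a b c d : vec4 a b c d 0 3 = d. Proof. by rewrite mxE. Qed.

Lemma addvE n (u v : 'rV[R]_n) k : (u + v) 0 k = u 0 k + v 0 k.
Proof. by rewrite mxE. Qed.
Lemma oppvE n (u : 'rV[R]_n) k : (- u) 0 k = - u 0 k.
Proof. by rewrite mxE. Qed.
Lemma scalevE n a (u : 'rV[R]_n) k : (a *: u) 0 k = a * u 0 k.
Proof. by rewrite mxE. Qed.
Lemma zerovE n k : (0 : 'rV[R]_n) 0 k = 0.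
Proof. by rewrite mxE. Qed.

Definition cross (u v : 'rV[R]_3) : 'rV[R]_3 :=
  vec3 (u 0 1 * v 0 2 - u 0 2 * v 0 1) (u 0 2 * v 0 0 - u 0 0 * v 0 2)
       (u 0 0 * v 0 1 - u 0 1 * v 0 0).

Definition diag3 (a b c : R) (u : 'rV[R]_3) : 'rV[R]_3 :=
  vec3 (a * u 0 0) (b * u 0 1) (c * u 0 2).

Definition vecE := (vec3_0, vec3_1, vec3_2, vec4_0, vec4_1, vec4_2, vec4_3,
  addvE, oppvE, scalevE, zerovE).

End Vec.

Ltac row3 := apply/rowP; elim/ord3_ind; rewrite /cross /diag3 ?vecE.
(** Entries of equal vectors may display their scalar type in different convertible forms; they are
    brought to one form and then abstracted into atoms for [ring]. *)
Ltac gen_entries := match goal with R : realType |- _ =>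
  repeat match goal with |- context [@fun_of_matrix ?T ?m ?n ?u ?i ?k] =>
    tryif constr_eq T (Real.sort R) then fail else
    change (@fun_of_matrix T m n u i k) with (@fun_of_matrix (Real.sort R) m n u i k) end;
  repeat match goal with |- context [@fun_of_matrix ?T ?m ?n ?u ?i ?k] =>
    generalize (@fun_of_matrix T m n u i k); intro end end.
Ltac gen_derive := repeat match goal with
  |- context [@derive ?R ?V ?W ?f ?a ?v] => generalize (@derive R V W f a v); intro end.
Ltac vring := gen_entries; ring.
Ltac row4 := apply/rowP; elim/ord4_ind; rewrite /cross /diag3 ?vecE.

Section Dot.
Variable R : realType.

Lemma dotE n (u v : 'rV[R]_n) : dot u v = \sum_i u 0 i * v 0 i.
Proof. by rewrite /dot mxE; apply: eq_bigr => i _; rewrite mxE. Qed.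

Lemma dot3E (u v : 'rV[R]_3) : dot u v = u 0 0 * v 0 0 + u 0 1 * v 0 1 + u 0 2 * v 0 2.
Proof. by rewrite dotE sum3E. Qed.

Lemma dot4E (u v : 'rV[R]_4) :
  dot u v = u 0 0 * v 0 0 + u 0 1 * v 0 1 + u 0 2 * v 0 2 + u 0 3 * v 0 3.
Proof. by rewrite dotE sum4E. Qed.

Lemma dotC n (u v : 'rV[R]_n) : dot u v = dot v u.
Proof. by rewrite !dotE; apply: eq_bigr => i _; rewrite mulrC. Qed.

Lemma dotDl n (u v w : 'rV[R]_n) : dot (u + v) w = dot u w + dot v w.
Proof. by rewrite !dotE -big_split; apply: eq_bigr => i _; rewrite mxE mulrDl. Qed.

Lemma dotZl n a (u w : 'rV[R]_n) : dot (a *: u) w = a * dot u w.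
Proof. by rewrite !dotE big_distrr /=; apply: eq_bigr => i _; rewrite mxE mulrA. Qed.

Lemma dotNl n (u w : 'rV[R]_n) : dot (- u) w = - dot u w.
Proof. by rewrite -scaleN1r dotZl mulN1r. Qed.

Lemma dot0l n (w : 'rV[R]_n) : dot 0 w = 0.
Proof. by rewrite -(scale0r 0) dotZl mul0r. Qed.

Lemma dotDr n (u v w : 'rV[R]_n) : dot w (u + v) = dot w u + dot w v.
Proof. by rewrite !(dotC w) dotDl. Qed.

Lemma dotZr n a (u w : 'rV[R]_n) : dot w (a *: u) = a * dot w u.
Proof. by rewrite !(dotC w) dotZl. Qed.

Lemma dotNr n (u w : 'rV[R]_n) : dot w (- u) = - dot w u.
Proof. by rewrite !(dotC w) dotNl. Qed.

Lemma dot0r n (w : 'rV[R]_n) : dot w 0 = 0.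
Proof. by rewrite dotC dot0l. Qed.

Definition dot_lin := (dotDl, dotDr, dotZl, dotZr, dotNl, dotNr, dot0l, dot0r).

Lemma dot_ge0 n (u : 'rV[R]_n) : 0 <= dot u u.
Proof. by rewrite dotE; apply: sumr_ge0 => i _; rewrite -expr2 sqr_ge0. Qed.

Lemma dot_eq0 n (u : 'rV[R]_n) : (dot u u == 0) = (u == 0).
Proof.
apply/eqP/eqP => [|->]; last exact: dot0l.
rewrite dotE => /eqP; rewrite psumr_eq0 => [|i _]; last by rewrite -expr2 sqr_ge0.
move=> /allP H; apply/rowP => i; rewrite mxE; apply/eqP.
by have := H i (mem_index_enum i); rewrite -expr2 sqrf_eq0.
Qed.

Lemma dot_gt0 n (u : 'rV[R]_n) : (0 < dot u u) = (u != 0).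
Proof. by rewrite lt_neqAle dot_ge0 andbT eq_sym dot_eq0. Qed.

Lemma sphereP n (r : R) (u : 'rV[R]_n) : 0 <= r -> sphere r u <-> dot u u = r ^+ 2.
Proof.
move=> r0; rewrite /sphere /enorm /=; split => [<-|->].
  by rewrite sqr_sqrtr // dot_ge0.
by rewrite sqrtr_sqr ger0_norm.
Qed.

End Dot.

(** * Smooth vector-valued maps *)

Section VectorCalculus.
Variables (R : realType) (V : normedModType R).

Definition Cinfv n (U : set V) (W : V -> 'rV[R]_n) :=
  forall k, Cinf U (fun z => W z 0 k).

Variable U : set V.
Hypothesis openU : open U.

Lemma differentiable_row n (W : V -> 'rV[R]_n) x :
  (forall k, differentiable (fun z => W z 0 k) x) -> differentiable W x.
Proof.
move=> dW; pose F (k : 'I_n) z : 'rV[R]_n := W z 0 k *: delta_mx 0 k.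
have -> : W = \sum_(k < n) F k.
  apply/funext => z; rewrite fct_sumE; exact: row_sum_delta.
apply: differentiable_sum => k.
exact: differentiableZl.
Qed.

Lemma Cinfv_differentiable n (W : V -> 'rV[R]_n) x :
  Cinfv U W -> U x -> differentiable W x.
Proof.
by move=> cW Ux; apply: differentiable_row => k; exact: Cinf_differentiable (cW k) Ux.
Qed.

Lemma derive_coord n (W : V -> 'rV[R]_n) x v k : differentiable W x ->
  ('D_v W x) 0 k = 'D_v (fun z => W z 0 k) x.
Proof. by move=> dW; rewrite derive_mx ?mxE //; exact: diff_derivable. Qed.

Lemma Cinfv_derive n (W : V -> 'rV[R]_n) v : Cinfv U W -> Cinfv U ('D_v W).
Proof.
move=> cW k; apply: Cinf_ext (Cinf_derive v (cW k)) => // z Uz.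
by rewrite derive_coord //; exact: Cinfv_differentiable.
Qed.

Lemma Cinfv_ext n (W W' : V -> 'rV[R]_n) :
  (forall z, U z -> W z = W' z) -> Cinfv U W -> Cinfv U W'.
Proof. by move=> E cW k; apply: Cinf_ext (cW k) => // z Uz; rewrite E. Qed.

Lemma eq_on_deriveV n (W W' : V -> 'rV[R]_n) x v :
  (forall z, U z -> W z = W' z) -> U x -> 'D_v W x = 'D_v W' x.
Proof.
by move=> fg Ux; apply: near_eq_derive; apply: filterS (open_nbhs_nbhs (conj openU Ux)) => z /fg.
Qed.

Lemma Cinfv_cst n (c : 'rV[R]_n) : Cinfv U (fun=> c).
Proof. by move=> k; exact: Cinf_cst. Qed.

Lemma Cinfv_add n (W W' : V -> 'rV[R]_n) :
  Cinfv U W -> Cinfv U W' -> Cinfv U (fun z => W z + W' z).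
Proof.
move=> cW cW' k; apply: Cinf_ext (Cinf_add openU (cW k) (cW' k)) => // z _.
by rewrite mxE.
Qed.

Lemma Cinfv_opp n (W : V -> 'rV[R]_n) : Cinfv U W -> Cinfv U (fun z => - W z).
Proof.
by move=> cW k; apply: Cinf_ext (Cinf_opp openU (cW k)) => // z _; rewrite mxE.
Qed.

Lemma Cinfv_scale n (g : V -> R) (W : V -> 'rV[R]_n) :
  Cinf U g -> Cinfv U W -> Cinfv U (fun z => g z *: W z).
Proof.
by move=> cg cW k; apply: Cinf_ext (Cinf_mul openU cg (cW k)) => // z _; rewrite mxE.
Qed.

Lemma Cinf_dot n (W W' : V -> 'rV[R]_n) :
  Cinfv U W -> Cinfv U W' -> Cinf U (fun z => dot (W z) (W' z)).
Proof.
move=> cW cW'.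
apply: (@Cinf_ext _ _ _ openU (fun z => \sum_i W z 0 i * W' z 0 i)) => [z _|].
  by rewrite dotE.
by apply: Cinf_sum => // i _; apply: Cinf_mul => //.
Qed.

Lemma Cinfv_vec3 (a b c : V -> R) : Cinf U a -> Cinf U b -> Cinf U c ->
  Cinfv U (fun z => vec3 (a z) (b z) (c z)).
Proof.
by move=> ca cb cc; elim/ord3_ind; [apply: Cinf_ext ca|apply: Cinf_ext cb|apply: Cinf_ext cc];
  move=> // z _; rewrite ?vecE.
Qed.

Lemma Cinfv_vec4 (a b c d : V -> R) : Cinf U a -> Cinf U b -> Cinf U c -> Cinf U d ->
  Cinfv U (fun z => vec4 (a z) (b z) (c z) (d z)).
Proof.
by move=> ca cb cc cd; elim/ord4_ind; [apply: Cinf_ext ca|apply: Cinf_ext cb|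
  apply: Cinf_ext cc|apply: Cinf_ext cd];
  move=> // z _; rewrite ?vecE.
Qed.

Lemma Cinfv_cross (W W' : V -> 'rV[R]_3) :
  Cinfv U W -> Cinfv U W' -> Cinfv U (fun z => cross (W z) (W' z)).
Proof.
move=> cW cW'; have M i j := Cinf_mul openU (cW i) (cW' j).
have S i j k l := Cinf_add openU (M i j) (Cinf_opp openU (M k l)).
by apply: Cinfv_vec3; exact: S.
Qed.

Lemma Cinfv_diag3 a b c (W : V -> 'rV[R]_3) :
  Cinfv U W -> Cinfv U (fun z => diag3 a b c (W z)).
Proof.
by move=> cW; apply: Cinfv_vec3; apply: Cinf_mul => //; exact: Cinf_cst.
Qed.

Section Rules.
Variables (x v : V).

Lemma deriveV_add n (W W' : V -> 'rV[R]_n) : differentiable W x -> differentiable W' x ->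
  'D_v (fun z => W z + W' z) x = 'D_v W x + 'D_v W' x.
Proof. by move=> dW dW'; apply: deriveD; exact: diff_derivable. Qed.

Lemma deriveV_opp n (W : V -> 'rV[R]_n) : differentiable W x ->
  'D_v (fun z => - W z) x = - 'D_v W x.
Proof. by move=> dW; apply: deriveN; exact: diff_derivable. Qed.

Lemma differentiable_scale n (g : V -> R) (W : V -> 'rV[R]_n) : differentiable g x ->
  differentiable W x -> differentiable (fun z => g z *: W z) x.
Proof.
move=> dg dW; apply: differentiable_row => k.
rewrite (_ : (fun z => _) = (fun z => g z * W z 0 k)); last by apply/funext => z; rewrite mxE.
apply: differentiable_mul => //.
exact: (differentiable_comp dW (differentiable_coord _ _ _)).
Qed.

Lemma differentiable_entry n (W : V -> 'rV[R]_n) k : differentiable W x ->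
  differentiable (fun z => W z 0 k) x.
Proof. by move=> dW; exact: (differentiable_comp dW (differentiable_coord _ _ _)). Qed.

Lemma deriveV_scale n (g : V -> R) (W : V -> 'rV[R]_n) : differentiable g x ->
  differentiable W x ->
  'D_v (fun z => g z *: W z) x = 'D_v g x *: W x + g x *: 'D_v W x.
Proof.
move=> dg dW; have dE k := differentiable_entry k dW.
apply/rowP => k; rewrite derive_coord; last exact: differentiable_scale.
rewrite (_ : (fun z => _) = (fun z => g z * W z 0 k)); last by apply/funext => z; rewrite mxE.
by rewrite derive_mul // !mxE derive_coord.
Qed.

Lemma derive_dot n (W W' : V -> 'rV[R]_n) : differentiable W x -> differentiable W' x ->
  'D_v (fun z => dot (W z) (W' z)) x = dot ('D_v W x) (W' x) + dot (W x) ('D_v W' x).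
Proof.
move=> dW dW'; have dE k := differentiable_entry k dW.
have dE' k := differentiable_entry k dW'.
pose F (k : 'I_n) z := W z 0 k * W' z 0 k.
rewrite (_ : (fun z => _) = \sum_k F k); last first.
  by apply/funext => z; rewrite dotE fct_sumE.
rewrite derive_sum => [|k]; last by apply: diff_derivable; exact: differentiable_mul.
rewrite !dotE -big_split; apply: eq_bigr => k _.
by rewrite derive_mul //= !derive_coord.
Qed.

End Rules.

Lemma Cinfv_schwarz n (W : V -> 'rV[R]_n) x u v : Cinfv U W -> U x ->
  'D_u ('D_v W) x = 'D_v ('D_u W) x.
Proof.
move=> cW Ux; have dW z (Uz : U z) := Cinfv_differentiable cW Uz.
have dD w : differentiable ('D_w W) x by apply: Cinfv_differentiable => //; exact: Cinfv_derive.
have E w k z (Uz : U z) : ('D_w W z) 0 k = 'D_w (fun z => W z 0 k) z.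
  exact: (derive_coord _ _ (dW z Uz)).
have E2 w w' k : ('D_w ('D_w' W) x) 0 k = 'D_w ('D_w' (fun z => W z 0 k)) x.
  have H := @derive_coord _ ('D_w' W) x w k (dD w').
  by apply: (etrans H); exact: (eq_on_derive openU _ (E w' k) Ux).
apply/rowP => k; apply: (etrans (E2 _ _ _)); apply: (etrans _ (esym (E2 _ _ _))).
exact: (Cinf_schwarz openU _ _ (cW k) Ux).
Qed.

End VectorCalculus.

Section HasDerive.
Variables (R : realType) (V : normedModType R) (x v : V).

(** Differentiability and the value travel together, so that [has_derive_tac] can follow the syntax
    of a function with the value left as an existential variable. *)
Definition has_derive (W : normedModType R) (f : V -> W) (d : W) :=
  differentiable f x /\ 'D_v f x = d.

Lemma has_deriveP (W : normedModType R) (f : V -> W) : differentiable f x -> has_derive f ('D_v f x).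
Proof. by []. Qed.

Lemma has_derive_eq (W : normedModType R) (f : V -> W) d e : has_derive f d -> d = e -> has_derive f e.
Proof. by move=> ? <-. Qed.

Lemma has_derive_cst (c : R) : has_derive (fun=> c : R) 0.
Proof. by split; [exact: differentiable_cst | exact: derive_cst]. Qed.

Lemma has_derive_add (f g : V -> R) d e : has_derive f d -> has_derive g e ->
  has_derive (fun z => f z + g z : R) (d + e).
Proof. by move=> [df <-] [dg <-]; split; [exact: differentiable_add | exact: derive_add]. Qed.

Lemma has_derive_opp (f : V -> R) d : has_derive f d -> has_derive (fun z => - f z : R) (- d).
Proof. by move=> [df <-]; split; [exact: differentiable_opp | exact: derive_opp]. Qed.

Lemma has_derive_mul (f g : V -> R) d e : has_derive f d -> has_derive g e ->
  has_derive (fun z => f z * g z : R) (d * g x + f x * e).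
Proof. by move=> [df <-] [dg <-]; split; [exact: differentiable_mul | exact: derive_mul]. Qed.

Lemma has_derive_entry n (f : V -> 'rV[R]_n) d k : has_derive f d ->
  has_derive (fun z => f z 0 k : R) (d 0 k).
Proof.
by move=> [df <-]; split; [exact: differentiable_entry | rewrite derive_coord].
Qed.

Lemma has_derive_ext (W : normedModType R) (f g : V -> W) d : f =1 g -> has_derive f d -> has_derive g d.
Proof. by move=> /funext ->. Qed.

Lemma has_derive_row n (f : V -> 'rV[R]_n) (d : 'rV[R]_n) :
  (forall k, has_derive (fun z => f z 0 k : R) (d 0 k)) -> has_derive f d.
Proof.
move=> H; have df : differentiable f x by apply: differentiable_row => k; exact: (H k).1.
by split=> //; apply/rowP => k; rewrite derive_coord // (H k).2.
Qed.

Lemma has_derive_addv n (f g : V -> 'rV[R]_n) d e : has_derive f d -> has_derive g e ->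
  has_derive (fun z => f z + g z) (d + e).
Proof. by move=> [df <-] [dg <-]; split; [exact: differentiableD | exact: deriveV_add]. Qed.

Lemma has_derive_scale n (a : V -> R) (f : V -> 'rV[R]_n) b d : has_derive a b ->
  has_derive f d -> has_derive (fun z => a z *: f z) (b *: f x + a x *: d).
Proof. by move=> [da <-] [df <-]; split; [exact: differentiable_scale | exact: deriveV_scale]. Qed.

Lemma has_derive_vec3 (a b c : V -> R) a' b' c' :
  has_derive a a' -> has_derive b b' -> has_derive c c' ->
  has_derive (fun z => vec3 (a z) (b z) (c z)) (vec3 a' b' c').
Proof.
move=> da db dc; apply: has_derive_row; elim/ord3_ind; rewrite vecE.
- by apply: has_derive_ext da => z; rewrite vecE.
- by apply: has_derive_ext db => z; rewrite vecE.
- by apply: has_derive_ext dc => z; rewrite vecE.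
Qed.

Lemma has_derive_vec4 (a b c d : V -> R) a' b' c' d' :
  has_derive a a' -> has_derive b b' -> has_derive c c' -> has_derive d d' ->
  has_derive (fun z => vec4 (a z) (b z) (c z) (d z)) (vec4 a' b' c' d').
Proof.
move=> da db dc dd; apply: has_derive_row; elim/ord4_ind; rewrite vecE.
- by apply: has_derive_ext da => z; rewrite vecE.
- by apply: has_derive_ext db => z; rewrite vecE.
- by apply: has_derive_ext dc => z; rewrite vecE.
- by apply: has_derive_ext dd => z; rewrite vecE.
Qed.

Lemma has_derive_inv (f : V -> R) d : f x != 0 -> has_derive f d ->
  has_derive (fun z => (f z)^-1 : R) (- d * ((f x)^-1 * (f x)^-1)).
Proof. by move=> f0 [df <-]; split; [exact: differentiable_inv | exact: derive_inv]. Qed.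

End HasDerive.

Lemma has_derive_id (R : realType) n (x v : 'rV[R]_n) : has_derive x v (fun z => z) v.
Proof. by split; [apply: differentiable_row => k; exact: differentiable_coord | exact: derive_id]. Qed.

Ltac has_derive_tac := repeat lazymatch goal with
  | |- has_derive _ _ (fun z => _ + _) _ => first [eapply has_derive_add | eapply has_derive_addv]
  | |- has_derive _ _ (fun z => _ *: _) _ => eapply has_derive_scale
  | |- has_derive _ _ (fun z => _ * _) _ => eapply has_derive_mul
  | |- has_derive _ _ (fun z => - _) _ => eapply has_derive_opp
  | |- has_derive _ _ (fun z => vec3 _ _ _) _ => eapply has_derive_vec3
  | |- has_derive _ _ (fun z => vec4 _ _ _ _) _ => eapply has_derive_vec4
  | |- has_derive _ _ (fun z => fun_of_matrix _ _ _) _ => eapply has_derive_entry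
  | |- has_derive _ _ (fun z => z) _ => eapply has_derive_id
  | |- _ => first [eassumption | eapply has_derive_cst]
  end.

Section DeriveVectors.
Variables (R : realType) (V : normedModType R) (x v : V).

Lemma derive_cross (W W' : V -> 'rV[R]_3) : differentiable W x -> differentiable W' x ->
  differentiable (fun z => cross (W z) (W' z)) x /\
  'D_v (fun z => cross (W z) (W' z)) x = cross ('D_v W x) (W' x) + cross (W x) ('D_v W' x).
Proof.
move=> /(has_deriveP v) dW /(has_deriveP v) dW'.
rewrite /cross; eapply has_derive_eq; first by has_derive_tac.
by row3; vring.
Qed.

Lemma derive_diag3 a b c (W : V -> 'rV[R]_3) : differentiable W x ->
  'D_v (fun z => diag3 a b c (W z)) x = diag3 a b c ('D_v W x).
Proof.
move=> /(has_deriveP v) dW.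
suff [] : has_derive x v (fun z => diag3 a b c (W z)) (diag3 a b c ('D_v W x)) by [].
rewrite /diag3; eapply has_derive_eq; first by has_derive_tac.
by row3; vring.
Qed.

End DeriveVectors.

Lemma derive_basis (R : realType) (W : normedModType R) (g : 'rV[R]_2 -> W) (v x : 'rV[R]_2) :
  differentiable g x ->
  'D_v g x = v 0 0 *: 'D_(basis_vector R 0) g x + v 0 1 *: 'D_(basis_vector R 1) g x.
Proof.
move=> dg; have {1}-> : v = v 0 0 *: basis_vector R 0 + v 0 1 *: basis_vector R 1.
  by apply/rowP; elim/ord2_ind; rewrite !mxE /= ?(mulr0, mulr1, addr0, add0r).
by rewrite (deriveDv _ _ dg) !(deriveZv _ _ dg).
Qed.

Lemma derive0_ball_cstV (R : realType) (V : normedModType R) n (g : V -> 'rV[R]_n) (x : V) (r : R) :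
  (forall y, ball x r y -> differentiable g y /\ forall v, 'D_v g y = 0) ->
  forall y, ball x r y -> g y = g x.
Proof.
move=> dg y xy; apply/rowP => k.
apply: (derive0_ball_cst (f := fun z => g z 0 k) _ xy) => z xz; have [d D] := dg z xz.
by split=> [|v]; [exact: differentiable_entry | rewrite -(derive_coord v k d) D mxE].
Qed.

Ltac cinf op := repeat lazymatch goal with
  | |- Cinf _ (fun x => _ + _) => apply: (Cinf_add op)
  | |- Cinf _ (fun x => _ * _) => apply: (Cinf_mul op)
  | |- Cinf _ (fun x => - _) => apply: (Cinf_opp op)
  | |- Cinf _ (fun x => dot _ _) => apply: (Cinf_dot op)
  | |- Cinf _ (fun x => _ ^+ _) => first [exact: (Cinf_cst op) | apply: (Cinf_exp op)]
  | |- Cinfv _ (fun x => _ + _) => apply: (Cinfv_add op)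
  | |- Cinfv _ (fun x => - _) => apply: (Cinfv_opp op)
  | |- Cinfv _ (fun x => _ *: _) => apply: (Cinfv_scale op)
  | |- Cinfv _ (fun x => cross _ _) => apply: (Cinfv_cross op)
  | |- Cinfv _ (fun x => diag3 _ _ _ _) => apply: (Cinfv_diag3 op)
  | |- Cinfv _ (fun x => vec3 _ _ _) => apply: (Cinfv_vec3 op)
  | |- Cinfv _ (fun x => vec4 _ _ _ _) => apply: (Cinfv_vec4 op)
  | |- _ => first [exact: (Cinf_cst op) | exact: (Cinfv_cst op) | assumption | match goal with H : _ |- _ => solve [apply H] end]
  end.

(** * The Levi-Civita connection of an orthonormal frame *)

Lemma crossDl (R : realType) (u v w : 'rV[R]_3) : cross (u + v) w = cross u w + cross v w.
Proof. by row3; vring. Qed.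

Lemma crossDr (R : realType) (u v w : 'rV[R]_3) : cross w (u + v) = cross w u + cross w v.
Proof. by row3; vring. Qed.

Lemma crossC (R : realType) (u v : 'rV[R]_3) : cross u v = - cross v u.
Proof. by row3; vring. Qed.

Lemma crossvv (R : realType) (u : 'rV[R]_3) : cross u u = 0.
Proof. by row3; vring. Qed.

Lemma crossZl (R : realType) k (u w : 'rV[R]_3) : cross (k *: u) w = k *: cross u w.
Proof. by row3; vring. Qed.

Lemma crossZr (R : realType) k (u w : 'rV[R]_3) : cross w (k *: u) = k *: cross w u.
Proof. by row3; vring. Qed.

Lemma dot_inj (R : realType) n (u v : 'rV[R]_n) : (forall w, dot u w = dot v w) -> u = v.
Proof.
move=> H; apply/eqP; rewrite -subr_eq0 -dot_eq0.
by rewrite dotDl dotNl H subrr.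
Qed.

(** * The Koszul formula for the coordinate connection *)

Section Koszul.
Variables (R : realType) (n : nat) (H : 'rV[R]_n -> 'M[R]_n) (y : 'rV[R]_n).
Hypothesis symH : (H y)^T = H y.
Hypothesis unitH : H y \in unitmx.
Hypothesis dH : forall i j, differentiable (fun z => H z i j) y.

Lemma metricE (z X Y : 'rV[R]_n) :
  metric H z X Y = \sum_i \sum_j X 0 i * H z i j * Y 0 j.
Proof.
rewrite /metric mxE exchange_big; apply: eq_bigr => j _.
by rewrite !mxE big_distrl.
Qed.

Lemma derive_metric (X Y Z : 'rV[R]_n) :
  'D_X (fun z => metric H z Y Z) y =
  \sum_i \sum_j \sum_l X 0 i * Y 0 j * Z 0 l
    * 'D_(basis_vector R i) (fun z => H z j l) y.
Proof.
pose F j l (z : 'rV[R]_n) := Y 0 j * Z 0 l * H z j l.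
have dc (c : R) : differentiable (fun _ : 'rV[R]_n => c) y by exact: differentiable_cst.
have dF j l : differentiable (F j l) y by exact: (differentiable_mul (dc _) (dH j l)).
have dS j : differentiable (\sum_l F j l) y by exact: differentiable_sum.
rewrite (_ : (fun z => _) = \sum_j \sum_l F j l); last first.
  apply/funext => z; rewrite metricE fct_sumE; apply: eq_bigr => j _.
  by rewrite fct_sumE; apply: eq_bigr => l _; rewrite /F; ring.
rewrite derive_sum => [|j]; last exact: diff_derivable.
under eq_bigr => j _.
  rewrite derive_sum => [|l]; last exact: diff_derivable.
  under eq_bigr => l _.
    rewrite (derive_mul _ (dc _) (dH j l)) (derive_cst (_ : R)) mul0r add0r.
    rewrite [X in 'D_X _ y](row_sum_delta X) deriveE // linear_sum /= big_distrr /=.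
    under eq_bigr => i _ do rewrite linearZ /= -(deriveE _ (dH j l)).
    over.
  rewrite exchange_big /=.
  over.
rewrite exchange_big; apply: eq_bigr => i _; apply: eq_bigr => j _.
by apply: eq_bigr => l _; rewrite /GRing.scale /=; ring.
Qed.

(** Constant fields have vanishing brackets, so only the three derivative terms of the Koszul
    formula remain. All later knowledge of the connection of the sphere comes from here. *)
Lemma Gamma_koszul (X Y Z : 'rV[R]_n) :
  metric H y (Gamma H y X Y) Z =
  2^-1 * ('D_X (fun z => metric H z Y Z) y + 'D_Y (fun z => metric H z X Z) y
          - 'D_Z (fun z => metric H z X Y) y).
Proof.
pose T i j l : R := 'D_(basis_vector R i) (fun z => H z j l) y.
have HV k l : \sum_m invmx (H y) m k * H y m l = (k == l)%:R.
  have := mulVmx unitH => /matrixP/(_ k l); rewrite !mxE => <-.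
  apply: eq_bigr => m _; congr (_ * _).
  by rewrite -[in RHS]symH -trmx_inv mxE.
rewrite !derive_metric metricE.
transitivity (2^-1 * (\sum_i \sum_j \sum_l X 0 i * Y 0 j * Z 0 l * (T i j l + T j i l - T l i j))).
  transitivity (\sum_k \sum_l \sum_i \sum_j \sum_m
     2^-1 * (X 0 i * Y 0 j * Z 0 l * (T i j m + T j i m - T m i j)) * (invmx (H y) k m * H y k l)).
    apply: eq_bigr => k _; apply: eq_bigr => l _.
    rewrite mxE -mulrA big_distrl; apply: eq_bigr => i _.
    rewrite big_distrl; apply: eq_bigr => j _ /=.
    rewrite /christoffel big_distrr /= !big_distrl /=; apply: eq_bigr => m _.
    by rewrite /T; ring.
  (* The sum over k is moved inwards, where the inverse metric contracts to a Kronecker delta. *)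
  rewrite exchange_big /=; under eq_bigr => l _.
    rewrite exchange_big /=; under eq_bigr => i _.
      rewrite exchange_big /=; under eq_bigr => j _.
        rewrite exchange_big /=; under eq_bigr => m _.
          rewrite -big_distrr /= HV mulr_natr mulrb.
          over.
        rewrite -big_mkcond big_pred1_eq.
        over.
      over.
    over.
  rewrite /= big_distrr /= exchange_big /=; apply: eq_bigr => i _.
  rewrite big_distrr /= exchange_big /=; apply: eq_bigr => j _.
  by rewrite big_distrr /=.
congr (_ * _).
have E2 : \sum_i \sum_j \sum_l Y 0 i * X 0 j * Z 0 l * T i j l =
          \sum_i \sum_j \sum_l X 0 i * Y 0 j * Z 0 l * T j i l.
  rewrite exchange_big; apply: eq_bigr => i _; apply: eq_bigr => j _.
  by apply: eq_bigr => l _; ring.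
have E3 : \sum_i \sum_j \sum_l Z 0 i * X 0 j * Y 0 l * T i j l =
          \sum_i \sum_j \sum_l X 0 i * Y 0 j * Z 0 l * T l i j.
  rewrite exchange_big; apply: eq_bigr => i _; rewrite exchange_big; apply: eq_bigr => j _.
  by apply: eq_bigr => l _; ring.
rewrite -/(T _ _ _) E2 E3 -big_split -sumrB; apply: eq_bigr => i _.
rewrite -big_split -sumrB; apply: eq_bigr => j _.
rewrite -big_split -sumrB; apply: eq_bigr => l _ /=.
by rewrite /T; ring.
Qed.

End Koszul.

Definition dmx (R : realType) (V : normedModType R) n p (A : V -> 'M[R]_(n, p)) (v x : V) :
    'M[R]_(n, p) :=
  \matrix_(i, j) 'D_v (fun z => A z i j) x.

Section MatrixProduct.
Variables (R : realType) (V : normedModType R) (n p : nat).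
Variables (W : V -> 'rV[R]_n) (A : V -> 'M[R]_(n, p)) (x : V).
Hypothesis dW : differentiable W x.
Hypothesis dA : forall i j, differentiable (fun z => A z i j) x.

Lemma differentiable_mulmx : differentiable (fun z => W z *m A z) x.
Proof.
apply: differentiable_row => j.
rewrite (_ : (fun z => _) = \sum_i (fun z => W z 0 i * A z i j)); last first.
  by apply/funext => z; rewrite mxE fct_sumE.
apply: differentiable_sum => i.
by apply: differentiable_mul => //; exact: differentiable_entry.
Qed.

Lemma derive_mulmx v :
  'D_v (fun z => W z *m A z) x = 'D_v W x *m A x + W x *m dmx A v x.
Proof.
have dE i := differentiable_entry i dW.
apply/rowP => j; rewrite (derive_coord _ _ differentiable_mulmx).
rewrite (_ : (fun z => _) = \sum_i (fun z => W z 0 i * A z i j)); last first.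
  by apply/funext => z; rewrite mxE fct_sumE.
rewrite derive_sum => [|i]; last first.
  by apply: diff_derivable; exact: (differentiable_mul (dE i) (dA i j)).
rewrite !mxE -big_split; apply: eq_bigr => i _ /=.
by rewrite (derive_mul _ (dE i) (dA i j)) mxE (derive_coord _ _ dW).
Qed.

End MatrixProduct.

(** * Orthonormal frames whose connection is a cross product *)

Section Frame.
Variables (R : realType) (H E C : 'rV[R]_3 -> 'M[R]_3) (l1 l2 l3 : R).
Let L := diag3 l1 l2 l3.
Let Q := diag3 (l2 * l3 - l1 * (l2 + l3)) (l1 * l3 - l2 * (l1 + l3))
               (l1 * l2 - l3 * (l1 + l2)).
Hypothesis EC : forall y, E y *m C y = 1%:M.
Hypothesis HE : forall y, H y = C y *m (C y)^T.
Hypothesis smoothE : forall i j, Cinf setT (fun y => E y i j).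
Hypothesis smoothC : forall i j, Cinf setT (fun y => C y i j).
Hypothesis bracket : forall y a b,
  b *m dmx E (a *m E y) y - a *m dmx E (b *m E y) y
    = (cross (L a) b - cross (L b) a) *m E y.

Let CE y : C y *m E y = 1%:M. Proof. exact: mulmx1C. Qed.

Let dE y i j : differentiable (fun z => E z i j) y.
Proof. exact: (Cinf_differentiable (smoothE i j)). Qed.

Let dC y i j : differentiable (fun z => C z i j) y.
Proof. exact: (Cinf_differentiable (smoothC i j)). Qed.

Implicit Types (y a b c X Y Z : 'rV[R]_3).

Lemma frame_inj y a b : a *m E y = b *m E y -> a = b.
Proof. by move=> ab; rewrite -[a]mulmx1 -(EC y) mulmxA ab -mulmxA EC mulmx1. Qed.

Lemma frame_metric y X Y : metric H y X Y = dot (X *m C y) (Y *m C y).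
Proof. by rewrite /metric HE /dot trmx_mul !mulmxA. Qed.

Lemma frame_metricE y a b : metric H y (a *m E y) (b *m E y) = dot a b.
Proof. by rewrite frame_metric -!mulmxA EC !mulmx1. Qed.

Lemma frame_sym y : (H y)^T = H y.
Proof. by rewrite HE trmx_mul trmxK. Qed.

Lemma frame_unit y : H y \in unitmx.
Proof.
have [uC _] := mulmx1_unit (CE y).
by rewrite HE unitmx_mul unitmx_tr uC.
Qed.

Lemma frame_differentiable y i j : differentiable (fun z => H z i j) y.
Proof.
rewrite (_ : (fun z => _) = \sum_k (fun z => C z i k * C z j k)); last first.
  apply/funext => z; rewrite HE mxE fct_sumE.
  by apply: eq_bigr => k _; rewrite mxE.
by apply: differentiable_sum => k; exact: differentiable_mul.
Qed.

(* Constant vector fields have non-constant frame components; differentiating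
   [(b *m E) *m C = b] expresses their derivatives through those of the frame. *)
Let derive_frame_metric y X b c :
  'D_X (fun z => metric H z (b *m E y) (c *m E y)) y
    = - dot (b *m dmx E X y *m C y) c - dot b (c *m dmx E X y *m C y).
Proof.
have dcst (u : 'rV[R]_3) : differentiable (fun _ : 'rV[R]_3 => u) y by exact: differentiable_cst.
have K (u : 'rV[R]_3) : 'D_X (fun z => (u *m E y) *m C z) y = - (u *m dmx E X y *m C y).
  have dP : differentiable (fun z => u *m E z) y.
    by apply: differentiable_mulmx => //; exact: dcst.
  have := derive_mulmx dP (dC y) X.
  rewrite (_ : (fun z => _) = fun=> u); last first.
    by apply/funext => z; rewrite -mulmxA EC mulmx1.
  rewrite (derive_cst u) (derive_mulmx (dcst u) (dE y)) (derive_cst u) mul0mx add0r.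
  rewrite (derive_mulmx (dcst _) (dC y)) (derive_cst _) mul0mx add0r.
  by move/esym/eqP; rewrite addrC addr_eq0 => /eqP.
have dK (u : 'rV[R]_3) : differentiable (fun z => (u *m E y) *m C z) y.
  by apply: differentiable_mulmx => //; exact: dcst.
rewrite (_ : (fun z => _) = fun z => dot ((b *m E y) *m C z) ((c *m E y) *m C z)); last first.
  by apply/funext => z; rewrite frame_metric.
rewrite (derive_dot _ (dK b) (dK c)) !K -[b *m E y *m C y]mulmxA EC mulmx1.
by rewrite -[c *m E y *m C y]mulmxA EC mulmx1 !dot_lin.
Qed.

(** The left side is the covariant derivative of the field with constant frame components b. The
    right side is a metric connection, a cross product being skew, and [bracket] says that it is
    torsion free; the Koszul formula leaves no other choice. *)
Lemma frame_Gamma y a b :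
  Gamma H y (a *m E y) (b *m E y) + b *m dmx E (a *m E y) y = cross (L a) b *m E y.
Proof.
(* [A a b] holds the frame components of the Euclidean derivative, along a, of the field with
   components b. *)
pose A (a b : 'rV[R]_3) := b *m dmx E (a *m E y) y *m C y.
have brA u w : A u w - A w u = cross (L u) w - cross (L w) u.
  by rewrite /A -mulmxBl bracket -mulmxA EC mulmx1.
suff G : Gamma H y (a *m E y) (b *m E y) *m C y = cross (L a) b - A a b.
  rewrite -[X in X + _]mulmx1 -(CE y) mulmxA G mulmxBl /A.
  by rewrite -[_ *m C y *m E y]mulmxA CE mulmx1 subrK.
apply: dot_inj => c.
have := Gamma_koszul (frame_sym y) (frame_unit y) (frame_differentiable y)
  (a *m E y) (b *m E y) (c *m E y).
rewrite frame_metric -[c *m E y *m C y]mulmxA EC mulmx1 => ->.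
have dA u v w : 'D_(u *m E y) (fun z => metric H z (v *m E y) (w *m E y)) y
    = - dot (A u v) w - dot v (A u w) by exact: derive_frame_metric.
rewrite !dA; have := brA a b; have := brA a c; have := brA b c.
move: (A a b) (A b a) (A a c) (A c a) (A b c) (A c b) => {dA brA A} ab ba ac ca bc cb.
move=> /(canRL (subrK _)) -> /(canRL (subrK _)) -> /(canRL (subrK _)) ->.
rewrite !dot_lin !dot3E /L /cross /diag3 !vecE.
by gen_entries; field.
Qed.

Section Along.
Variables (m : nat) (U : set 'rV[R]_m) (F : 'rV[R]_m -> 'rV[R]_3).
Variable (th : 'rV[R]_m -> 'rV[R]_m -> 'rV[R]_3).
Hypothesis openU : open U.
Hypothesis smoothF : Cinfv U F.
Hypothesis smooth_th : forall v, Cinfv U (th v).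
Hypothesis thE : forall v x, U x -> 'D_v F x = th v x *m E (F x).

(** The pull-back connection [covD] in frame components, as [covD_frame] shows. *)
Definition nab (v : 'rV[R]_m) (w : 'rV[R]_m -> 'rV[R]_3) (x : 'rV[R]_m) :=
  'D_v w x + cross (L (th v x)) (w x).

Let dEF i j x : U x -> differentiable (fun z => E (F z) i j) x.
Proof.
move=> Ux; apply: (@differentiable_comp _ _ _ _ F (fun y => E y i j)).
  exact: (Cinfv_differentiable smoothF).
exact: dE.
Qed.

Let dmxEF v x : U x -> dmx (fun z => E (F z)) v x = dmx E ('D_v F x) (F x).
Proof.
move=> Ux; have dF := Cinfv_differentiable smoothF Ux.
apply/matrixP => i j; rewrite !mxE !(deriveE _ (dE _ _ _)) deriveE; last exact: dEF.
rewrite (@diff_comp _ _ _ _ F (fun y => E y i j) x dF (dE _ _ _)) /=.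
by rewrite (deriveE _ dF).
Qed.

Lemma derive_frame v (w : 'rV[R]_m -> 'rV[R]_3) x : U x -> differentiable w x ->
  'D_v (fun z => w z *m E (F z)) x
    = 'D_v w x *m E (F x) + w x *m dmx E (th v x *m E (F x)) (F x).
Proof.
move=> Ux dw; have H1 i j := dEF i j Ux.
by apply: (etrans (derive_mulmx dw H1 v)); rewrite (dmxEF v Ux) (thE v Ux).
Qed.

Lemma covD_frame v (W w : 'rV[R]_m -> 'rV[R]_3) x : U x -> differentiable w x ->
  (forall z, U z -> W z = w z *m E (F z)) ->
  covD H F v W x = nab v w x *m E (F x).
Proof.
move=> Ux dw WE; rewrite /covD (eq_on_deriveV openU v WE Ux) WE // thE //.
rewrite derive_frame // /nab mulmxDl -frame_Gamma.
by rewrite -!addrA [X in _ + X]addrC.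
Qed.

(** The Maurer-Cartan equation: second derivatives of [F] commute, and what differentiating the
    frame leaves over is a bracket. *)
Lemma structure_equation u v x : U x ->
  'D_u (th v) x - 'D_v (th u) x + (cross (L (th u x)) (th v x) - cross (L (th v x)) (th u x)) = 0.
Proof.
move=> Ux; have dth w := Cinfv_differentiable (smooth_th w) Ux.
have D s t : 'D_s ('D_t F) x = 'D_s (th t) x *m E (F x)
    + th t x *m dmx E (th s x *m E (F x)) (F x).
  by rewrite (eq_on_deriveV openU s (fun z Uz => thE t Uz) Ux) derive_frame.
have := Cinfv_schwarz openU u v smoothF Ux; rewrite !D => S.
apply: (@frame_inj (F x)); rewrite mul0mx mulmxDl mulmxBl -bracket.
move/eqP: S; rewrite -subr_eq0 => /eqP <-.
by rewrite opprD addrACA.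
Qed.

Lemma Cinfv_nab v w : Cinfv U w -> Cinfv U (nab v w).
Proof.
move=> cw; apply: Cinfv_add => //; first exact: Cinfv_derive.
by apply: Cinfv_cross => //; exact: Cinfv_diag3.
Qed.

Section Rules.
Variables (v x : 'rV[R]_m).
Hypothesis Ux : U x.

Lemma nab_add w w' : differentiable w x -> differentiable w' x ->
  nab v (fun z => w z + w' z) x = nab v w x + nab v w' x.
Proof.
by move=> dw dw'; rewrite /nab deriveV_add // crossDr addrACA.
Qed.

Lemma nab_opp w : differentiable w x -> nab v (fun z => - w z) x = - nab v w x.
Proof.
move=> dw; rewrite /nab deriveV_opp // opprD; congr (_ + _).
by rewrite -[- w x]scaleN1r crossZr scaleN1r.
Qed.

Lemma nab_scale (g : 'rV[R]_m -> R) w : differentiable g x -> differentiable w x ->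
  nab v (fun z => g z *: w z) x = 'D_v g x *: w x + g x *: nab v w x.
Proof.
by move=> dg dw; rewrite /nab deriveV_scale // crossZr scalerDr addrA.
Qed.

Lemma nab_cross w w' : differentiable w x -> differentiable w' x ->
  nab v (fun z => cross (w z) (w' z)) x
    = cross (nab v w x) (w' x) + cross (w x) (nab v w' x).
Proof.
move=> dw dw'; rewrite /nab (derive_cross v dw dw').2 crossDl crossDr.
by row3; vring.
Qed.

Lemma derive_dot_nab w w' : differentiable w x -> differentiable w' x ->
  'D_v (fun z => dot (w z) (w' z)) x = dot (nab v w x) (w' x) + dot (w x) (nab v w' x).
Proof.
move=> dw dw'; rewrite derive_dot // /nab !dot_lin.
rewrite !(dot3E _ (cross _ _)) !(dot3E (cross _ _)) /cross !vecE.
by move: (dot _ _) (dot _ _) => p q; vring.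
Qed.

End Rules.

(** Ricci identity. With a, b the values of the coframe, the structure equation replaces its
    exterior derivative by [- (tr L - L) (a x b)], while [(L a) x (L b)] is the cofactor matrix of L
    applied to [a x b]; hence [Q] is [cof L - L (tr L - L)]. *)
Lemma nab_comm u v w x : U x -> Cinfv U w ->
  nab u (nab v w) x - nab v (nab u w) x = cross (Q (cross (th u x) (th v x))) (w x).
Proof.
move=> Ux cw; have dth t := Cinfv_differentiable (smooth_th t) Ux.
have dw := Cinfv_differentiable cw Ux.
have dDw t : differentiable ('D_t w) x.
  by apply: (Cinfv_differentiable _ Ux); exact: Cinfv_derive.
have dL t : differentiable (fun z => L (th t z)) x.
  by apply: (Cinfv_differentiable _ Ux); exact: Cinfv_diag3.
have dX t : differentiable (fun z => cross (L (th t z)) (w z)) x.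
  by apply: (Cinfv_differentiable _ Ux); apply: Cinfv_cross => //; exact: Cinfv_diag3.
have Enab s t : 'D_s (nab t w) x = 'D_s ('D_t w) x + (cross (L ('D_s (th t) x)) (w x)
     + cross (L (th t x)) ('D_s w x)).
  by rewrite /nab (deriveV_add _ (dDw t) (dX t)) (derive_cross _ (dL t) dw).2 derive_diag3.
rewrite /nab in Enab *; rewrite !{}Enab (Cinfv_schwarz openU u v cw Ux).
have := structure_equation u v Ux.
move: ('D_v ('D_u w) x) ('D_u w x) ('D_v w x) => a b c.
move/eqP; rewrite addr_eq0 subr_eq => /eqP ->.
by rewrite /Q /L; row3; vring.
Qed.

End Along.

(** The Ricci identity for [F] the identity map, whose coframe is [v *m C z]. *)
Lemma curvature_frame y X Y Z :
  curvature H y X Y Z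
    = cross (Q (cross (X *m C y) (Y *m C y))) (Z *m C y) *m E y.
Proof.
pose th (v z : 'rV[R]_3) := v *m C z.
have oT : open [set: 'rV[R]_3] by exact: openT.
have sth v : Cinfv setT (th v).
  move=> k; apply: (@Cinf_ext _ _ _ oT (fun z => \sum_i v 0 i * C z i k)).
    by move=> z _; rewrite mxE.
  by apply: Cinf_sum => // i _; apply: Cinf_mul => //; exact: Cinf_cst.
have sid : Cinfv [set: 'rV[R]_3] id.
  move=> k n; elim: n => [//|n _]; split=> [z _|v]; first exact: differentiable_coord.
  apply: (@Ck_ext _ _ _ oT _ (fun=> v 0 k)); last exact: Ck_cst.
  have did z : differentiable (fun z : 'rV[R]_3 => z) z.
    by apply: differentiable_row => j; exact: differentiable_coord.
  move=> z _; have := derive_coord v k (did z).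
  by rewrite derive_id => ->.
have thE v x : setT x -> 'D_v id x = th v x *m E x.
  by move=> _; rewrite derive_id /th -mulmxA CE mulmx1.
have dw w z : Cinfv setT w -> differentiable (w : 'rV[R]_3 -> 'rV[R]_3) z.
  by move=> cw; exact: (Cinfv_differentiable cw).
have c1 v z : covD H id v (cst Z) z = nab th v (th Z) z *m E z.
  apply: (covD_frame oT sid thE) => //; first exact: dw.
  by move=> z' _; rewrite /th -mulmxA CE mulmx1.
have c2 u v : covD H id u (covD H id v (cst Z)) y = nab th u (nab th v (th Z)) y *m E y.
  apply: (covD_frame oT sid thE) => //; first by apply: dw; exact: Cinfv_nab.
rewrite /curvature !c2 -mulmxBl.
by rewrite (nab_comm oT sid sth thE).
Qed.

End Frame.

(** * The Hopf fields and the Berger metric *)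

Section HopfFields.
Variable R : realType.
Implicit Types p v X Y : 'rV[R]_4.

(** [hopf1], [hopf2] and [hopf3] are three anticommuting complex structures of R^4, quaternion units
    acting on p; [hopf3] is tangent to the Hopf fibres. *)
Definition hopf1 p := vec4 (- p 0 2) (p 0 3) (p 0 0) (- p 0 1).
Definition hopf2 p := vec4 (p 0 3) (p 0 2) (- p 0 1) (- p 0 0).
Definition hopf3 p := vec4 (- p 0 1) (p 0 0) (- p 0 3) (p 0 2).

(** The symmetric bilinear map with [dhopf p p = 2 *: hopf p], hence the derivative of [hopf] at
    p. *)
Definition dhopf p v := vec3
  (v 0 0 * p 0 2 + p 0 0 * v 0 2 + v 0 1 * p 0 3 + p 0 1 * v 0 3)
  (v 0 1 * p 0 2 + p 0 1 * v 0 2 - v 0 0 * p 0 3 - p 0 0 * v 0 3)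
  (v 0 0 * p 0 0 + v 0 1 * p 0 1 - v 0 2 * p 0 2 - v 0 3 * p 0 3).

Lemma hopfE p : hopf p = vec3 (p 0 0 * p 0 2 + p 0 1 * p 0 3)
  (p 0 1 * p 0 2 - p 0 0 * p 0 3)
  (2^-1 * (p 0 0 * p 0 0 + p 0 1 * p 0 1 - p 0 2 * p 0 2 - p 0 3 * p 0 3)).
Proof.
by apply/rowP; elim/ord3_ind; rewrite vecE !mxE /=; gen_entries; field.
Qed.

Lemma Cinf_coord n (U : set 'rV[R]_n) (k : 'I_n) : open U -> Cinf U (fun y : 'rV[R]_n => y 0 k).
Proof.
move=> oU j; elim: j => [//|j _]; split=> [z _|v]; first exact: differentiable_coord.
apply: (@Ck_ext _ _ _ oU _ (fun=> v 0 k)); last exact: Ck_cst.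
have did z : differentiable (fun z : 'rV[R]_n => z) z.
  by apply: differentiable_row => i; exact: differentiable_coord.
by move=> z _; have := derive_coord v k (did z); rewrite derive_id => ->.
Qed.

Lemma has_derive_dhopf (V : normedModType R) (x v : V) (f g : V -> 'rV[R]_4) f' g' :
  has_derive x v f f' -> has_derive x v g g' ->
  has_derive x v (fun z => dhopf (f z) (g z)) (dhopf f' (g x) + dhopf (f x) g').
Proof.
move=> df dg; rewrite /dhopf; eapply has_derive_eq; first by has_derive_tac.
by row3; vring.
Qed.

Lemma derive_hopf p v : differentiable (@hopf R) p /\ 'D_v (@hopf R) p = dhopf p v.
Proof.
rewrite (funext hopfE) -/(has_derive _ _ _ _); eapply has_derive_eq; first by has_derive_tac.
by rewrite /dhopf; row3; gen_entries; field.
Qed.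

(** Components in [hopf1], [hopf2] and [hopf3] divided by eps, a frame that is orthonormal for the
    Berger metric; hence the factor eps. *)
Definition hcoord eps p X := vec3 (dot X (hopf1 p)) (dot X (hopf2 p)) (eps * dot X (hopf3 p)).

Lemma hopf_basis p X : dot p p = 1 -> dot X p = 0 ->
  X = dot X (hopf1 p) *: hopf1 p + dot X (hopf2 p) *: hopf2 p + dot X (hopf3 p) *: hopf3 p.
Proof.
move=> pp Xp.
(* In homogeneous form this is a polynomial identity in all entries; the two constraints are
   inserted afterwards. *)
suff E : dot p p *: X = dot X p *: p + (dot X (hopf1 p) *: hopf1 p
    + dot X (hopf2 p) *: hopf2 p + dot X (hopf3 p) *: hopf3 p).
  by move: E; rewrite pp Xp scale1r scale0r add0r.
by rewrite !dot4E; row4; rewrite /hopf1 /hopf2 /hopf3 ?vecE; vring.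
Qed.

Lemma vertical_sub p m (X : 'M_(m, 4)) : dot p p = 1 ->
  (X <= vertical p)%MS = (X <= hopf3 p)%MS.
Proof.
move=> pp.
have inV : (hopf3 p <= vertical p)%MS.
  rewrite /vertical sub_capmx; apply/andP; split; apply/sub_kermxP.
    apply/rowP => i; rewrite ord1 [RHS]mxE -/(dot _ _) dot4E /hopf3 !vecE; vring.
  have [dh dhE] := derive_hopf p (hopf3 p).
  rewrite -deriveEjacobian // dhE /dhopf /hopf3; row3; vring.
apply/idP/idP => [|/submx_trans]; last exact.
move=> XV; apply/row_subP => i; move: (row_subP XV i).
move: (row i X) => v; rewrite /vertical sub_capmx => /andP[/sub_kermxP v1 /sub_kermxP v2].
have vp : dot v p = 0 by rewrite /dot v1 mxE.
have [dh dhE] := derive_hopf p v.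
move: v2; rewrite -deriveEjacobian // dhE => v2.
(* On the unit sphere [dhopf p] maps [hopf1 p] and [hopf2 p] to orthonormal vectors, so pairing with
   these images reads off the horizontal components of v. *)
have P1 : dot (dhopf p v) (dhopf p (hopf1 p)) = dot p p * dot v (hopf1 p).
  by rewrite dot3E !dot4E /dhopf /hopf1 !vecE; vring.
have P2 : dot (dhopf p v) (dhopf p (hopf2 p)) = dot p p * dot v (hopf2 p).
  by rewrite dot3E !dot4E /dhopf /hopf2 !vecE; vring.
move: P1 P2; rewrite v2 !dot0l pp !mul1r => P1 P2.
by rewrite [v](hopf_basis pp vp) -P1 -P2 !scale0r !add0r scalemx_sub.
Qed.

Lemma horizontal_sub p v : dot p p = 1 ->
  (v <= horizontal p)%MS = (dot v p == 0) && (dot v (hopf3 p) == 0).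
Proof.
move=> pp; rewrite /horizontal sub_capmx; congr (_ && _).
  apply/sub_kermxP/eqP => [v1|v1]; first by rewrite /dot v1 mxE.
  by apply/rowP => i; rewrite ord1 [RHS]mxE.
have inV : (hopf3 p <= vertical p)%MS by rewrite vertical_sub.
have Vin : (vertical p <= hopf3 p)%MS by rewrite -vertical_sub.
apply/sub_kermxP/eqP => [v1|v1].
  have /submxP[D DE] := inV.
  by rewrite /dot {1}DE trmx_mul mulmxA v1 mul0mx mxE.
have /submxP[D DE] := Vin.
rewrite DE trmx_mul mulmxA (_ : v *m (hopf3 p)^T = 0) ?mul0mx //.
by apply/rowP => i; rewrite ord1 [RHS]mxE.
Qed.

Lemma berger_metricE eps p X Y : dot p p = 1 -> dot X p = 0 -> dot Y p = 0 ->
  berger_metric eps p X Y = dot (hcoord eps p X) (hcoord eps p Y).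
Proof.
move=> pp Xp Yp.
have h1p : dot (hopf1 p) p = 0 by rewrite dot4E /hopf1 !vecE; vring.
have h2p : dot (hopf2 p) p = 0 by rewrite dot4E /hopf2 !vecE; vring.
have h13 : dot (hopf1 p) (hopf3 p) = 0 by rewrite dot4E /hopf1 /hopf3 !vecE; vring.
have h23 : dot (hopf2 p) (hopf3 p) = 0 by rewrite dot4E /hopf2 /hopf3 !vecE; vring.
have h12 : dot (hopf1 p) (hopf2 p) = 0 by rewrite dot4E /hopf1 /hopf2 !vecE; vring.
have h11 : dot (hopf1 p) (hopf1 p) = 1 by rewrite -pp !dot4E /hopf1 !vecE; vring.
have h22 : dot (hopf2 p) (hopf2 p) = 1 by rewrite -pp !dot4E /hopf2 !vecE; vring.
have h33 : dot (hopf3 p) (hopf3 p) = 1 by rewrite -pp !dot4E /hopf3 !vecE; vring.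
(* [proj_mx_id] and [proj_mx_0] apply only once the two row spaces are known to meet in 0. *)
have d0 : (horizontal p :&: vertical p = 0)%MS.
  apply/eqP; rewrite -submx0; apply/rV_subP => v; rewrite sub_capmx => /andP[].
  rewrite horizontal_sub // vertical_sub // => /andP[_ /eqP v3] /sub_rVP[a vE].
  by move: v3; rewrite vE dotZl h33 mulr1 => ->; rewrite scale0r sub0mx.
have d0' : (vertical p :&: horizontal p = 0)%MS by rewrite capmxC.
have hor X' : dot X' p = 0 ->
    X' *m proj_mx (horizontal p) (vertical p)
      = dot X' (hopf1 p) *: hopf1 p + dot X' (hopf2 p) *: hopf2 p /\
    X' *m proj_mx (vertical p) (horizontal p) = dot X' (hopf3 p) *: hopf3 p.
  move=> Xp'; set x1 := dot X' (hopf1 p); set x2 := dot X' (hopf2 p).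
  have hH : ((x1 *: hopf1 p + x2 *: hopf2 p)%R <= horizontal p)%MS.
    by rewrite horizontal_sub // !dot_lin h1p h2p h13 h23 !mulr0 addr0 eqxx.
  have hV : (dot X' (hopf3 p) *: hopf3 p <= vertical p)%MS.
    by rewrite vertical_sub // scalemx_sub.
  have E := hopf_basis pp Xp'; rewrite -/x1 -/x2 in E.
  split; rewrite {1}E mulmxDl; first by rewrite proj_mx_id // proj_mx_0 // addr0.
  by rewrite proj_mx_0 // proj_mx_id // add0r.
rewrite /berger_metric (hor _ Xp).1 (hor _ Xp).2 (hor _ Yp).1 (hor _ Yp).2.
rewrite !dot_lin [dot (hopf2 p) (hopf1 p)]dotC h11 h12 h22 h33.
rewrite dot3E /hcoord !vecE.
by move: (dot X _) (dot X _) (dot X _) (dot Y _) (dot Y _) (dot Y _) => a b c d e f; ring.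
Qed.

End HopfFields.

(** * The Hopf frame in stereographic coordinates *)

Section Stereographic.
Variables (R : realType) (eps : R).
Hypothesis eps0 : eps != 0.
Implicit Types (y v : 'rV[R]_3) (s : bool).

(** Half of the conformal factor of stereographic projection. *)
Definition half_inv y : R := (dot y y + 1)^-1.

Lemma dot1_gt0 y : 0 < dot y y + 1.
Proof. by rewrite ltr_wpDl ?dot_ge0. Qed.

Lemma dot1_neq0 y : dot y y + 1 != 0.
Proof. by rewrite gt_eqF // dot1_gt0. Qed.

Lemma stereo_invE s y : stereo_inv s y =
  vec4 (2 * y 0 0 * half_inv y) (2 * y 0 1 * half_inv y) (2 * y 0 2 * half_inv y)
    ((-1) ^+ s * (1 - 2 * half_inv y)).
Proof.
have l0 : (0 : 'I_4) = lift ord_max (0 : 'I_3) by exact/val_inj.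
have l1 : (1 : 'I_4) = lift ord_max (1 : 'I_3) by exact/val_inj.
have l2 : (2 : 'I_4) = lift ord_max (2 : 'I_3) by exact/val_inj.
have l3 : (3 : 'I_4) = ord_max by exact/val_inj.
apply/rowP; elim/ord4_ind; rewrite vecE /stereo_inv scalevE mxE /half_inv.
- by rewrite l0 liftK mulrC.
- by rewrite l1 liftK mulrC.
- by rewrite l2 liftK mulrC.
- rewrite l3 unlift_none mulrCA; congr (_ * _).
  by have := dot1_neq0 y; move: (dot y y) => d d0; field.
Qed.

Lemma stereo_inv_sphere s y : dot (stereo_inv s y) (stereo_inv s y) = 1.
Proof.
rewrite stereo_invE dot4E !vecE /half_inv; have := dot1_neq0 y; rewrite dot3E.
by case: s => /=; rewrite ?expr0 ?expr1; gen_entries; intros; field.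
Qed.

(* The fields [hopf1], [hopf2] and [hopf3] in stereographic coordinates. *)
Definition field1 s y := vec3 (- y 0 2 - (-1) ^+ s * (y 0 0 * y 0 1))
  ((-1) ^+ s * (2^-1 * (dot y y - 1) - y 0 1 * y 0 1))
  (y 0 0 - (-1) ^+ s * (y 0 1 * y 0 2)).
Definition field2 s y := vec3 ((-1) ^+ s * (2^-1 * (dot y y - 1) - y 0 0 * y 0 0))
  (y 0 2 - (-1) ^+ s * (y 0 0 * y 0 1))
  (- y 0 1 - (-1) ^+ s * (y 0 0 * y 0 2)).
Definition field3 s y := vec3 (- y 0 1 + (-1) ^+ s * (y 0 0 * y 0 2))
  (y 0 0 + (-1) ^+ s * (y 0 1 * y 0 2))
  ((-1) ^+ s * (- (2^-1 * (dot y y - 1)) + y 0 2 * y 0 2)).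

Definition frameE s y : 'M[R]_3 :=
  \matrix_(a, k) [:: field1 s y 0 k; field2 s y 0 k; eps^-1 * field3 s y 0 k]`_a.
(** The three fields are orthogonal, each of Euclidean length half of [dot y y + 1]; the dual
    covectors are therefore the fields times the square of the conformal factor. *)
Definition frameC s y : 'M[R]_3 :=
  \matrix_(k, a) [:: 4 * half_inv y * half_inv y * field1 s y 0 k;
                     4 * half_inv y * half_inv y * field2 s y 0 k;
                     4 * half_inv y * half_inv y * (eps * field3 s y 0 k)]`_a.

Lemma mul_frameE s y v : v *m frameE s y =
  v 0 0 *: field1 s y + v 0 1 *: field2 s y + (v 0 2 * eps^-1) *: field3 s y.
Proof.
by apply/rowP => k; rewrite mxE sum3E !mxE /= -[X in _ = _ + _ + X]mulrA.
Qed.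

Lemma frame_EC s y : frameE s y *m frameC s y = 1%:M.
Proof.
have := dot1_neq0 y; move: eps0; rewrite dot3E => e0 y0.
by apply/matrixP; elim/ord3_ind; elim/ord3_ind; rewrite !mxE sum3E !mxE /=
  /field1 /field2 /field3 ?vecE /half_inv dot3E; move: y0; case: s => /=;
  rewrite ?expr0 ?expr1; gen_entries; intros; field; repeat (apply/andP; split).
Qed.

Lemma Cinf_half_inv : Cinf setT half_inv.
Proof.
have oT : open [set: 'rV[R]_3] by exact: openT.
apply: Cinf_inv => //; first by move=> z _; exact: dot1_neq0.
apply: Cinf_add => //; last exact: Cinf_cst.
by apply: Cinf_dot => // k; exact: Cinf_coord.
Qed.

Lemma Cinfv_field s : [/\ Cinfv setT (field1 s), Cinfv setT (field2 s) & Cinfv setT (field3 s)].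
Proof.
have oT : open [set: 'rV[R]_3] by exact: openT.
have ck k : Cinf [set: 'rV[R]_3] (fun y => y 0 k) by exact: Cinf_coord.
have cd : Cinfv [set: 'rV[R]_3] id by [].
split; rewrite /field1 /field2 /field3; cinf oT.
Qed.

Lemma Cinf_frameE s i j : Cinf setT (fun y => frameE s y i j).
Proof.
have oT : open [set: 'rV[R]_3] by exact: openT.
have [c1 c2 c3] := Cinfv_field s.
elim/ord3_ind: i.
- by apply: (Cinf_ext oT _ (c1 j)) => z _; rewrite [RHS]mxE.
- by apply: (Cinf_ext oT _ (c2 j)) => z _; rewrite [RHS]mxE.
- by apply: (Cinf_ext oT _ (Cinf_mul oT (Cinf_cst oT eps^-1) (c3 j))) => z _; rewrite [RHS]mxE.
Qed.

Lemma Cinf_frameC s i j : Cinf setT (fun y => frameC s y i j).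
Proof.
have oT : open [set: 'rV[R]_3] by exact: openT.
have [c1 c2 c3] := Cinfv_field s.
have ch := Cinf_mul oT (Cinf_mul oT (Cinf_cst oT 4) Cinf_half_inv) Cinf_half_inv.
elim/ord3_ind: j.
- by apply: (Cinf_ext oT _ (Cinf_mul oT ch (c1 i))) => z _; rewrite [RHS]mxE.
- by apply: (Cinf_ext oT _ (Cinf_mul oT ch (c2 i))) => z _; rewrite [RHS]mxE.
- by apply: (Cinf_ext oT _ (Cinf_mul oT ch (Cinf_mul oT (Cinf_cst oT eps) (c3 i)))) => z _; rewrite [RHS]mxE.
Qed.

Lemma derive_stereo_inv s y v : differentiable (@stereo_inv R s) y /\
  'D_v (@stereo_inv R s) y =
  vec4 (2 * v 0 0 * half_inv y - 4 * y 0 0 * dot v y * (half_inv y * half_inv y))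
       (2 * v 0 1 * half_inv y - 4 * y 0 1 * dot v y * (half_inv y * half_inv y))
       (2 * v 0 2 * half_inv y - 4 * y 0 2 * dot v y * (half_inv y * half_inv y))
       ((-1) ^+ s * (4 * dot v y * (half_inv y * half_inv y))).
Proof.
have oT : open [set: 'rV[R]_3] by exact: openT.
have dk k : differentiable (fun z : 'rV[R]_3 => z 0 k) y by exact: differentiable_coord.
have did : differentiable (fun z : 'rV[R]_3 => z) y by apply: differentiable_row.
have dc (c : R) : differentiable (fun _ : 'rV[R]_3 => c) y by exact: differentiable_cst.
have dh : differentiable half_inv y by exact: (Cinf_differentiable Cinf_half_inv).
have d1 : differentiable (fun z : 'rV[R]_3 => dot z z + 1) y.
  by apply: differentiable_add => //; apply: (Cinf_differentiable (U := setT)) => //;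
    apply: Cinf_dot => // k; exact: Cinf_coord.
have dd : differentiable (fun z : 'rV[R]_3 => dot z z) y.
  by apply: (Cinf_differentiable (U := setT)) => //; apply: Cinf_dot => // k; exact: Cinf_coord.
have Dh : 'D_v half_inv y = - (2 * dot v y) * (half_inv y * half_inv y).
  rewrite (derive_inv v d1 (dot1_neq0 y)) (derive_add v dd (dc 1)) (derive_cst (_ : R)) addr0.
  by rewrite (derive_dot v did did) derive_id [dot y v]dotC -mulr2n mulr_natl.
have hv : has_derive y v half_inv (- (2 * dot v y) * (half_inv y * half_inv y)) by [].
rewrite (_ : @stereo_inv R s = fun y => vec4 (2 * y 0 0 * half_inv y) (2 * y 0 1 * half_inv y)
  (2 * y 0 2 * half_inv y) ((-1) ^+ s * (1 - 2 * half_inv y))); last first.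
  by apply/funext => z; rewrite stereo_invE.
eapply has_derive_eq; first by has_derive_tac.
by move: (half_inv y) (dot v y) ((-1) ^+ s) => h d sg; row4; vring.
Qed.

Lemma hcoord_stereo_inv s y v :
  hcoord eps (stereo_inv s y) ('D_v (@stereo_inv R s) y) = v *m frameC s y.
Proof.
rewrite (derive_stereo_inv s y v).2 /hcoord stereo_invE !dot4E /hopf1 /hopf2 /hopf3.
apply/rowP; elim/ord3_ind; rewrite [RHS]mxE sum3E !mxE /= /field1 /field2 /field3 ?vecE !dot3E
  /half_inv; have := dot1_neq0 y; rewrite dot3E; case: s => /=; rewrite ?expr0 ?expr1;
  by gen_entries; intros; field.
Qed.

Lemma stereo_inv_tangent s y v :
  dot ('D_v (@stereo_inv R s) y) (stereo_inv s y) = 0.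
Proof.
rewrite (derive_stereo_inv s y v).2 stereo_invE dot4E !vecE !dot3E /half_inv.
have := dot1_neq0 y; rewrite dot3E; case: s => /=; rewrite ?expr0 ?expr1;
  by gen_entries; intros; field.
Qed.

Lemma berger_coord_metricE s y :
  berger_coord_metric eps s y = frameC s y *m (frameC s y)^T.
Proof.
apply/matrixP => i j; rewrite [LHS]mxE berger_metricE ?stereo_inv_sphere ?stereo_inv_tangent //.
have H1 := hcoord_stereo_inv s y (basis_vector R i).
have H2 := hcoord_stereo_inv s y (basis_vector R j).
apply: (etrans (congr2 (@dot R 3) H1 H2)).
by rewrite /basis_vector -!rowE dotE mxE; apply: eq_bigr => k _; rewrite !mxE.
Qed.

End Stereographic.

Section Bracket.
Variables (R : realType) (s : bool).
Implicit Types (y a b v : 'rV[R]_3).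

Lemma derive_fields y v :
  [/\ 'D_v (@field1 R s) y = vec3
        (- v 0 2 - (-1) ^+ s * (v 0 0 * y 0 1 + y 0 0 * v 0 1))
        ((-1) ^+ s * (dot v y - (v 0 1 * y 0 1 + y 0 1 * v 0 1)))
        (v 0 0 - (-1) ^+ s * (v 0 1 * y 0 2 + y 0 1 * v 0 2)),
      'D_v (@field2 R s) y = vec3
        ((-1) ^+ s * (dot v y - (v 0 0 * y 0 0 + y 0 0 * v 0 0)))
        (v 0 2 - (-1) ^+ s * (v 0 0 * y 0 1 + y 0 0 * v 0 1))
        (- v 0 1 - (-1) ^+ s * (v 0 0 * y 0 2 + y 0 0 * v 0 2)) &
      'D_v (@field3 R s) y = vec3
        (- v 0 1 + (-1) ^+ s * (v 0 0 * y 0 2 + y 0 0 * v 0 2))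
        (v 0 0 + (-1) ^+ s * (v 0 1 * y 0 2 + y 0 1 * v 0 2))
        ((-1) ^+ s * (- dot v y + (v 0 2 * y 0 2 + y 0 2 * v 0 2)))].
Proof.
have di := has_derive_id y v.
have dd : has_derive y v (fun z => dot z z : R) (2 * dot v y).
  rewrite (funext (fun z => dot3E z z)); eapply has_derive_eq; first by has_derive_tac.
  by rewrite dot3E; ring.
have H f d : has_derive y v f d -> 'D_v f y = d by case.
by split; apply: H; rewrite /field1 /field2 /field3; (eapply has_derive_eq; first by has_derive_tac);
  move: (dot v y) (dot y y) ((-1) ^+ s) => e e' sg; row3; gen_entries; field.
Qed.

(** The relations of su(2), [[E1, E2] = 2 E3] and its cyclic permutations, extended bilinearly. *)
Lemma bracket_fields y a b :
  let E (u : 'rV[R]_3) : 'rV[R]_3 := u 0 0 *: field1 s y + u 0 1 *: field2 s y + u 0 2 *: field3 s y in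
  let DE (u v : 'rV[R]_3) : 'rV[R]_3 := u 0 0 *: 'D_v (@field1 R s) y + u 0 1 *: 'D_v (@field2 R s) y
    + u 0 2 *: 'D_v (@field3 R s) y in
  DE b (E a) - DE a (E b) = E (2 *: cross a b).
Proof.
move=> E DE.
have df f : Cinfv setT f -> differentiable (f : 'rV[R]_3 -> 'rV[R]_3) y.
  by move=> cf; exact: (Cinfv_differentiable cf).
have [/df d1 /df d2 /df d3] := Cinfv_field R s.
have lin (u : 'rV[R]_3) (f : 'rV[R]_3 -> 'rV[R]_3) : differentiable f y ->
    'D_(E u) f y = u 0 0 *: 'D_(field1 s y) f y + u 0 1 *: 'D_(field2 s y) f y
      + u 0 2 *: 'D_(field3 s y) f y.
  by move=> fy; rewrite !(deriveDv _ _ fy) !(deriveZv _ _ fy).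
have br12 : 'D_(field1 s y) (@field2 R s) y - 'D_(field2 s y) (@field1 R s) y = 2 *: field3 s y.
  have [_ -> _] := derive_fields y (field1 s y); have [-> _ _] := derive_fields y (field2 s y).
  rewrite /field1 /field2 /field3 !dot3E.
  by row3; case: s => /=; rewrite ?expr0 ?expr1; gen_entries; field.
have br23 : 'D_(field2 s y) (@field3 R s) y - 'D_(field3 s y) (@field2 R s) y = 2 *: field1 s y.
  have [_ _ ->] := derive_fields y (field2 s y); have [_ -> _] := derive_fields y (field3 s y).
  rewrite /field1 /field2 /field3 !dot3E.
  by row3; case: s => /=; rewrite ?expr0 ?expr1; gen_entries; field.
have br31 : 'D_(field3 s y) (@field1 R s) y - 'D_(field1 s y) (@field3 R s) y = 2 *: field2 s y.
  have [-> _ _] := derive_fields y (field3 s y); have [_ _ ->] := derive_fields y (field1 s y).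
  rewrite /field1 /field2 /field3 !dot3E.
  by row3; case: s => /=; rewrite ?expr0 ?expr1; gen_entries; field.
rewrite /DE !(lin _ _ d1) !(lin _ _ d2) !(lin _ _ d3) /E.
move: br12 br23 br31 => /(canRL (subrK _)) -> /(canRL (subrK _)) -> /(canRL (subrK _)) ->.
gen_derive; move: (field1 s y) (field2 s y) (field3 s y) => *.
by row3; vring.
Qed.

(** Origin of [2 / eps - eps]: once the third field is divided by eps, the structure constants are
    [2 / eps], [2 / eps], [2 * eps]. As [(L a) x b - (L b) x a] is [(tr L - L) (a x b)], this asks
    for [l2 + l3 = l1 + l3 = 2 / eps] and [l1 + l2 = 2 * eps]. *)
Lemma frame_bracket (eps : R) : eps != 0 -> forall y a b,
  b *m dmx (frameE eps s) (a *m frameE eps s y) y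
    - a *m dmx (frameE eps s) (b *m frameE eps s y) y
  = (cross (diag3 eps eps (2 / eps - eps) a) b - cross (diag3 eps eps (2 / eps - eps) b) a)
      *m frameE eps s y.
Proof.
move=> e0 y a b.
have [c1 c2 c3] := Cinfv_field R s.
have df (c : 'rV[R]_3 -> 'rV[R]_3) (cc : Cinfv setT c) : differentiable (c : 'rV[R]_3 -> 'rV[R]_3) y.
  exact: (Cinfv_differentiable cc).
have dk (c : 'rV[R]_3 -> 'rV[R]_3) (cc : Cinfv setT c) k : differentiable (fun z : 'rV[R]_3 => c z 0 k : R) y.
  exact: (Cinf_differentiable (cc k)).
have D u v : u *m dmx (frameE eps s) v y = u 0 0 *: 'D_v (@field1 R s) y
    + u 0 1 *: 'D_v (@field2 R s) y + (u 0 2 * eps^-1) *: 'D_v (@field3 R s) y.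
  apply/rowP => k; rewrite [LHS]mxE sum3E ![dmx _ _ _ _ _]mxE.
  have -> : (fun z => frameE eps s z 0 k) = (fun z => field1 s z 0 k).
    by apply/funext => z; rewrite [LHS]mxE.
  have -> : (fun z => frameE eps s z 1 k) = (fun z => field2 s z 0 k).
    by apply/funext => z; rewrite [LHS]mxE.
  have -> : (fun z => frameE eps s z 2 k) = (fun z => eps^-1 * field3 s z 0 k).
    by apply/funext => z; rewrite [LHS]mxE.
  have H1 := derive_coord v k (df _ c1); have H2 := derive_coord v k (df _ c2).
  have H3 := derive_coord v k (df _ c3).
  have dc : differentiable (fun _ : 'rV[R]_3 => eps^-1) y by exact: differentiable_cst.
  rewrite (derive_mul v dc (dk _ c3 k)) (derive_cst (_ : R)) mul0r add0r.
  rewrite -H1 -H2 -H3; gen_derive.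
  by rewrite !addvE !scalevE mulrA.
have M u : u *m frameE eps s y = let u' := diag3 1 1 eps^-1 u in
    u' 0 0 *: field1 s y + u' 0 1 *: field2 s y + u' 0 2 *: field3 s y.
  by rewrite mul_frameE /= /diag3 !vecE !mul1r [_^-1 * _]mulrC.
have DM u v : u *m dmx (frameE eps s) v y = let u' := diag3 1 1 eps^-1 u in
    u' 0 0 *: 'D_v (@field1 R s) y + u' 0 1 *: 'D_v (@field2 R s) y
    + u' 0 2 *: 'D_v (@field3 R s) y.
  by rewrite D /= /diag3 !vecE !mul1r [_^-1 * _]mulrC.
have B := bracket_fields y (diag3 1 1 eps^-1 a) (diag3 1 1 eps^-1 b).
rewrite !DM !M; apply: (etrans B) => /=.
have -> : diag3 1 1 eps^-1 (cross (diag3 eps eps (2 / eps - eps) a) b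
    - cross (diag3 eps eps (2 / eps - eps) b) a)
  = 2 *: cross (diag3 1 1 eps^-1 a) (diag3 1 1 eps^-1 b).
  by row3; gen_entries; field.
by [].
Qed.

End Bracket.

(** * Surfaces in a three-dimensional frame *)

Section CrossAlgebra.
Variable R : realType.
Implicit Types u v w t n : 'rV[R]_3.

Lemma cross_cross u v w : cross u (cross v w) = dot u w *: v - dot u v *: w.
Proof. by rewrite !dot3E; row3; vring. Qed.

Lemma cross_crossl u v w : cross (cross u v) w = dot u w *: v - dot v w *: u.
Proof. by rewrite !dot3E; row3; vring. Qed.

Lemma dot_crossC u v w : dot (cross u v) w = dot (cross v w) u.
Proof. by rewrite !dot3E /cross !vecE; vring. Qed.

Lemma dot_cross_same u v : dot (cross u v) u = 0.
Proof. by rewrite !dot3E /cross !vecE; vring. Qed.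

Lemma dot_cross_same2 u v : dot (cross u v) v = 0.
Proof. by rewrite !dot3E /cross !vecE; vring. Qed.

Lemma lagrange u v : dot (cross u v) (cross u v) = dot u u * dot v v - dot u v * dot u v.
Proof. by rewrite !dot3E /cross !vecE; vring. Qed.

Lemma cramer t1 t2 n v : dot (cross t1 t2) n *: v =
  dot v (cross t2 n) *: t1 + dot v (cross n t1) *: t2 + dot v (cross t1 t2) *: n.
Proof. by rewrite !dot3E; row3; vring. Qed.

Lemma diag3_cross_anti a b c u v :
  cross (diag3 a b c u) v + cross u (diag3 a b c v)
    = (a + b + c) *: cross u v - diag3 a b c (cross u v).
Proof. by row3; vring. Qed.

Lemma diag3Z a b c k u : diag3 a b c (k *: u) = k *: diag3 a b c u.
Proof. by row3; vring. Qed.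

End CrossAlgebra.

(** * The tangent plane of a surface: dual basis and shape operator *)

Section Gram.
Variables (R : realType) (t1 t2 n : 'rV[R]_3) (J : R).
Hypotheses (J0 : J != 0) (Jn : J *: n = cross t1 t2) (nn : dot n n = 1).

Lemma normal_orthl : dot n t1 = 0.
Proof. by apply: (mulfI J0); rewrite mulr0 -dotZl Jn dot_cross_same. Qed.

Lemma normal_orthr : dot n t2 = 0.
Proof. by apply: (mulfI J0); rewrite mulr0 -dotZl Jn dot_cross_same2. Qed.

Lemma gram_det : J * J = dot t1 t1 * dot t2 t2 - dot t1 t2 * dot t1 t2.
Proof. by rewrite -lagrange -Jn dotZl dotZr nn mulr1. Qed.

(** The vector is J times the first element of the dual basis, [J G^11 t1 + J G^12 t2] with [G^ij]
    the inverse Gram matrix: the weights of the divergence formula turn into a cross product. *)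
Lemma dual_basis1 : cross t2 n = J^-1 *: (dot t2 t2 *: t1 - dot t1 t2 *: t2).
Proof.
apply: (scalerI J0); rewrite scalerA mulfV // scale1r -crossZr Jn cross_cross.
by rewrite [dot t2 t1]dotC.
Qed.

Lemma dual_basis2 : cross n t1 = J^-1 *: (dot t1 t1 *: t2 - dot t1 t2 *: t1).
Proof.
apply: (scalerI J0); rewrite scalerA mulfV // scale1r -crossZl Jn cross_crossl.
by rewrite [dot t2 t1]dotC.
Qed.

Lemma tangent_span v : dot v n = 0 -> exists a b, v = a *: t1 + b *: t2.
Proof.
move=> vn; have := cramer t1 t2 n v; rewrite -Jn dotZl nn mulr1 dotZr vn mulr0 scale0r addr0.
move=> E; exists (J^-1 * dot v (cross t2 n)), (J^-1 * dot v (cross n t1)).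
by apply: (scalerI J0); rewrite E scalerDr !scalerA !mulrA !mulfV // !mul1r.
Qed.

Lemma normal_line v : dot v t1 = 0 -> dot v t2 = 0 -> v = dot v n *: n.
Proof.
move=> v1 v2; apply: (scalerI J0).
have := cramer t1 t2 n v; rewrite -Jn dotZl nn mulr1 dual_basis1 dual_basis2.
rewrite !(dotZr, dotDr, dotNr) v1 v2 !(mulr0, subrr, oppr0, scale0r, add0r) => ->.
by rewrite scalerA.
Qed.

Variables (N1 N2 : 'rV[R]_3) (h : R).
Hypotheses (N1n : dot N1 n = 0) (N2n : dot N2 n = 0) (symN : dot N1 t2 = dot N2 t1).
Hypothesis hE : J * h = dot (cross t2 N1 + cross N2 t1) n.

Lemma mean_curvature_vector : cross t2 N1 + cross N2 t1 = (J * h) *: n.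
Proof.
have [a [b N1E]] := tangent_span N1n; have [c [d N2E]] := tangent_span N2n.
have E : cross t2 N1 + cross N2 t1 = - (a + d) *: (J *: n).
  by rewrite N1E N2E Jn; row3; vring.
by rewrite hE E scalerA dotZl nn mulr1.
Qed.

(** Let A be the shape operator, so that [N_i = - A t_i] and [h = tr A]. Then [N2 + h *: t2] is the
    adjugate of A applied to t2, and the right-angle rotation [cross n] turns the adjugate into the
    transpose, which is A by [symN]. *)
Lemma dual_shape1 : J^-1 *: (dot t2 t2 *: N1 - dot t1 t2 *: N2) = cross n (N2 + h *: t2).
Proof.
have [a [b N1E]] := tangent_span N1n; have [c [d N2E]] := tangent_span N2n.
have hab : h = - (a + d).
  apply: (mulfI J0); rewrite hE N1E N2E.
  have -> : cross t2 (a *: t1 + b *: t2) + cross (c *: t1 + d *: t2) t1 = - (a + d) *: (J *: n).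
    by rewrite Jn; row3; vring.
  by rewrite scalerA dotZl nn mulr1 mulrC.
have s : b * dot t2 t2 = c * dot t1 t1 + d * dot t1 t2 - a * dot t1 t2.
  by move: symN; rewrite N1E N2E !dot_lin [dot t2 t1]dotC => /(canRL (addKr _)) ->; ring.
have -> : cross n (N2 + h *: t2) = c *: cross n t1 + a *: cross t2 n.
  by rewrite hab N2E; row3; vring.
rewrite dual_basis1 dual_basis2 N1E N2E.
have -> : dot t2 t2 *: (a *: t1 + b *: t2) = (dot t2 t2 * a) *: t1 + (b * dot t2 t2) *: t2.
  by rewrite scalerDr !scalerA [b * _]mulrC.
rewrite s; move: (dot _ _) (dot _ _) (dot _ _) (J^-1) => p q r j.
by row3; vring.
Qed.

Lemma dual_shape2 : J^-1 *: (dot t1 t1 *: N2 - dot t1 t2 *: N1) = - cross n (N1 + h *: t1).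
Proof.
have [a [b N1E]] := tangent_span N1n; have [c [d N2E]] := tangent_span N2n.
have hab : h = - (a + d).
  apply: (mulfI J0); rewrite hE N1E N2E.
  have -> : cross t2 (a *: t1 + b *: t2) + cross (c *: t1 + d *: t2) t1 = - (a + d) *: (J *: n).
    by rewrite Jn; row3; vring.
  by rewrite scalerA dotZl nn mulr1 mulrC.
have s : c * dot t1 t1 = b * dot t2 t2 + a * dot t1 t2 - d * dot t1 t2.
  by move: symN; rewrite N1E N2E !dot_lin [dot t2 t1]dotC => /(canLR (addrK _)) <-; ring.
have -> : cross n (N1 + h *: t1) = - (d *: cross n t1) - b *: cross t2 n.
  by rewrite hab N1E; row3; vring.
rewrite dual_basis1 dual_basis2 N1E N2E.
have -> : dot t1 t1 *: (c *: t1 + d *: t2) = (c * dot t1 t1) *: t1 + (d * dot t1 t1) *: t2.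
  by rewrite scalerDr !scalerA [c * _]mulrC [d * _]mulrC.
rewrite s; move: (dot _ _) (dot _ _) (dot _ _) (J^-1) => p q r j.
by row3; vring.
Qed.

Lemma shape_det : cross N1 N2 = dot n (cross N1 N2) *: n.
Proof.
have [a [b N1E]] := tangent_span N1n; have [c [d N2E]] := tangent_span N2n.
have -> : cross N1 N2 = (a * d - b * c) *: (J *: n).
  by rewrite N1E N2E Jn; row3; vring.
by rewrite !dotZr nn mulr1 scalerA.
Qed.

End Gram.

Section PlaneMatrices.
Variable R : realType.

Lemma invmx2 (A : 'M[R]_2) (d : R) : d != 0 ->
  d = A 0 0 * A 1 1 - A 0 1 * A 1 0 ->
  [/\ invmx A 0 0 = d^-1 * A 1 1, invmx A 0 1 = - (d^-1 * A 0 1),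
      invmx A 1 0 = - (d^-1 * A 1 0) & invmx A 1 1 = d^-1 * A 0 0].
Proof.
move=> d0 dE.
pose B : 'M[R]_2 := \matrix_(i, j) nth 0 (nth [::] [:: [:: d^-1 * A 1 1; - (d^-1 * A 0 1)];
  [:: - (d^-1 * A 1 0); d^-1 * A 0 0]] i) j.
have AB : A *m B = 1%:M.
  apply/matrixP; elim/ord2_ind; elim/ord2_ind; rewrite mxE sum2E !mxE /=; move: d0; rewrite dE;
  by gen_entries; intros; field.
have [uA _] := mulmx1_unit AB.
have -> : invmx A = B by rewrite -[LHS]mulmx1 -AB mulmxA mulVmx // mul1mx.
by split; rewrite mxE.
Qed.

Lemma Gamma_basis n (G : 'rV[R]_n -> 'M[R]_n) x i j k :
  Gamma G x (basis_vector R i) (basis_vector R j) 0 k = christoffel G k i j x.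
Proof.
rewrite mxE (bigD1 i) //= (bigD1 j) //= !mxE !eqxx !mulr1.
rewrite big1 => [|j' /negbTE j'j]; last by rewrite [basis_vector R j 0 j']mxE j'j andbF mulr0.
rewrite addr0 big1 ?addr0 // => i' /negbTE i'i.
by apply: big1 => j' _; rewrite [basis_vector R i 0 i']mxE i'i andbF mulr0 mul0r.
Qed.

End PlaneMatrices.

(** * Tension and bitension of a surface in a moving frame *)

Section MovingFrame.
Variables (R : realType) (l1 l2 l3 q1 q2 q3 : R) (U : set 'rV[R]_2).
Variable th : 'rV[R]_2 -> 'rV[R]_2 -> 'rV[R]_3.
Let e0 : 'rV[R]_2 := basis_vector R 0.
Let e1 : 'rV[R]_2 := basis_vector R 1.
Let t1 := th e0.
Let t2 := th e1.
Local Notation "'N_ v w" := (nab l1 l2 l3 th v w) (at level 10, v at level 1, w at level 9).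
Let Q := diag3 q1 q2 q3.
Hypothesis openU : open U.
Hypothesis smooth_th : forall v, Cinfv U (th v).
Hypothesis torsion_free : forall x, U x -> 'N_e0 t2 x = 'N_e1 t1 x.
Hypothesis nab_curv : forall w x, U x -> Cinfv U w ->
  'N_e0 ('N_e1 w) x - 'N_e1 ('N_e0 w) x = cross (Q (cross (t1 x) (t2 x))) (w x).
Hypothesis th_indep : forall x, U x -> cross (t1 x) (t2 x) != 0.

Definition area x : R := Num.sqrt (dot (cross (t1 x) (t2 x)) (cross (t1 x) (t2 x))).
Definition unit_normal x : 'rV[R]_3 := (area x)^-1 *: cross (t1 x) (t2 x).
Let J := area.
Let nu := unit_normal.

Lemma area_gt0 x : U x -> 0 < J x.
Proof. by move=> Ux; rewrite sqrtr_gt0 dot_gt0 th_indep. Qed.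

Let J0 x : U x -> J x != 0. Proof. by move=> /area_gt0 /lt0r_neq0. Qed.

Lemma Cinfv_t1t2 : Cinfv U (fun x => cross (t1 x) (t2 x)).
Proof. exact: (Cinfv_cross openU (smooth_th e0) (smooth_th e1)). Qed.

Lemma Cinf_area : Cinf U J.
Proof.
apply: Cinf_sqrt => //; last by apply: Cinf_dot => //; exact: Cinfv_t1t2.
by move=> z Uz; rewrite dot_gt0 th_indep.
Qed.

Lemma Cinf_areaV : Cinf U (fun x => (J x)^-1).
Proof. by apply: Cinf_inv => //; exact: Cinf_area. Qed.

Lemma Cinfv_normal : Cinfv U nu.
Proof. by apply: Cinfv_scale => //; [exact: Cinf_areaV|exact: Cinfv_t1t2]. Qed.

Lemma area_normal x : U x -> J x *: nu x = cross (t1 x) (t2 x).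
Proof. by move=> Ux; rewrite scalerA mulfV ?scale1r // J0. Qed.

Lemma normal_unit x : U x -> dot (nu x) (nu x) = 1.
Proof.
move=> Ux; rewrite dotZl dotZr mulrA -[X in _ * X]sqr_sqrtr ?dot_ge0 // -/(area x).
by rewrite -/J -invfM -expr2 mulVf // expf_neq0 // J0.
Qed.

Definition N1 := 'N_e0 nu.
Definition N2 := 'N_e1 nu.
Definition tension_vec x := (J x)^-1 *: (cross (t2 x) (N1 x) + cross (N2 x) (t1 x)).
(** Trace of the shape operator, twice the mean curvature; its sign depends on the orientation of
    the chart. *)
Definition mcurv x := dot (tension_vec x) (nu x).
Definition gauss_kronecker x := (J x)^-1 * dot (nu x) (cross (N1 x) (N2 x)).

Lemma Cinfv_N1 : Cinfv U N1.
Proof. by apply: Cinfv_nab => //; exact: Cinfv_normal. Qed.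

Lemma Cinfv_N2 : Cinfv U N2.
Proof. by apply: Cinfv_nab => //; exact: Cinfv_normal. Qed.

Lemma Cinfv_tension_vec : Cinfv U tension_vec.
Proof.
apply: (Cinfv_scale openU Cinf_areaV); apply: (Cinfv_add openU).
  exact: (Cinfv_cross openU (smooth_th e1) Cinfv_N1).
exact: (Cinfv_cross openU Cinfv_N2 (smooth_th e0)).
Qed.

Lemma Cinf_mcurv : Cinf U mcurv.
Proof. by apply: Cinf_dot => //; [exact: Cinfv_tension_vec|exact: Cinfv_normal]. Qed.

Section AtPoint.
Variable x : 'rV[R]_2.
Hypothesis Ux : U x.

Let dnu : differentiable nu x. Proof. exact: (Cinfv_differentiable Cinfv_normal). Qed.

Lemma normal_t1 : dot (nu x) (t1 x) = 0.
Proof. exact: normal_orthl (J0 Ux) (area_normal Ux). Qed.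

Lemma normal_t2 : dot (nu x) (t2 x) = 0.
Proof. exact: normal_orthr (J0 Ux) (area_normal Ux). Qed.

Lemma N_normal v : dot ('N_v nu x) (nu x) = 0.
Proof.
have := derive_dot_nab l1 l2 l3 th v dnu dnu.
rewrite (eq_on_derive openU v (fun z Uz => normal_unit Uz) Ux) (derive_cst (_ : R)).
rewrite [X in _ + X]dotC -mulr2n => /esym/eqP; rewrite mulrn_eq0 /=.
by move/eqP.
Qed.

End AtPoint.

Lemma N_symmetric x : U x -> dot (N1 x) (t2 x) = dot (N2 x) (t1 x).
Proof.
move=> Ux; have dnu := Cinfv_differentiable Cinfv_normal Ux.
have dth v := Cinfv_differentiable (smooth_th v) Ux.
have A1 := derive_dot_nab l1 l2 l3 th e0 dnu (dth e1).
have A2 := derive_dot_nab l1 l2 l3 th e1 dnu (dth e0).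
move: A1 A2; rewrite (eq_on_derive openU e0 (fun z Uz => normal_t2 Uz) Ux).
rewrite (eq_on_derive openU e1 (fun z Uz => normal_t1 Uz) Ux) !(derive_cst (_ : R)).
rewrite -/t1 -/t2 torsion_free // => A1 A2.
by apply: (addIr (dot (nu x) ('N_e1 t1 x))); rewrite -A1 -A2.
Qed.

Lemma areaE x : U x -> J x * mcurv x = dot (cross (t2 x) (N1 x) + cross (N2 x) (t1 x)) (nu x).
Proof. by move=> Ux; rewrite /mcurv dotZl mulrA mulfV ?mul1r // J0. Qed.

Lemma tension_vecE x : U x -> tension_vec x = mcurv x *: nu x.
Proof.
move=> Ux; rewrite /tension_vec (mean_curvature_vector (J0 Ux) (area_normal Ux)
  (normal_unit Ux) (N_normal Ux e0) (N_normal Ux e1) (areaE Ux)).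
by rewrite scalerA mulrA mulVf ?mul1r // J0.
Qed.

Section Divergence.
Variable G : 'rV[R]_2 -> 'M[R]_2.
Hypothesis GE : forall x i j, U x ->
  G x i j = dot (th (basis_vector R i) x) (th (basis_vector R j) x).

Let p z := dot (t1 z) (t1 z).
Let q z := dot (t1 z) (t2 z).
Let r z := dot (t2 z) (t2 z).

Let cp : Cinf U p. Proof. exact: (Cinf_dot openU (smooth_th e0) (smooth_th e0)). Qed.
Let cq : Cinf U q. Proof. exact: (Cinf_dot openU (smooth_th e0) (smooth_th e1)). Qed.
Let cr : Cinf U r. Proof. exact: (Cinf_dot openU (smooth_th e1) (smooth_th e1)). Qed.

Let JJ x : U x -> J x * J x = p x * r x - q x * q x.
Proof. by move=> Ux; exact: (gram_det (area_normal Ux) (normal_unit Ux)). Qed.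

Let p_neq0 x : U x -> p x != 0.
Proof.
move=> Ux; rewrite /p dot_eq0; apply/eqP => t0; have := th_indep Ux.
by rewrite t0 (_ : cross 0 _ = 0) ?eqxx //; row3; rewrite !mul0r subrr.
Qed.

Let DJ v x : U x -> 'D_v (fun z => (J z)^-1) x =
  - ('D_v p x * r x + p x * 'D_v r x - 2 * q x * 'D_v q x) / (2 * J x * J x * J x).
Proof.
move=> Ux; have dJ := Cinf_differentiable Cinf_area Ux.
have [dp dq dr] := And3 (Cinf_differentiable cp Ux) (Cinf_differentiable cq Ux)
  (Cinf_differentiable cr Ux).
have dpr := differentiable_mul dp dr; have dqq := differentiable_mul dq dq.
have := eq_on_derive openU v JJ Ux.
rewrite (derive_mul v dJ dJ) (derive_add v dpr (differentiable_opp dqq)).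
rewrite (derive_opp v dqq) (derive_mul v dp dr) (derive_mul v dq dq).
rewrite (derive_inv v dJ (J0 Ux)); move: (J0 Ux).
move: (J x) ('D_v J x) ('D_v p x) ('D_v q x) ('D_v r x) (p x) (q x) (r x).
move=> j dj p1 q1' r1 p0 q0 r0 j0 E.
have -> : p1 * r0 + p0 * r1 - 2 * q0 * q1' = dj * j + j * dj.
  by rewrite E; ring.
by field.
Qed.

(** The classical formula: the trace of [nabla W] is [J^-1] times the sum of the
    [nabla_i (J G^ij W_j)]. W is left general because it serves twice, for the coframe and for the
    derivative of the tension field. *)
Lemma laplace_div (W : 'rV[R]_2 -> 'rV[R]_2 -> 'rV[R]_3) :
  (forall v, Cinfv U (W v)) ->
  (forall x v, U x -> W v x = v 0 0 *: W e0 x + v 0 1 *: W e1 x) ->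
  forall x, U x ->
  trace_metric G x (fun v w => 'N_v (W w) x - W (Gamma G x v w) x) =
  (J x)^-1 *:
    ('N_e0 (fun z => (J z)^-1 *: (dot (t2 z) (t2 z) *: W e0 z - dot (t1 z) (t2 z) *: W e1 z)) x
   + 'N_e1 (fun z => (J z)^-1 *: (dot (t1 z) (t1 z) *: W e1 z - dot (t1 z) (t2 z) *: W e0 z)) x).
Proof.
move=> cW linW x Ux.
have [dp dq dr] := And3 (Cinf_differentiable cp Ux) (Cinf_differentiable cq Ux)
  (Cinf_differentiable cr Ux).
have dW v := Cinfv_differentiable (cW v) Ux.
have dJV := Cinf_differentiable Cinf_areaV Ux.
have N_term v (g1 g2 : 'rV[R]_2 -> R) w1 w2 : differentiable g1 x -> differentiable g2 x ->
    'N_v (fun z => (J z)^-1 *: (g1 z *: W w1 z - g2 z *: W w2 z)) x =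
    'D_v (fun z => (J z)^-1) x *: (g1 x *: W w1 x - g2 x *: W w2 x)
    + (J x)^-1 *: ('D_v g1 x *: W w1 x + g1 x *: 'N_v (W w1) x
                  - ('D_v g2 x *: W w2 x + g2 x *: 'N_v (W w2) x)).
  move=> dg1 dg2.
  have d1 := differentiable_scale dg1 (dW w1); have d2 := differentiable_scale dg2 (dW w2).
  have d3 : differentiable (fun z => - (g2 z *: W w2 z)) x by exact: differentiableN.
  have d4 : differentiable (fun z => g1 z *: W w1 z - g2 z *: W w2 z) x.
    exact: differentiableD.
  rewrite (nab_scale _ _ _ _ _ dJV d4) (nab_add _ _ _ _ _ d1 d3) (nab_opp _ _ _ _ _ d2).
  by rewrite (nab_scale _ _ _ _ _ dg1 (dW w1)) (nab_scale _ _ _ _ _ dg2 (dW w2)).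
rewrite (N_term _ _ _ _ _ dr dq) (N_term _ _ _ _ _ dp dq) !(DJ _ Ux).
have G00 z : U z -> G z 0 0 = p z by move=> Uz; rewrite GE.
have G01 z : U z -> G z 0 1 = q z by move=> Uz; rewrite GE.
have G10 z : U z -> G z 1 0 = q z by move=> Uz; rewrite GE // dotC.
have G11 z : U z -> G z 1 1 = r z by move=> Uz; rewrite GE.
have D00 v := eq_on_derive openU v G00 Ux; have D01 v := eq_on_derive openU v G01 Ux.
have D10 v := eq_on_derive openU v G10 Ux; have D11 v := eq_on_derive openU v G11 Ux.
have JJ0 : J x * J x != 0 by rewrite mulf_neq0 // J0.
have detG : J x * J x = G x 0 0 * G x 1 1 - G x 0 1 * G x 1 0.
  by rewrite G00 // G01 // G10 // G11 // JJ.
have [I00 I01 I10 I11] := invmx2 JJ0 detG.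
rewrite G00 // in I11; rewrite G01 // in I01; rewrite G10 // in I10; rewrite G11 // in I00.
rewrite /trace_metric !sum2E /= -/e0 -/e1 !(linW _ (Gamma _ _ _ _) Ux) /e0 /e1 !Gamma_basis.
rewrite /christoffel !sum2E I00 I01 I10 I11 !D00 !D01 !D10 !D11 -/e0 -/e1.
have := JJ Ux; move: (J0 Ux) (p_neq0 Ux).
move: ('N_e0 (W e0) x) ('N_e0 (W e1) x) ('N_e1 (W e0) x) ('N_e1 (W e1) x) (W e0 x) (W e1 x).
move: ('D_e0 p x) ('D_e1 p x) ('D_e0 q x) ('D_e1 q x) ('D_e0 r x) ('D_e1 r x).
rewrite -/(p x) -/(q x) -/(r x); move: (J x) (p x) (q x) (r x).
move=> j P Qq Rr p0 p1 q0 q1' r0 r1 w00 w01 w10 w11 w0 w1 j0 P0 E.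
(* Solving [J^2 = p r - q^2] for r leaves independent atoms for [field]; the division is by p, the
   squared length of t1. *)
have RE : Rr = (j * j + Qq * Qq) / P by rewrite E subrK mulrC mulKf.
rewrite RE; apply/rowP => k; rewrite !(addvE, oppvE, scalevE).
by gen_entries; field; rewrite j0 P0.
Qed.

Let nab_eq_on v w w' x : (forall z, U z -> w z = w' z) -> U x ->
  'N_v w x = 'N_v w' x.
Proof. by move=> E Ux; rewrite /nab (eq_on_deriveV openU v E Ux) E. Qed.

Hypothesis th_lin : forall x v, U x -> th v x = v 0 0 *: t1 x + v 0 1 *: t2 x.

(** The fluxes are [t2 x n] and [n x t1]; by [torsion_free] the derivatives of t1 and t2 cancel in
    the divergence, and only those of n survive. *)
Lemma tension_div x : U x ->
  trace_metric G x (fun v w => 'N_v (th w) x - th (Gamma G x v w) x) = tension_vec x.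
Proof.
move=> Ux; rewrite (laplace_div smooth_th th_lin Ux).
have D1 z : U z -> (J z)^-1 *: (dot (t2 z) (t2 z) *: t1 z - dot (t1 z) (t2 z) *: t2 z)
    = cross (t2 z) (nu z).
  by move=> Uz; rewrite (dual_basis1 (J0 Uz) (area_normal Uz)).
have D2 z : U z -> (J z)^-1 *: (dot (t1 z) (t1 z) *: t2 z - dot (t1 z) (t2 z) *: t1 z)
    = cross (nu z) (t1 z).
  by move=> Uz; rewrite (dual_basis2 (J0 Uz) (area_normal Uz)).
rewrite (nab_eq_on e0 D1 Ux) (nab_eq_on e1 D2 Ux).
have dnu := Cinfv_differentiable Cinfv_normal Ux.
have dth v := Cinfv_differentiable (smooth_th v) Ux.
rewrite (nab_cross _ _ _ _ _ (dth e1) dnu) (nab_cross _ _ _ _ _ dnu (dth e0)).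
rewrite -/t1 -/t2 torsion_free // /tension_vec; congr (_ *: _).
rewrite -/(N1 x) -/(N2 x); move: ('N_e1 t1 x) (N1 x) (N2 x) (t1 x) (t2 x) (nu x) => *.
by row3; vring.
Qed.

Hypothesis mcurv_cst : forall v x, U x -> 'D_v mcurv x = 0.

Lemma nab_tension v x : U x -> 'N_v tension_vec x = mcurv x *: 'N_v nu x.
Proof.
move=> Ux; rewrite (nab_eq_on v tension_vecE Ux).
have dnu := Cinfv_differentiable Cinfv_normal Ux.
have dh := Cinf_differentiable Cinf_mcurv Ux.
by rewrite (nab_scale _ _ _ _ _ dh dnu) mcurv_cst // scale0r add0r.
Qed.

Lemma nab_linear w x v : differentiable w x -> U x ->
  'N_v w x = v 0 0 *: 'N_e0 w x + v 0 1 *: 'N_e1 w x.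
Proof.
move=> dw Ux; rewrite /nab th_lin // (derive_basis v dw) -/e0 -/e1; gen_derive.
rewrite -/t1 -/t2; move: (t1 x) (t2 x) (w x) => a b c.
by intros; row3; vring.
Qed.

(** The fluxes are h times [n x (N2 + h t2)] and [- n x (N1 + h t1)]. Up to this factor their
    divergence collects [2 N1 x N2], that is [2 d J n], then [- h^2 J n] from the terms in t1 and
    t2, and [n x ([nabla_0, nabla_1] n)], which the Ricci identity turns into
    [J (Q n - (n.Qn) n)]. *)
Lemma laplace_tension x : U x ->
  trace_metric G x (fun v w => 'N_v ('N_w tension_vec) x - 'N_(Gamma G x v w) tension_vec x)
  = mcurv x *: (Q (nu x) + (2 * gauss_kronecker x - mcurv x ^+ 2 - dot (nu x) (Q (nu x))) *: nu x).
Proof.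
move=> Ux; have dt := Cinfv_differentiable Cinfv_tension_vec.
have cN v : Cinfv U ('N_v tension_vec).
  by apply: Cinfv_nab => //; exact: Cinfv_tension_vec.
rewrite (laplace_div (W := fun v => 'N_v tension_vec) cN (fun z v Uz => nab_linear v (dt z Uz) Uz) Ux).
have D1 z : U z -> (J z)^-1 *: (dot (t2 z) (t2 z) *: 'N_e0 tension_vec z
     - dot (t1 z) (t2 z) *: 'N_e1 tension_vec z)
    = mcurv z *: cross (nu z) (N2 z + mcurv z *: t2 z).
  move=> Uz; rewrite -(dual_shape1 (J0 Uz) (area_normal Uz) (normal_unit Uz)
    (N_normal Uz e0) (N_normal Uz e1) (N_symmetric Uz) (areaE Uz)).
  rewrite !nab_tension // -/(N1 z) -/(N2 z).
  by move: (mcurv z) (dot _ _) (dot _ _) (_^-1) => *; row3; vring.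
have D2 z : U z -> (J z)^-1 *: (dot (t1 z) (t1 z) *: 'N_e1 tension_vec z
     - dot (t1 z) (t2 z) *: 'N_e0 tension_vec z)
    = mcurv z *: - cross (nu z) (N1 z + mcurv z *: t1 z).
  move=> Uz; rewrite -(dual_shape2 (J0 Uz) (area_normal Uz) (normal_unit Uz)
    (N_normal Uz e0) (N_normal Uz e1) (N_symmetric Uz) (areaE Uz)).
  rewrite !nab_tension // -/(N1 z) -/(N2 z).
  by move: (mcurv z) (dot _ _) (dot _ _) (_^-1) => *; row3; vring.
rewrite (nab_eq_on e0 D1 Ux) (nab_eq_on e1 D2 Ux).
have dnu := Cinfv_differentiable Cinfv_normal Ux.
have dth v := Cinfv_differentiable (smooth_th v) Ux.
have dh := Cinf_differentiable Cinf_mcurv Ux.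
have d1 := Cinfv_differentiable Cinfv_N1 Ux; have d2 := Cinfv_differentiable Cinfv_N2 Ux.
have s1 := differentiable_scale dh (dth e0); have s2 := differentiable_scale dh (dth e1).
have a1 : differentiable (fun z => N1 z + mcurv z *: t1 z) x by exact: differentiableD.
have a2 : differentiable (fun z => N2 z + mcurv z *: t2 z) x by exact: differentiableD.
have dX w : differentiable w x -> differentiable (fun z => cross (nu z) (w z)) x.
  by move=> dw; exact: (derive_cross 0 dnu dw).1.
have x1 := dX _ a1; have x2 := dX _ a2.
have x1' : differentiable (fun z => - cross (nu z) (N1 z + mcurv z *: t1 z)) x.
  exact: differentiableN.
rewrite (nab_scale _ _ _ _ _ dh x2) (nab_scale _ _ _ _ _ dh x1') !mcurv_cst // !scale0r !add0r.
rewrite (nab_opp _ _ _ _ _ x1) (nab_cross _ _ _ _ _ dnu a1) (nab_cross _ _ _ _ _ dnu a2).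
rewrite (nab_add _ _ _ _ _ d1 s1) (nab_add _ _ _ _ _ d2 s2).
rewrite (nab_scale _ _ _ _ _ dh (dth e0)) (nab_scale _ _ _ _ _ dh (dth e1)).
rewrite !mcurv_cst // !scale0r !add0r -/t1 -/t2 torsion_free // -/(N1 x) -/(N2 x).
have C := nab_curv Ux Cinfv_normal; rewrite -/N1 -/N2 in C.
have := mean_curvature_vector (J0 Ux) (area_normal Ux) (normal_unit Ux)
    (N_normal Ux e0) (N_normal Ux e1) (areaE Ux).
have := shape_det (J0 Ux) (area_normal Ux) (normal_unit Ux) (N_normal Ux e0) (N_normal Ux e1).
rewrite -/(N1 x) -/(N2 x) => det mc.
have -> : mcurv x *: (cross (N1 x) (N2 x + mcurv x *: t2 x)
       + cross (nu x) ('N_e0 N2 x + mcurv x *: 'N_e1 t1 x))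
    + mcurv x *: - (cross (N2 x) (N1 x + mcurv x *: t1 x)
       + cross (nu x) ('N_e1 N1 x + mcurv x *: 'N_e1 t1 x))
  = mcurv x *: (2 *: cross (N1 x) (N2 x) - mcurv x *: (cross (t2 x) (N1 x) + cross (N2 x) (t1 x))
     + cross (nu x) ('N_e0 N2 x - 'N_e1 N1 x)).
  move: ('N_e0 N2 x) ('N_e1 N1 x) ('N_e1 t1 x) (N1 x) (N2 x) (t1 x) (t2 x) (nu x) (mcurv x) => *.
  by row3; vring.
rewrite C mc det -(area_normal Ux) /Q diag3Z crossZl crossZr cross_cross (normal_unit Ux) scale1r.
rewrite /gauss_kronecker; move: (J0 Ux) (dot _ (cross _ _)) (dot _ (diag3 _ _ _ _)).
move: (J x) (mcurv x) (nu x) (diag3 _ _ _ _) => j h n Qn j0 d e.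
by apply/rowP => k; rewrite !(addvE, oppvE, scalevE); gen_entries; field.
Qed.

(** With [a = t1 x n] and [b = t2 x n] the contraction becomes [(Q a) x b + a x (Q b)], which is
    [(tr Q - Q) (a x b)], and [a x b = J n]. *)
Lemma curvature_trace x : U x ->
  trace_metric G x (fun v w => cross (Q (cross (th v x) (tension_vec x))) (th w x))
  = mcurv x *: ((q1 + q2 + q3) *: nu x - Q (nu x)).
Proof.
move=> Ux; have JJ0 : J x * J x != 0 by rewrite mulf_neq0 // J0.
have detG : J x * J x = G x 0 0 * G x 1 1 - G x 0 1 * G x 1 0.
  by rewrite !GE // JJ // [dot (th (basis_vector R 1) x) (th (basis_vector R 0) x)]dotC.
have [I00 I01 I10 I11] := invmx2 JJ0 detG.
rewrite /trace_metric !sum2E I00 I01 I10 I11 !GE // -/e0 -/e1 -/t1 -/t2 tension_vecE //.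
rewrite [dot (t2 x) (t1 x)]dotC.
transitivity ((mcurv x * (J x)^-1) *:
  (cross (Q (cross (t1 x) (nu x))) ((J x)^-1 *: (dot (t2 x) (t2 x) *: t1 x - dot (t1 x) (t2 x) *: t2 x))
 + cross (Q (cross (t2 x) (nu x))) ((J x)^-1 *: (dot (t1 x) (t1 x) *: t2 x - dot (t1 x) (t2 x) *: t1 x)))).
  have QE t : Q (cross t (mcurv x *: nu x)) = mcurv x *: Q (cross t (nu x)).
    by rewrite /Q crossZr diag3Z.
  rewrite !QE invfM; move: (J x)^-1 (mcurv x) (dot _ _) (dot _ _) (dot _ _).
  move: (Q (cross (t1 x) (nu x))) (Q (cross (t2 x) (nu x))) (t1 x) (t2 x) => *.
  by row3; vring.
rewrite -(dual_basis1 (J0 Ux) (area_normal Ux)) -(dual_basis2 (J0 Ux) (area_normal Ux)).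
set a := cross (t1 x) (nu x); set b := cross (t2 x) (nu x).
have -> : cross (nu x) (t1 x) = - a by rewrite crossC.
have -> : cross (Q a) b + cross (Q b) (- a) = cross (Q a) b + cross a (Q b).
  by congr (_ + _); rewrite -scaleN1r crossZr scaleN1r -crossC.
rewrite /Q diag3_cross_anti.
have -> : cross a b = J x *: nu x.
  rewrite /a cross_crossl /b [dot (nu x) _]dotC dot_cross_same2 scale0r subr0.
  by rewrite dotC 2!dot_crossC -(area_normal Ux) dotZl (normal_unit Ux) mulr1.
rewrite diag3Z; move: (J0 Ux); move: (J x) (mcurv x) (nu x) (diag3 _ _ _ _) => j h n Qn j0.
by apply/rowP => k; rewrite !(addvE, oppvE, scalevE); gen_entries; field.
Qed.

End Divergence.

End MovingFrame.

(** * Surfaces in the Berger sphere *)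

Section StereographicImage.
Variables (R : realType) (s : bool).
Implicit Types (p v : 'rV[R]_4).

Lemma ord_maxE : (ord_max : 'I_4) = 3.
Proof. exact/val_inj. Qed.

Definition stereo_den p : R := 1 - (-1) ^+ s * p 0 3.

Lemma stereo_den_neq0 p : p 0 3 != (-1) ^+ s -> stereo_den p != 0.
Proof.
apply: contraNN; rewrite /stereo_den => /eqP e; apply/eqP; move: e.
by case: s => /=; rewrite ?expr0 ?expr1; gen_entries; intros; lra.
Qed.

Lemma stereoE p : stereo s p = vec3 (p 0 0 * (stereo_den p)^-1)
  (p 0 1 * (stereo_den p)^-1) (p 0 2 * (stereo_den p)^-1).
Proof.
apply/rowP; elim/ord3_ind; rewrite vecE mxE ord_maxE /stereo_den; congr (p 0 _ / _);
  exact/val_inj.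
Qed.

Lemma half_dot_stereo p : dot p p = 1 -> p 0 3 != (-1) ^+ s ->
  2^-1 * (dot (stereo s p) (stereo s p) - 1) = (-1) ^+ s * p 0 3 * (stereo_den p)^-1.
Proof.
move=> pp /stereo_den_neq0 d0; rewrite stereoE dot3E !vecE.
have -> : (-1) ^+ s * p 0 3 = 1 - stereo_den p by rewrite /stereo_den subKr.
have E : p 0 0 * p 0 0 + p 0 1 * p 0 1 + p 0 2 * p 0 2 = 2 * stereo_den p - stereo_den p ^+ 2.
  move: pp; rewrite dot4E /stereo_den => /(canRL (addrK _)) ->.
  by case: s => /=; rewrite ?expr0 ?expr1; vring.
transitivity (2^-1 * ((p 0 0 * p 0 0 + p 0 1 * p 0 1 + p 0 2 * p 0 2) * (stereo_den p)^-1 ^+ 2 - 1)).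
  by move: (stereo_den p)^-1 => t; vring.
by rewrite E; move: d0; move: (stereo_den p) => d d0; field.
Qed.

Definition dstereo p v := vec3
  (v 0 0 * (stereo_den p)^-1 + (-1) ^+ s * (p 0 0 * v 0 3) * ((stereo_den p)^-1 * (stereo_den p)^-1))
  (v 0 1 * (stereo_den p)^-1 + (-1) ^+ s * (p 0 1 * v 0 3) * ((stereo_den p)^-1 * (stereo_den p)^-1))
  (v 0 2 * (stereo_den p)^-1 + (-1) ^+ s * (p 0 2 * v 0 3) * ((stereo_den p)^-1 * (stereo_den p)^-1)).

Lemma field_stereo p : dot p p = 1 -> p 0 3 != (-1) ^+ s ->
  [/\ field1 s (stereo s p) = dstereo p (hopf1 p), field2 s (stereo s p) = dstereo p (hopf2 p)
    & field3 s (stereo s p) = dstereo p (hopf3 p)].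
Proof.
move=> pp p3; have H := half_dot_stereo pp p3.
split; rewrite /field1 /field2 /field3 H /dstereo /hopf1 /hopf2 /hopf3 !stereoE;
  row3; rewrite ?vecE; move: (stereo_den p)^-1 => t; case: s => /=; rewrite ?expr0 ?expr1;
  by vring.
Qed.

Lemma dstereoD p v w : dstereo p (v + w) = dstereo p v + dstereo p w.
Proof.
rewrite /dstereo; move: (stereo_den p)^-1 ((-1) ^+ s) => *.
by row3; rewrite ?vecE; vring.
Qed.

Lemma dstereoZ p k v : dstereo p (k *: v) = k *: dstereo p v.
Proof.
rewrite /dstereo; move: (stereo_den p)^-1 ((-1) ^+ s) => *.
by row3; rewrite ?vecE; vring.
Qed.

End StereographicImage.

Lemma basis2E (R : realType) :
  [/\ (basis_vector R (0 : 'I_2)) 0 0 = 1, (basis_vector R (0 : 'I_2)) 0 1 = 0,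
      (basis_vector R (1 : 'I_2)) 0 0 = 0 & (basis_vector R (1 : 'I_2)) 0 1 = 1].
Proof. by split; rewrite mxE. Qed.

Lemma basis2_comb (R : realType) (a b : R) :
  (a *: basis_vector R 0 + b *: basis_vector R (1 : 'I_2)) 0 0 = a /\
  (a *: basis_vector R 0 + b *: basis_vector R (1 : 'I_2)) 0 1 = b.
Proof.
have [b00 b01 b10 b11] := basis2E R.
by rewrite !addvE !scalevE b00 b01 b10 b11 !mulr1 !mulr0 addr0 add0r.
Qed.

Lemma cross_eq0_dep (R : realType) (a b : 'rV[R]_3) : cross a b = 0 ->
  dot b b *: a + (- dot a b) *: b = 0.
Proof.
move=> ab; rewrite scaleNr [dot a b]dotC -cross_cross ab.
by row3; rewrite !mulr0 subrr.
Qed.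

Section Surface.
Variables (R : realType) (eps : R) (s : bool) (U : set 'rV[R]_2) (f : 'rV[R]_2 -> 'rV[R]_4).
Hypothesis eps0 : eps != 0.
Hypothesis openU : open U.
Hypothesis smoothf : Cinfv U f.
Hypothesis f_sphere : forall x, U x -> dot (f x) (f x) = 1.
Hypothesis f_dom : forall x, U x -> f x 0 3 != (-1) ^+ s.
Hypothesis f_immersion : forall x v, U x -> 'D_v f x = 0 -> v = 0.

Definition coframe v x := hcoord eps (f x) ('D_v f x).
Let th := coframe.
Let F := @stereo R s \o f.
Let E := frameE eps s.
Let C := frameC eps s.
Let H := @berger_coord_metric R eps s.
Let G := pullback_metric eps f.
Let e0 : 'rV[R]_2 := basis_vector R 0.
Let e1 : 'rV[R]_2 := basis_vector R 1.
Let l3 := 2 / eps - eps.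

Let df x : U x -> differentiable f x. Proof. exact: Cinfv_differentiable. Qed.

Lemma tangent_sphere v x : U x -> dot ('D_v f x) (f x) = 0.
Proof.
move=> Ux; have := derive_dot v (df Ux) (df Ux).
rewrite (eq_on_derive openU v f_sphere Ux) (derive_cst (_ : R)).
rewrite [dot (f x) _]dotC -mulr2n => /esym/eqP; rewrite mulrn_eq0 /=.
by move/eqP.
Qed.

Lemma Cinfv_hopf : [/\ Cinfv U (fun x => hopf1 (f x)), Cinfv U (fun x => hopf2 (f x))
  & Cinfv U (fun x => hopf3 (f x))].
Proof.
split; apply: Cinfv_vec4 => //; first [exact: smoothf
  | by apply: Cinf_opp => //; exact: smoothf].
Qed.

Lemma Cinfv_coframe v : Cinfv U (th v).
Proof.
have [c1 c2 c3] := Cinfv_hopf; have cD := Cinfv_derive openU v smoothf.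
apply: (Cinfv_vec3 openU (Cinf_dot openU cD c1) (Cinf_dot openU cD c2)).
exact: (Cinf_mul openU (Cinf_cst openU eps) (Cinf_dot openU cD c3)).
Qed.

Lemma Cinfv_stereo : Cinfv U F.
Proof.
have cd : Cinf U (fun x => stereo_den s (f x)).
  apply: (Cinf_add openU (Cinf_cst openU 1)); apply: (Cinf_opp openU).
  exact: (Cinf_mul openU (Cinf_cst openU _) (smoothf 3)).
have ci : Cinf U (fun x => (stereo_den s (f x))^-1).
  by apply: Cinf_inv => // z Uz; exact: (stereo_den_neq0 (f_dom Uz)).
have cm k := Cinf_mul openU (smoothf k) ci.
apply: Cinfv_ext (Cinfv_vec3 openU (cm 0) (cm 1) (cm 2)) => // z Uz.
by rewrite /F /= stereoE.
Qed.

Lemma derive_stereo v x : U x -> 'D_v F x = dstereo s (f x) ('D_v f x).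
Proof.
move=> Ux; have dfx := has_deriveP v (df Ux).
have dd : has_derive x v (fun z => stereo_den s (f z)) (- ((-1) ^+ s * ('D_v f x) 0 3)).
  by rewrite /stereo_den; eapply has_derive_eq; [has_derive_tac | move: ((-1) ^+ s) => sg; ring].
have di := has_derive_inv (f := fun z => stereo_den s (f z)) (stereo_den_neq0 (f_dom Ux)) dd.
suff [] : has_derive x v F (dstereo s (f x) ('D_v f x)) by [].
have -> : F = fun z => vec3 (f z 0 0 * (stereo_den s (f z))^-1)
   (f z 0 1 * (stereo_den s (f z))^-1) (f z 0 2 * (stereo_den s (f z))^-1).
  by apply/funext => z; rewrite /F /= stereoE.
eapply has_derive_eq; first by has_derive_tac.
rewrite /dstereo; move: ('D_v f x) (stereo_den s (f x))^-1 ((-1) ^+ s) (f x) => D t sg p.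
by row3; vring.
Qed.

Lemma derive_stereo_frame v x : U x -> 'D_v F x = th v x *m E (F x).
Proof.
move=> Ux; rewrite derive_stereo // mul_frameE /th /coframe /hcoord !vecE.
rewrite [eps * _ * _]mulrAC mulfV // mul1r /F /=.
have [-> -> ->] := field_stereo (f_sphere Ux) (f_dom Ux).
rewrite {1}[X in dstereo _ _ X](hopf_basis (f_sphere Ux) (tangent_sphere v Ux)).
by rewrite !dstereoD !dstereoZ.
Qed.

Lemma pullback_coframe x i j : U x ->
  G x i j = dot (th (basis_vector R i) x) (th (basis_vector R j) x).
Proof.
move=> Ux; rewrite mxE.
exact: (berger_metricE _ (f_sphere Ux) (tangent_sphere _ Ux) (tangent_sphere _ Ux)).
Qed.

Lemma coframe_linear x v : U x -> th v x = v 0 0 *: th e0 x + v 0 1 *: th e1 x.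
Proof.
move=> Ux; rewrite /th /coframe (derive_basis v (df Ux)) -/e0 -/e1; gen_derive; intros.
by rewrite /hcoord !dot_lin; move: (dot _ _) (dot _ _) (dot _ _) (dot _ _) (dot _ _) (dot _ _);
  intros; row3; rewrite ?vecE; vring.
Qed.

Lemma coframe_eq0 x v : U x -> th v x = 0 -> v = 0.
Proof.
move=> Ux v0; apply: (f_immersion Ux).
rewrite (hopf_basis (f_sphere Ux) (tangent_sphere v Ux)).
have := congr1 (fun w : 'rV[R]_3 => w 0 0) v0; have := congr1 (fun w : 'rV[R]_3 => w 0 1) v0.
have := congr1 (fun w : 'rV[R]_3 => w 0 2) v0; rewrite /th /coframe /hcoord !vecE.
move=> /eqP; rewrite mulf_eq0 (negbTE eps0) /= => /eqP -> -> ->.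
by rewrite !scale0r !addr0.
Qed.

Lemma coframe_indep x : U x -> cross (th e0 x) (th e1 x) != 0.
Proof.
move=> Ux; apply/eqP => c0.
(* The dependence relation of [cross_eq0_dep]: the immersion condition makes v vanish, so that
   [th e1 x] has norm 0. *)
pose v := dot (th e1 x) (th e1 x) *: e0 + (- dot (th e0 x) (th e1 x)) *: e1.
have [_ _ _ b11] := basis2E R.
have [v0 v1] : v 0 0 = dot (th e1 x) (th e1 x) /\ v 0 1 = - dot (th e0 x) (th e1 x).
  exact: basis2_comb.
have vz : v = 0.
  apply: (coframe_eq0 Ux); rewrite (coframe_linear v Ux) v0 v1.
  exact: cross_eq0_dep c0.
have /eqP : dot (th e1 x) (th e1 x) = 0 by rewrite -v0 vz zerovE.
rewrite dot_eq0 => /eqP /(coframe_eq0 Ux) /(congr1 (fun w : 'rV[R]_2 => w 0 1)).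
by rewrite b11 zerovE => /eqP; rewrite oner_eq0.
Qed.

Let EC : forall y, E y *m C y = 1%:M. Proof. exact: frame_EC. Qed.
Let HE : forall y, H y = C y *m (C y)^T. Proof. exact: berger_coord_metricE. Qed.
Let sE : forall i j, Cinf setT (fun y => E y i j). Proof. exact: Cinf_frameE. Qed.
Let sC : forall i j, Cinf setT (fun y => C y i j). Proof. exact: Cinf_frameC. Qed.
Let thE : forall v x, U x -> 'D_v F x = th v x *m E (F x).
Proof. by move=> v x; exact: derive_stereo_frame. Qed.

(** Minus the sectional curvature [4 - 3 eps^2] of the horizontal planes; the other two entries of
    [Q] are minus the curvature [eps^2] of the planes containing the fibre direction. *)
Definition ricci3 : R := 3 * eps ^+ 2 - 4.
Let Q := diag3 (- eps ^+ 2) (- eps ^+ 2) ricci3.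
Local Notation "'N_ v w" := (nab eps eps l3 th v w) (at level 10, v at level 1, w at level 9).

Let QE u : diag3 (eps * l3 - eps * (eps + l3)) (eps * l3 - eps * (eps + l3))
  (eps * eps - l3 * (eps + eps)) u = Q u.
Proof. by rewrite /Q /ricci3 /l3; row3; gen_entries; field. Qed.

Lemma surface_structure x : U x ->
  'D_e0 (th e1) x - 'D_e1 (th e0) x + (cross (diag3 eps eps l3 (th e0 x)) (th e1 x)
     - cross (diag3 eps eps l3 (th e1 x)) (th e0 x)) = 0.
Proof.
exact: (structure_equation EC sE (frame_bracket s eps0) openU Cinfv_stereo Cinfv_coframe thE).
Qed.

Lemma surface_torsion x : U x -> 'N_e0 (th e1) x = 'N_e1 (th e0) x.
Proof.
move=> Ux; have /eqP := surface_structure Ux; rewrite addrACA -opprD subr_eq0 => /eqP.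
by rewrite /nab.
Qed.

Lemma surface_nab_curv w x : U x -> Cinfv U w ->
  'N_e0 ('N_e1 w) x - 'N_e1 ('N_e0 w) x = cross (Q (cross (th e0 x) (th e1 x))) (w x).
Proof.
move=> Ux cw; rewrite -QE.
exact: (nab_comm EC sE (frame_bracket s eps0) openU Cinfv_stereo Cinfv_coframe thE e0 e1 Ux cw).
Qed.

Lemma trace_metric_mulmx (A : 'rV[R]_2 -> 'M[R]_2) x (B : 'rV[R]_2 -> 'rV[R]_2 -> 'rV[R]_3)
    (B' : 'rV[R]_2 -> 'rV[R]_2 -> 'rV[R]_3) (P : 'M[R]_3) :
  (forall v w, B v w = B' v w *m P) -> trace_metric A x B = trace_metric A x B' *m P.
Proof.
move=> BE; rewrite /trace_metric mulmx_suml; apply: eq_bigr => i _.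
by rewrite mulmx_suml; apply: eq_bigr => j _; rewrite BE scalemxAl.
Qed.

Let covDE v W w x := @covD_frame _ _ _ _ _ _ _ EC HE sE sC (frame_bracket s eps0) _ _ _ _ openU
  Cinfv_stereo thE v W w x.

Lemma sff_surface v w x : U x ->
  second_fundamental_form G H F x v w = ('N_v (th w) x - th (Gamma G x v w) x) *m E (F x).
Proof.
move=> Ux; rewrite /second_fundamental_form mulmxBl thE //; congr (_ - _).
apply: covDE => //; last by move=> z Uz; exact: thE.
by apply: Cinfv_differentiable Ux; exact: Cinfv_coframe.
Qed.

Lemma tension_surface x : U x ->
  tension G H F x = tension_vec eps eps l3 th x *m E (F x).
Proof.
move=> Ux; rewrite /tension (trace_metric_mulmx _ _ (fun v w => sff_surface v w Ux)).
by rewrite (tension_div openU Cinfv_coframe surface_torsion coframe_indep pullback_coframe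
  coframe_linear Ux).
Qed.

(** [xi] is plus or minus [unit_normal], with no information on the sign; hence the squares. *)
Lemma mean_curvature_surface xi x c : U x -> unit_normal_at H F xi x ->
  mean_curvature G H F xi x = c -> mcurv eps eps l3 th x ^+ 2 = (2 * c) ^+ 2.
Proof.
move=> Ux [xi1 xiT] <-; set h := mcurv _ _ _ _ x.
have CE : C (F x) *m E (F x) = 1%:M by exact: mulmx1C.
pose k := xi x *m C (F x); have xiE : xi x = k *m E (F x) by rewrite -mulmxA CE mulmx1.
have mE := frame_metricE EC HE (F x).
have k1 : dot k k = 1 by rewrite -xi1 xiE mE.
have kt v : dot k (th v x) = 0 by rewrite -(xiT v) xiE thE // mE.
have J0 := lt0r_neq0 (area_gt0 coframe_indep Ux).
have kn : k = dot k (unit_normal th x) *: unit_normal th x.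
  exact: (normal_line J0 (area_normal coframe_indep Ux) (normal_unit coframe_indep Ux)).
have k2 : dot k (unit_normal th x) ^+ 2 = 1.
  by rewrite -k1 [in RHS]kn dotZl dotZr (normal_unit coframe_indep Ux) mulr1 expr2.
have -> : mean_curvature G H F xi x = 2^-1 * metric H (F x) (tension G H F x) (xi x).
  rewrite /mean_curvature; congr (_ * _).
  rewrite /tension /trace_metric /metric !mulmx_suml summxE; apply: eq_bigr => i _.
  rewrite !mulmx_suml summxE; apply: eq_bigr => j _.
  by rewrite -!scalemxAl [RHS]mxE.
rewrite tension_surface // xiE mE.
rewrite (tension_vecE eps eps l3 openU Cinfv_coframe coframe_indep Ux) -/h dotZl dotC.
by rewrite mulrA mulfV ?pnatr_eq0 // mul1r exprMn k2 mulr1.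
Qed.

Lemma bitension_surface x : (forall v z, U z -> 'D_v (mcurv eps eps l3 th) z = 0) -> U x ->
  bitension G H F x =
  (mcurv eps eps l3 th x *: (2 *: Q (unit_normal th x)
     - (mcurv eps eps l3 th x ^+ 2 - 2 * gauss_kronecker eps eps l3 th x
        + dot (unit_normal th x) (Q (unit_normal th x)) + (eps ^+ 2 - 4)) *: unit_normal th x))
    *m E (F x).
Proof.
move=> hc Ux; have ct := Cinfv_tension_vec eps eps l3 openU Cinfv_coframe coframe_indep.
have cov1 v z : U z -> covD H F v (tension G H F) z
    = 'N_v (tension_vec eps eps l3 th) z *m E (F z).
  move=> Uz; apply: covDE => //; last by move=> z' Uz'; exact: tension_surface.
  exact: Cinfv_differentiable Uz.
have cov2 v w : covD H F v (covD H F w (tension G H F)) x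
    = 'N_v ('N_w (tension_vec eps eps l3 th)) x *m E (F x).
  apply: covDE => //; last by move=> z' Uz'; exact: cov1.
  by apply: Cinfv_differentiable Ux; apply: Cinfv_nab => //; exact: Cinfv_coframe.
have thC v : 'D_v F x *m C (F x) = th v x by rewrite thE // -mulmxA EC mulmx1.
have tC : tension G H F x *m C (F x) = tension_vec eps eps l3 th x.
  by rewrite tension_surface // -mulmxA EC mulmx1.
have curvE v w : curvature H (F x) ('D_v F x) (tension G H F x) ('D_w F x)
    = cross (Q (cross (th v x) (tension_vec eps eps l3 th x))) (th w x) *m E (F x).
  by rewrite (curvature_frame EC HE sE sC (frame_bracket s eps0)) !thC tC QE.
have lapE v w : covD H F v (covD H F w (tension G H F)) x
      - covD H F (Gamma G x v w) (tension G H F) x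
    = ('N_v ('N_w (tension_vec eps eps l3 th)) x
       - 'N_(Gamma G x v w) (tension_vec eps eps l3 th) x) *m E (F x).
  by rewrite cov2 cov1 // mulmxBl.
rewrite /bitension (trace_metric_mulmx _ _ lapE) (trace_metric_mulmx _ _ curvE) -mulmxBl.
rewrite (laplace_tension openU Cinfv_coframe surface_torsion surface_nab_curv coframe_indep
  pullback_coframe coframe_linear hc Ux).
rewrite (curvature_trace eps eps l3 (- eps ^+ 2) (- eps ^+ 2) ricci3 openU Cinfv_coframe coframe_indep
  pullback_coframe Ux).
congr (_ *m _); rewrite /Q.
have -> : - eps ^+ 2 + - eps ^+ 2 + ricci3 = eps ^+ 2 - 4 by rewrite /ricci3; ring.
move: (mcurv _ _ _ _ x) (gauss_kronecker _ _ _ _ x) (dot _ (diag3 _ _ _ _)).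
move=> h g d; move: (unit_normal _ _) => n; move: (diag3 _ _ _ n) => Qn.
by apply/rowP => k; rewrite !(addvE, oppvE, scalevE); vring.
Qed.

End Surface.

(** * Algebra of the shape operator at a point *)

Section ShapeAlgebra.
Variables (R : realType) (t1 t2 n : 'rV[R]_3) (J : R).
Hypotheses (J0 : J != 0) (Jn : J *: n = cross t1 t2) (nn : dot n n = 1).
Variables (N1 N2 : 'rV[R]_3) (h d : R).
Hypotheses (N1n : dot N1 n = 0) (N2n : dot N2 n = 0) (symN : dot N1 t2 = dot N2 t1).
Hypothesis hE : J * h = dot (cross t2 N1 + cross N2 t1) n.
Hypothesis dE : J * d = dot n (cross N1 N2).

Let span_coef : exists a b c e, [/\ N1 = a *: t1 + b *: t2, N2 = c *: t1 + e *: t2,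
  h = - (a + e) & d = a * e - b * c].
Proof.
have [a [b N1E]] := tangent_span J0 Jn nn N1n; have [c [e N2E]] := tangent_span J0 Jn nn N2n.
exists a, b, c, e; split => //.
  apply: (mulfI J0); rewrite hE N1E N2E.
  have -> : cross t2 (a *: t1 + b *: t2) + cross (c *: t1 + e *: t2) t1 = - (a + e) *: (J *: n).
    by rewrite Jn; row3; vring.
  by rewrite scalerA dotZl nn mulr1 mulrC.
apply: (mulfI J0); rewrite dE N1E N2E.
have -> : cross (a *: t1 + b *: t2) (c *: t1 + e *: t2) = (a * e - b * c) *: (J *: n).
  by rewrite Jn; row3; vring.
by rewrite scalerA dotZr nn mulr1 mulrC.
Qed.

(** The relation [III - h II + d I = 0] between the fundamental forms, where II has entries
    [- dot N_i t_j]; the symmetry of II enters as [S0]. *)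
Lemma cayley_hamilton :
  [/\ dot N1 N1 + h * dot N1 t1 + d * dot t1 t1 = 0,
      dot N1 N2 + h * dot N1 t2 + d * dot t1 t2 = 0 &
      dot N2 N2 + h * dot N2 t2 + d * dot t2 t2 = 0].
Proof.
have [a [b [c [e [N1E N2E hab dab]]]]] := span_coef.
move: symN; rewrite N1E N2E hab dab !dot_lin [dot t2 t1]dotC.
move: (dot t1 t1) (dot t1 t2) (dot t2 t2) => p q r s.
have S0 : a * q + b * r - (c * p + e * q) = 0 by rewrite s subrr.
split.
- by transitivity (b * (a * q + b * r - (c * p + e * q))); [ring|rewrite S0 mulr0].
- by transitivity (- a * (a * q + b * r - (c * p + e * q))); [ring|rewrite S0 mulr0].
- by transitivity (- c * (a * q + b * r - (c * p + e * q))); [ring|rewrite S0 mulr0].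
Qed.

Lemma umbilic_trace k : N1 = - k *: t1 -> N2 = - k *: t2 -> h = 2 * k /\ d = k ^+ 2.
Proof.
move=> E1 E2; split.
  apply: (mulfI J0); rewrite hE E1 E2.
  have -> : cross t2 (- k *: t1) + cross (- k *: t2) t1 = (2 * k) *: (J *: n).
    by rewrite Jn; row3; vring.
  by rewrite scalerA dotZl nn mulr1 mulrC.
apply: (mulfI J0); rewrite dE E1 E2.
have -> : cross (- k *: t1) (- k *: t2) = (k ^+ 2) *: (J *: n).
  by rewrite Jn; row3; vring.
by rewrite scalerA dotZr nn mulr1 mulrC.
Qed.

(* A normal orthogonal to the third frame field, i.e. tangent to the base. *)
Hypothesis n2 : n 0 2 = 0.

Let u := vec3 (n 0 1) (- n 0 0) 0.

Let nn2 : n 0 0 * n 0 0 + n 0 1 * n 0 1 = 1.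
Proof. by move: nn; rewrite dot3E n2 mulr0 addr0. Qed.

Lemma horizontal_split v : dot v n = 0 -> v = dot v u *: u + v 0 2 *: vec3 0 0 1.
Proof.
move=> vn; have E : v 0 0 * n 0 0 + v 0 1 * n 0 1 = 0.
  by move: vn; rewrite dot3E n2 mulr0 addr0.
have v0 : v 0 0 = (v 0 0 * n 0 1 - v 0 1 * n 0 0) * n 0 1.
  rewrite -[LHS]mulr1 -nn2.
  transitivity (n 0 0 * (v 0 0 * n 0 0 + v 0 1 * n 0 1) + (v 0 0 * n 0 1 - v 0 1 * n 0 0) * n 0 1).
    by vring.
  by rewrite E mulr0 add0r.
have v1 : v 0 1 = (v 0 0 * n 0 1 - v 0 1 * n 0 0) * - n 0 0.
  rewrite -[LHS]mulr1 -nn2.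
  transitivity (n 0 1 * (v 0 0 * n 0 0 + v 0 1 * n 0 1) + (v 0 0 * n 0 1 - v 0 1 * n 0 0) * - n 0 0).
    by vring.
  by rewrite E mulr0 add0r.
rewrite dot3E /u !vecE; row3; last by vring.
  by rewrite {1}v0; vring.
by rewrite {1}v1; vring.
Qed.

Variables (eps a1 a2 : R).
Hypothesis eps0 : eps != 0.
Hypotheses (N1E : N1 = a1 *: u + cross (diag3 eps eps (2 / eps - eps) t1) n).
Hypotheses (N2E : N2 = a2 *: u + cross (diag3 eps eps (2 / eps - eps) t2) n).
Hypotheses (t1n : dot t1 n = 0) (t2n : dot t2 n = 0).

Let l := 2 / eps - eps.

Let cross_u x z : cross (diag3 eps eps l (x *: u + z *: vec3 0 0 1)) n
  = - (l * z) *: u + (eps * x) *: vec3 0 0 1.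
Proof.
have -> : (eps * x) *: vec3 0 0 (1 : R) =
    (eps * x * (n 0 0 * n 0 0 + n 0 1 * n 0 1)) *: vec3 0 0 1.
  by rewrite nn2 mulr1.
by rewrite /u; row3; rewrite ?n2; vring.
Qed.

Let cross_uu x z x' z' : cross (x *: u + z *: vec3 0 0 1) (x' *: u + z' *: vec3 0 0 1)
  = (x' * z - x * z') *: n.
Proof. by rewrite /u; row3; rewrite ?n2; vring. Qed.

Let dot_uu x z x' z' : dot (x *: u + z *: vec3 0 0 1) (x' *: u + z' *: vec3 0 0 1)
  = x * x' + z * z'.
Proof.
transitivity (x * x' * (n 0 0 * n 0 0 + n 0 1 * n 0 1) + z * z'); last by rewrite nn2 mulr1.
by rewrite dot3E /u !vecE; vring.
Qed.

(** In the orthonormal tangent basis formed by [u] and the vertical vector, the vertical component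
    of the derivative of n comes from [L] alone: eps along [u], 0 along the fibre. Symmetry and the
    trace then determine the matrix, with rows [(- h, eps)] and [(eps, 0)]. *)
Lemma horizontal_shape : d = - eps ^+ 2 /\
  (a1 = 2 / eps * t1 0 2 - h * dot t1 u /\ a2 = 2 / eps * t2 0 2 - h * dot t2 u).
Proof.
have T1 := horizontal_split t1n; have T2 := horizontal_split t2n.
move: (dot t1 u) (dot t2 u) (t1 0 2) (t2 0 2) T1 T2 => x1 x2 z1 z2 T1 T2.
move: N1E N2E Jn symN hE dE; rewrite T1 T2.
rewrite !cross_u => M1 M2; rewrite M1 M2 cross_uu.
have -> : a1 *: u + (- (l * z1) *: u + (eps * x1) *: vec3 0 0 1)
  = (a1 - l * z1) *: u + (eps * x1) *: vec3 0 0 1 by rewrite addrA -scalerDl.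
have -> : a2 *: u + (- (l * z2) *: u + (eps * x2) *: vec3 0 0 1)
  = (a2 - l * z2) *: u + (eps * x2) *: vec3 0 0 1 by rewrite addrA -scalerDl.
rewrite !cross_uu !dot_uu !dot_lin nn !mulr1 => Jn' s hh dd.
have JE : J = x2 * z1 - x1 * z2.
  by have := congr1 (dot n) Jn'; rewrite !dotZr nn !mulr1.
have [b1 E1] : exists b, a1 - l * z1 = b by eexists.
have [b2 E2] : exists b, a2 - l * z2 = b by eexists.
rewrite E1 E2 in s hh dd.
have {}hh : J * h = b1 * z2 - b2 * z1 by rewrite hh; ring.
have {}s : b1 * x2 - b2 * x1 = eps * J.
  by rewrite JE -[b1 * x2](addrK (eps * x1 * z2)) s; ring.
have B1 : b1 = eps * z1 - h * x1.
  apply: (mulfI J0); transitivity ((b1 * x2 - b2 * x1) * z1 - x1 * (b1 * z2 - b2 * z1)).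
    by rewrite JE; ring.
  by rewrite s -hh; ring.
have B2 : b2 = eps * z2 - h * x2.
  apply: (mulfI J0); transitivity ((b1 * x2 - b2 * x1) * z2 - x2 * (b1 * z2 - b2 * z1)).
    by rewrite JE; ring.
  by rewrite s -hh; ring.
split.
  apply: (mulfI J0); rewrite dd; transitivity (- eps * (b1 * x2 - b2 * x1)); first by ring.
  by rewrite s; ring.
split.
  by rewrite -[a1](subrK (l * z1)) E1 B1 /l; field.
by rewrite -[a2](subrK (l * z2)) E2 B2 /l; field.
Qed.

End ShapeAlgebra.

Section OrthonormalFrame.
Variables (R : realType) (n e : 'rV[R]_3).
Hypotheses (nn : dot n n = 1) (ee : dot e e = 1) (ne : dot n e = 0).

Lemma parseval v w : dot v w =
  dot v e * dot w e + dot v (cross n e) * dot w (cross n e) + dot v n * dot w n.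
Proof.
have E1 : cross e (cross n e) = n by rewrite cross_cross ee dotC ne scale1r scale0r subr0.
have E2 : cross (cross n e) n = e by rewrite cross_crossl nn dotC ne scale1r scale0r subr0.
have := cramer e (cross n e) n v; rewrite E1 nn scale1r E2 => {1}->.
by rewrite !dot_lin ![dot _ w]dotC.
Qed.

End OrthonormalFrame.

(** * Isoparametric surfaces of the round sphere *)

Section PrincipalFrame.
Variable R : realType.

Lemma frame_decomp (n e v : 'rV[R]_3) : dot n n = 1 -> dot e e = 1 -> dot n e = 0 ->
  v = dot v e *: e + dot v (cross n e) *: cross n e + dot v n *: n.
Proof.
move=> nn ee ne.
have E1 : cross e (cross n e) = n by rewrite cross_cross ee dotC ne scale1r scale0r subr0.
have E2 : cross (cross n e) n = e by rewrite cross_crossl nn dotC ne scale1r scale0r subr0.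
by have := cramer e (cross n e) n v; rewrite E1 nn scale1r E2.
Qed.

(** Two orthogonal non-zero subspaces of a plane are lines. The last condition records that the
    differences [Z_i - Y_i] form a basis. *)
Lemma principal_frame (n Y0 Y1 Z0 Z1 : 'rV[R]_3) : dot n n = 1 ->
  dot Y0 n = 0 -> dot Y1 n = 0 -> dot Z0 n = 0 -> dot Z1 n = 0 ->
  dot Y0 Z0 = 0 -> dot Y0 Z1 = 0 -> dot Y1 Z0 = 0 -> dot Y1 Z1 = 0 ->
  ~ (Y0 = 0 /\ Y1 = 0) -> ~ (Z0 = 0 /\ Z1 = 0) -> cross (Z0 - Y0) (Z1 - Y1) != 0 ->
  exists e y0 y1 z0 z1, [/\ dot e e = 1, dot n e = 0 &
    [/\ Y0 = y0 *: e, Y1 = y1 *: e, Z0 = z0 *: cross n e & Z1 = z1 *: cross n e]] /\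
    y0 * z1 - y1 * z0 != 0.
Proof.
move=> nn Y0n Y1n Z0n Z1n o00 o01 o10 o11 Yn0 Zn0 cr.
(* One of Y0, Y1 may vanish, so the direction of e comes from any non-zero tangent V orthogonal to
   Z0 and Z1. *)
suff gen V : V != 0 -> dot V n = 0 -> dot V Z0 = 0 -> dot V Z1 = 0 ->
  exists e y0 y1 z0 z1, [/\ dot e e = 1, dot n e = 0 &
    [/\ Y0 = y0 *: e, Y1 = y1 *: e, Z0 = z0 *: cross n e & Z1 = z1 *: cross n e]] /\
    y0 * z1 - y1 * z0 != 0.
  have [Y00|Y00] := eqVneq Y0 0; last exact: (gen Y0).
  have [Y10|Y10] := eqVneq Y1 0; last exact: (gen Y1).
  by case: Yn0.
move=> V0 Vn V0' V1'.
pose k := (Num.sqrt (dot V V))^-1; pose e := k *: V.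
have ee : dot e e = 1.
  rewrite dotZl dotZr mulrA -[X in _ * X](sqr_sqrtr (dot_ge0 V)) -expr2 -exprMn mulVf ?expr1n //.
  by rewrite gt_eqF // sqrtr_gt0 dot_gt0.
have ne : dot n e = 0 by rewrite dotZr dotC Vn mulr0.
have ez z : dot V z = 0 -> dot z e = 0 by rewrite dotZr dotC => ->; rewrite mulr0.
have ZE z : dot z n = 0 -> dot V z = 0 -> z = dot z (cross n e) *: cross n e.
  by move=> zn /ez ze; rewrite {1}(frame_decomp z nn ee ne) zn ze !scale0r add0r addr0.
have YE y : dot y n = 0 -> dot y Z0 = 0 -> dot y Z1 = 0 -> y = dot y e *: e.
  move=> yn y0 y1; have ye' : dot y (cross n e) = 0.
    have [z00|z00] := eqVneq (dot Z0 (cross n e)) 0.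
      have [z10|z10] := eqVneq (dot Z1 (cross n e)) 0.
        by case: Zn0; rewrite (ZE _ Z0n V0') (ZE _ Z1n V1') z00 z10 !scale0r.
      by apply: (mulfI z10); rewrite -dotZr -(ZE _ Z1n V1') y1 mulr0.
    by apply: (mulfI z00); rewrite -dotZr -(ZE _ Z0n V0') y0 mulr0.
  by rewrite {1}(frame_decomp y nn ee ne) yn ye' !scale0r !addr0.
exists e, (dot Y0 e), (dot Y1 e), (dot Z0 (cross n e)), (dot Z1 (cross n e)).
have [E0 E1 F0 F1] := And4 (YE _ Y0n o00 o01) (YE _ Y1n o10 o11) (ZE _ Z0n V0') (ZE _ Z1n V1').
split; first by split.
apply: contraNneq cr; move: E0 E1 F0 F1.
move: (cross n e) (dot Y0 e) (dot Y1 e) (dot Z0 _) (dot Z1 _) => e' y0 y1 z0 z1 -> -> -> -> d0.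
have -> : cross (z0 *: e' - y0 *: e) (z1 *: e' - y1 *: e) = (- (y0 * z1 - y1 * z0)) *: cross e e'.
  by row3; vring.
by rewrite d0 oppr0 scale0r.
Qed.

(** A totally symmetric trilinear form on the plane, killed by [(y1, - y0)] in its second slot and
    by [(z1, - z0)] in its third. By symmetry both vectors kill it in every slot, and they span the
    plane. *)
Lemma cubic_vanish (A : bool -> bool -> bool -> R) (y0 y1 z0 z1 : R) :
  (forall j, A false true j = A true false j) -> (forall i, A false i true = A true i false) ->
  (forall k j, y1 * A k false j = y0 * A k true j) ->
  (forall k i, z1 * A k i false = z0 * A k i true) ->
  y0 * z1 - y1 * z0 != 0 -> forall k i j, A k i j = 0.
Proof.
move=> s1 s2 c1 c2 d0.
have e1 : A false true false = A true false false by rewrite s1.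
have e2 : A false false true = A true false false by rewrite s2.
have e3 : A false true true = A true true false by rewrite s2.
have e4 : A true false true = A true true false by rewrite -s1 s2.
have key a b : y1 * a = y0 * b -> z1 * a = z0 * b -> a = 0.
  move=> p q; apply: (mulfI d0); rewrite mulr0.
  transitivity (y0 * (z1 * a) - z0 * (y1 * a)); first by ring.
  by rewrite p q; ring.
have a0 : A false false false = 0.
  by apply: (key _ (A true false false)); [rewrite c1 e1 | rewrite c2 e2].
have b0 : A true false false = 0.
  by apply: (key _ (A true true false)); [rewrite c1 | rewrite c2 e4].
have c0 : A true true false = 0.
  by apply: (key _ (A true true true)); [rewrite -e4 c1 | rewrite c2].
have d1 : A true true true = 0.
  have := c1 true true; have := c2 true true; rewrite e4 c0 !mulr0 => p q.
  apply: (mulfI d0); rewrite mulr0.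
  transitivity (z1 * (y0 * A true true true) - y1 * (z0 * A true true true)); first by ring.
  by rewrite -p -q !mulr0 subrr.
by do 3![case]; rewrite ?e1 ?e2 ?e3 ?e4.
Qed.

End PrincipalFrame.

Section Isoparametric.
Variables (R : realType) (l1 l2 l3 : R) (U : set 'rV[R]_2).
Variable th : 'rV[R]_2 -> 'rV[R]_2 -> 'rV[R]_3.
Let e0 : 'rV[R]_2 := basis_vector R 0.
Let e1 : 'rV[R]_2 := basis_vector R 1.
Local Notation "'N_ v w" := (nab l1 l2 l3 th v w) (at level 10, v at level 1, w at level 9).
Hypothesis openU : open U.
Hypothesis smooth_th : forall v, Cinfv U (th v).
Hypothesis torsion_free : forall x, U x -> 'N_e0 (th e1) x = 'N_e1 (th e0) x.
Hypothesis nab_curv : forall w x, U x -> Cinfv U w ->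
  'N_e0 ('N_e1 w) x - 'N_e1 ('N_e0 w) x = cross (- cross (th e0 x) (th e1 x)) (w x).
Hypothesis th_indep : forall x, U x -> cross (th e0 x) (th e1 x) != 0.

Let nu := unit_normal th.
Let h := mcurv l1 l2 l3 th.
Let gk := gauss_kronecker l1 l2 l3 th.
Variable hh : R.
Hypothesis hh0 : hh != 0.
Hypothesis h_sqr : forall x, U x -> h x ^+ 2 = hh.
Hypothesis h_cst : forall v x, U x -> 'D_v h x = 0.
Hypothesis h_gk : forall x, U x -> h x ^+ 2 - 2 * gk x = 2.

Let gkE x : U x -> gk x = (hh - 2) / 2.
Proof. by move=> Ux; have := h_gk Ux; rewrite h_sqr // => E; rewrite -{1}E; field. Qed.

Let J0 x : U x -> area th x != 0. Proof. by move=> /(area_gt0 th_indep) /lt0r_neq0. Qed.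

Lemma surface_CH x : U x ->
  [/\ dot ('N_e0 nu x) ('N_e0 nu x) + h x * dot ('N_e0 nu x) (th e0 x)
        + gk x * dot (th e0 x) (th e0 x) = 0,
      dot ('N_e0 nu x) ('N_e1 nu x) + h x * dot ('N_e0 nu x) (th e1 x)
        + gk x * dot (th e0 x) (th e1 x) = 0,
      dot ('N_e1 nu x) ('N_e1 nu x) + h x * dot ('N_e1 nu x) (th e1 x)
        + gk x * dot (th e1 x) (th e1 x) = 0 &
      dot ('N_e0 nu x) (th e1 x) = dot ('N_e1 nu x) (th e0 x)].
Proof.
move=> Ux; have sym := N_symmetric openU smooth_th torsion_free th_indep Ux.
have gE : area th x * gk x = dot (nu x) (cross ('N_e0 nu x) ('N_e1 nu x)).
  by rewrite /gk /gauss_kronecker mulrA mulfV ?mul1r // J0.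
have [c1 c2 c3] := cayley_hamilton (J0 Ux) (area_normal th_indep Ux) (normal_unit th_indep Ux)
  (N_normal l1 l2 l3 openU smooth_th th_indep Ux e0)
  (N_normal l1 l2 l3 openU smooth_th th_indep Ux e1) sym (areaE l1 l2 l3 th_indep Ux) gE.
by split.
Qed.

(** The traceless part of the shape operator squares to [h^2 / 4 - d], which is [1 - h^2 / 4]
    because [2 d = h^2 - 2]. *)
Lemma traceless_shape x : U x ->
  dot ('N_e0 nu x + (h x / 2) *: th e0 x) ('N_e0 nu x + (h x / 2) *: th e0 x)
    = (1 - hh / 4) * dot (th e0 x) (th e0 x) /\
  dot ('N_e1 nu x + (h x / 2) *: th e1 x) ('N_e1 nu x + (h x / 2) *: th e1 x)
    = (1 - hh / 4) * dot (th e1 x) (th e1 x).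
Proof.
move=> Ux; have [c1 _ c3 _] := surface_CH Ux; have := gkE Ux.
rewrite -(h_sqr Ux); move: c1 c3.
move: ('N_e0 nu x) ('N_e1 nu x) (th e0 x) (th e1 x) (h x) (gk x) => A B a b k d c1 c3 dE.
have H v t : dot v v + k * dot v t + d * dot t t = 0 ->
    dot (v + (k / 2) *: t) (v + (k / 2) *: t) = (1 - k ^+ 2 / 4) * dot t t.
  rewrite dE !dot_lin [dot t v]dotC; move: (dot v v) (dot v t) (dot t t) => p q r E.
  transitivity ((p + k * q + (k ^+ 2 - 2) / 2 * r) + (1 - k ^+ 2 / 4) * r); first by field.
  by rewrite E add0r.
by split; exact: H.
Qed.

Lemma th0_gt0 x : U x -> 0 < dot (th e0 x) (th e0 x).
Proof.
move=> Ux; rewrite dot_gt0; apply/eqP => t0; have := th_indep Ux.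
by rewrite t0 (_ : cross 0 _ = 0) ?eqxx //; row3; rewrite !mul0r subrr.
Qed.

(* Distinct principal curvatures k1, k2: [Y v] and [Z v] are the orthogonal images
   of v under the shape operator shifted by k2 and k1. By Codazzi the form
   <nabla_u (Y v), Z w> is totally symmetric, hence zero; differentiating once more,
   the Ricci identity gives 1 + k1 k2 = 0, while 1 + k1 k2 = h^2 / 2. *)
Section Distinct.
Hypothesis hh4 : hh < 4.
(** Root of the discriminant: [h^2 - 4 d = 4 - h^2], as [2 d = h^2 - 2]. *)
Let rho := Num.sqrt (4 - hh).
Let k2 x := (h x - rho) / 2.
Let k1 x := (h x + rho) / 2.
Let Y v x := 'N_v nu x + k2 x *: th v x.
Let Z v x := 'N_v nu x + k1 x *: th v x.

Let rho2 : rho ^+ 2 = 4 - hh. Proof. by rewrite sqr_sqrtr // subr_ge0 ltW. Qed.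
Let rho0 : rho != 0. Proof. by rewrite gt_eqF // sqrtr_gt0 subr_gt0. Qed.

Let cN v : Cinfv U ('N_v nu).
Proof. by apply: Cinfv_nab => //; exact: Cinfv_normal. Qed.

Let ch : Cinf U h. Proof. exact: Cinf_mcurv. Qed.

Let ck c : Cinf U (fun x => (h x + c) / 2).
Proof.
exact: (Cinf_mul openU (Cinf_add openU ch (Cinf_cst openU c)) (Cinf_cst openU 2^-1)).
Qed.

Let dk c v x : U x -> 'D_v (fun x => (h x + c) / 2) x = 0.
Proof.
move=> Ux; have dh := Cinf_differentiable ch Ux.
have dc (b : R) : differentiable (fun _ : 'rV[R]_2 => b) x by exact: differentiable_cst.
rewrite (derive_mul v (differentiable_add dh (dc c)) (dc 2^-1)) (derive_add v dh (dc c)).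
by rewrite h_cst // !(derive_cst (_ : R)) addr0 mul0r mulr0 addr0.
Qed.

Let dot_skew v W W' c x : (forall z, U z -> dot (W z) (W' z) = c) -> Cinfv U W -> Cinfv U W' ->
  U x -> dot ('N_v W x) (W' x) = - dot (W x) ('N_v W' x).
Proof.
move=> WW cW cW' Ux.
have := derive_dot_nab l1 l2 l3 th v (Cinfv_differentiable cW Ux) (Cinfv_differentiable cW' Ux).
rewrite (eq_on_derive openU v WW Ux) (derive_cst (_ : R)).
by move/esym/eqP; rewrite addr_eq0 => /eqP.
Qed.

Let cS c v : Cinfv U (fun x => 'N_v nu x + ((h x + c) / 2) *: th v x).
Proof. exact: (Cinfv_add openU (cN v) (Cinfv_scale openU (ck c) (smooth_th v))). Qed.

(** For constant curvature the Ricci identity applied to n yields a multiple of [cross nu nu], and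
    the shift by [(h + c) / 2] is constant. *)
Let codazzi c x : U x ->
  'N_e0 (fun x => 'N_e1 nu x + ((h x + c) / 2) *: th e1 x) x =
  'N_e1 (fun x => 'N_e0 nu x + ((h x + c) / 2) *: th e0 x) x.
Proof.
move=> Ux; have dth v := Cinfv_differentiable (smooth_th v) Ux.
have dN v := Cinfv_differentiable (cN v) Ux; have dkc := Cinf_differentiable (ck c) Ux.
have ds v := differentiable_scale dkc (dth v).
rewrite (nab_add _ _ _ _ _ (dN e1) (ds e1)) (nab_add _ _ _ _ _ (dN e0) (ds e0)).
rewrite (nab_scale _ _ _ _ _ dkc (dth e1)) (nab_scale _ _ _ _ _ dkc (dth e0)).
rewrite !dk // !scale0r !add0r torsion_free //; congr (_ + _).
have cnu := Cinfv_normal openU smooth_th th_indep.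
have := nab_curv Ux cnu; rewrite -(area_normal th_indep Ux) => /eqP.
by rewrite -scaleNr crossZl crossvv scaler0 subr_eq0 => /eqP.
Qed.

Let kk x : U x -> k1 x * k2 x = gk x.
Proof.
move=> Ux; transitivity ((h x ^+ 2 - rho ^+ 2) / 4).
  by rewrite /k1 /k2; move: (h x) rho => p q; field.
by rewrite gkE // rho2 h_sqr //; field.
Qed.

(** The shape operator is self-adjoint and a root of [(A - k1) (A - k2)]. *)
Let orth x : U x ->
  [/\ dot (Y e0 x) (Z e0 x) = 0, dot (Y e0 x) (Z e1 x) = 0,
      dot (Y e1 x) (Z e0 x) = 0 & dot (Y e1 x) (Z e1 x) = 0].
Proof.
move=> Ux; have [c1 c2 c3 sym] := surface_CH Ux.
have ks : k1 x + k2 x = h x by rewrite /k1 /k2; field.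
move: c1 c2 c3 sym; rewrite /Y /Z -(kk Ux) -ks.
move: ('N_e0 nu x) ('N_e1 nu x) (th e0 x) (th e1 x) (k1 x) (k2 x) => A B a b r1 r2 c1 c2 c3 sym.
have G v w t t' : dot v t' = dot w t ->
    dot v w + (r1 + r2) * dot v t' + r1 * r2 * dot t t' = 0 ->
    dot (v + r2 *: t) (w + r1 *: t') = 0.
  move=> E <-; rewrite !dot_lin [dot t w]dotC -E.
  by move: (dot _ _) (dot _ _) (dot _ _) => *; ring.
split; apply: G => //.
by rewrite [dot B A]dotC [dot b a]dotC -sym.
Qed.

Let ev (b : bool) := if b then e1 else e0.

Let codazzi_b c b z : U z ->
  'N_(ev b) (fun x => 'N_(ev (~~ b)) nu x + ((h x + c) / 2) *: th (ev (~~ b)) x) z =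
  'N_(ev (~~ b)) (fun x => 'N_(ev b) nu x + ((h x + c) / 2) *: th (ev b) x) z.
Proof. by move=> Uz; case: b => /=; rewrite codazzi. Qed.

Let orth_b i j x : U x -> dot (Y (ev i) x) (Z (ev j) x) = 0.
Proof. by move=> /orth []; case: i; case: j. Qed.

Let normalS c b x : U x -> dot ('N_(ev b) nu x + ((h x + c) / 2) *: th (ev b) x) (nu x) = 0.
Proof.
move=> Ux; rewrite dotDl dotZl (N_normal l1 l2 l3 openU smooth_th th_indep Ux) add0r dotC.
by case: b; rewrite ?(normal_t1 th_indep Ux) ?(normal_t2 th_indep Ux) mulr0.
Qed.

Let sY b : Cinfv U (Y (ev b)). Proof. exact: (cS (- rho) (ev b)). Qed.
Let sZ b : Cinfv U (Z (ev b)). Proof. exact: (cS rho (ev b)). Qed.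

(** An umbilic point with principal curvature [(h + c) / 2] has trace [h + c], not h. *)
Let not_umbilic c x : U x -> c != 0 -> ~ ('N_e0 nu x + ((h x + c) / 2) *: th e0 x = 0 /\
  'N_e1 nu x + ((h x + c) / 2) *: th e1 x = 0).
Proof.
move=> Ux c0 [A0 A1].
have E0 : 'N_e0 nu x = - ((h x + c) / 2) *: th e0 x.
  by rewrite [RHS]scaleNr; apply/eqP; rewrite -addr_eq0 A0.
have E1 : 'N_e1 nu x = - ((h x + c) / 2) *: th e1 x.
  by rewrite [RHS]scaleNr; apply/eqP; rewrite -addr_eq0 A1.
have gE : area th x * gk x = dot (nu x) (cross ('N_e0 nu x) ('N_e1 nu x)).
  by rewrite /gk /gauss_kronecker mulrA mulfV ?mul1r // J0.
have [] := umbilic_trace (J0 Ux) (area_normal th_indep Ux) (normal_unit th_indep Ux)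
  (areaE l1 l2 l3 th_indep Ux) gE E0 E1.
rewrite -/(h x) => hE _; move: c0; apply/negP/negPn/eqP.
by apply: (addrI (h x)); rewrite addr0 [RHS]hE; field.
Qed.

Let frame_at x : U x -> exists e y0 y1 z0 z1,
  [/\ dot e e = 1, dot (nu x) e = 0 &
    [/\ Y e0 x = y0 *: e, Y e1 x = y1 *: e, Z e0 x = z0 *: cross (nu x) e
      & Z e1 x = z1 *: cross (nu x) e]] /\ y0 * z1 - y1 * z0 != 0.
Proof.
move=> Ux; have [p1 p2 p3 p4] := orth Ux.
apply: principal_frame p1 p2 p3 p4 _ _ _.
- exact: (normal_unit th_indep Ux).
- exact: (normalS (- rho) false Ux).
- exact: (normalS (- rho) true Ux).
- exact: (normalS rho false Ux).
- exact: (normalS rho true Ux).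
- by apply: (not_umbilic Ux); rewrite oppr_eq0.
- exact: (not_umbilic Ux).
have E v : Z v x - Y v x = rho *: th v x.
  rewrite /Z /Y /k1 /k2; move: ('N_v nu x) (th v x) (h x) => A t a.
  by apply/rowP => k; rewrite !(addvE, oppvE, scalevE); gen_entries; field.
rewrite !E crossZl crossZr scalerA scaler_eq0 (negbTE (th_indep Ux)) orbF.
by rewrite mulf_neq0.
Qed.

Let form_vanish x k i j : U x -> dot ('N_(ev k) (Y (ev i)) x) (Z (ev j) x) = 0.
Proof.
move=> Ux.
have D a b c : dot ('N_(ev a) (Y (ev b)) x) (Z (ev c) x)
    = - dot (Y (ev b) x) ('N_(ev a) (Z (ev c)) x).
  exact: (dot_skew _ (fun z Uz => orth_b b c Uz) (sY b) (sZ c) Ux).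
have [e [y0 [y1 [z0 [z1 [[ee ne [E0 E1 F0 F1]] d0]]]]]] := frame_at Ux.
apply: (@cubic_vanish _ (fun a b c => dot ('N_(ev a) (Y (ev b)) x) (Z (ev c) x)) y0 y1 z0 z1) => //.
- by move=> c; rewrite (codazzi_b (- rho) false Ux).
(* As Y and Z are orthogonal, the derivative moves over to Z at the cost of a sign, and the Codazzi
   equation for Z gives the second symmetry. *)
- by move=> b; rewrite !D (codazzi_b rho false Ux).
- by move=> a c; rewrite !D E0 E1 !dotZl; move: (dot e _) => p; ring.
- by move=> a b; rewrite F0 F1 !dotZr; move: (dot _ _) => p; ring.
Qed.

Lemma distinct_absurd x : ~ U x.
Proof.
move=> Ux; have [e [y0 [y1 [z0 [z1 [[ee ne [E0 E1 F0 F1]] d0]]]]]] := frame_at Ux.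
have cnab a b : Cinfv U ('N_(ev a) (Y (ev b))) by exact: Cinfv_nab.
have cnu := Cinfv_normal openU smooth_th th_indep.
have D l k i j : dot ('N_(ev l) ('N_(ev k) (Y (ev i))) x) (Z (ev j) x)
    = - dot ('N_(ev k) (Y (ev i)) x) ('N_(ev l) (Z (ev j)) x).
  exact: (dot_skew _ (fun z Uz => form_vanish k i j Uz) (cnab k i) (sZ j) Ux).
have nY a b : dot ('N_(ev a) (Y (ev b)) x) (nu x) = - dot (Y (ev b) x) ('N_(ev a) nu x).
  exact: (dot_skew _ (fun z Uz => normalS (- rho) b Uz) (sY b) cnu Ux).
have nZ a b : dot ('N_(ev a) (Z (ev b)) x) (nu x) = - dot (Z (ev b) x) ('N_(ev a) nu x).
  exact: (dot_skew _ (fun z Uz => normalS rho b Uz) (sZ b) cnu Ux).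
pose y b := if b then y1 else y0; pose z b := if b then z1 else z0.
have EY b : Y (ev b) x = y b *: e by case: b.
have EZ b : Z (ev b) x = z b *: cross (nu x) e by case: b.
have yz : exists b c, y b != 0 /\ z c != 0.
  have [p0|p0] := eqVneq (y0 * z1) 0.
    exists true, false; split; apply: contraNneq d0 => q0; rewrite p0 /= in q0 *;
    by rewrite q0 ?mul0r ?mulr0 subrr.
  by exists false, true; move: p0; rewrite mulf_eq0 negb_or => /andP.
have [b0 [c0 [yb zc]]] := yz.
have tY a b : dot ('N_(ev a) (Y (ev b)) x) (cross (nu x) e) = 0.
  by apply: (mulfI zc); rewrite -dotZr -EZ form_vanish // mulr0.
have tZ a b : dot ('N_(ev a) (Z (ev b)) x) e = 0.
  apply: (mulfI yb); rewrite -dotZr -EY dotC.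
  rewrite -[LHS]opprK -(dot_skew _ (fun z Uz => orth_b b0 b Uz) (sY b0) (sZ b) Ux).
  by rewrite form_vanish // oppr0 mulr0.
(* The tangential parts of the two derivatives lie along e and along [cross (nu x) e], so only the
   normal components pair. *)
have P k i l j : dot ('N_(ev k) (Y (ev i)) x) ('N_(ev l) (Z (ev j)) x)
    = dot (Y (ev i) x) ('N_(ev k) nu x) * dot (Z (ev j) x) ('N_(ev l) nu x).
  have Pg v w : dot v (cross (nu x) e) = 0 -> dot w e = 0 ->
      dot v w = dot v (nu x) * dot w (nu x).
    move=> v0 w0; rewrite (parseval (normal_unit th_indep Ux) ee ne v w) v0 w0.
    by rewrite mulr0 mul0r !add0r.
  apply: (etrans (Pg _ _ (tY k i) (tZ l j))).
  by apply: (etrans (congr2 *%R (nY k i) (nZ l j))); exact: mulrNN.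
have thE b : th (ev b) x = rho^-1 *: (Z (ev b) x - Y (ev b) x).
  rewrite /Z /Y /k1 /k2; move: ('N_(ev b) nu x) (th (ev b) x) (h x) => A t a.
  by apply/rowP => k; rewrite !(addvE, oppvE, scalevE); gen_entries; field.
have nuE b : 'N_(ev b) nu x = rho^-1 *: (k1 x *: Y (ev b) x - k2 x *: Z (ev b) x).
  rewrite /Z /Y /k1 /k2; move: ('N_(ev b) nu x) (th (ev b) x) (h x) => A t a.
  by apply/rowP => k; rewrite !(addvE, oppvE, scalevE); gen_entries; field.
have e'e' : dot (cross (nu x) e) (cross (nu x) e) = 1.
  by rewrite lagrange (normal_unit th_indep Ux) ee ne mulr1 mulr0 subr0.
have e'e : dot (cross (nu x) e) e = 0 by rewrite dot_cross_same2.
have ee' : dot e (cross (nu x) e) = 0 by rewrite dotC.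
(* The Ricci identity for Y paired with Z: the normal components contribute [k1 k2], the curvature
   of the round sphere contributes 1. *)
have K i j : (y0 * z1 - y1 * z0) * (1 + k1 x * k2 x) * (y i * z j) = 0.
  have C := nab_curv Ux (sY i).
  have := congr1 (fun v => dot v (Z (ev j) x)) C.
  rewrite dotDl dotNl (D false true i j) (D true false i j) !P.
  rewrite (nuE false) (nuE true) -/(ev false) -/(ev true) !EY !EZ.
  rewrite (thE false) (thE true) -/(ev false) -/(ev true) !EY !EZ.
  move: (cross (nu x) e) e'e' e'e ee' => f ff fe ef.
  have -> : - cross (rho^-1 *: (z false *: f - y false *: e)) (rho^-1 *: (z true *: f - y true *: e))
    = (rho^-1 * rho^-1 * (y0 * z1 - y1 * z0)) *: cross e f.
    by move: (rho^-1) => r; rewrite /y /z; row3; vring.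
  rewrite crossZl crossZr cross_crossl ee fe scale1r scale0r subr0.
  rewrite !dot_lin ee ff fe ef.
  move: (k1 x) (k2 x) (y i) (z j) => r1 r2 yi zj; rewrite /y /z => E.
  have r0 : rho^-1 * rho^-1 != 0 by rewrite mulf_neq0 // invr_neq0.
  apply: (mulfI r0); rewrite mulr0; move: E => /eqP; rewrite -subr_eq0 => /eqP E.
  by rewrite -[RHS]oppr0 -E; move: (rho^-1) => r; ring.
have kk0 : 1 + k1 x * k2 x != 0.
  have -> : 1 + k1 x * k2 x = hh / 2 by rewrite kk // gkE //; field.
  by rewrite mulf_neq0 // invr_eq0 pnatr_eq0.
move: (K b0 c0) => /eqP; rewrite !mulf_eq0.
by rewrite (negbTE d0) (negbTE kk0) (negbTE yb) (negbTE zc).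
Qed.

End Distinct.

(** [traceless_shape] excludes [hh > 4] by positivity and forces umbilicity when [hh = 4]. *)
Theorem umbilic x : U x -> [/\ hh = 4, 'N_e0 nu x = - (h x / 2) *: th e0 x &
  'N_e1 nu x = - (h x / 2) *: th e1 x].
Proof.
move=> Ux; have [M0 M1] := traceless_shape Ux.
have hE : hh = 4.
  have [lt4|gt4|//] := ltgtP hh 4; first by case: (distinct_absurd lt4 Ux).
  have := dot_ge0 ('N_e0 nu x + (h x / 2) *: th e0 x); rewrite M0.
  rewrite pmulr_lge0 ?th0_gt0 // subr_ge0 ler_pdivrMr // mul1r => le4.
  by have := lt_le_trans gt4 le4; rewrite ltxx.
split=> //.
  apply/eqP; rewrite -subr_eq0 scaleNr opprK -dot_eq0 M0 hE.
  by rewrite mulfV ?subrr ?mul0r // pnatr_eq0.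
apply/eqP; rewrite -subr_eq0 scaleNr opprK -dot_eq0 M1 hE.
by rewrite mulfV ?subrr ?mul0r // pnatr_eq0.
Qed.

End Isoparametric.

(** * Local classification *)

Section HopfDerivatives.
Variables (R : realType) (V : normedModType R) (f : V -> 'rV[R]_4) (x v : V).
Hypothesis df : differentiable f x.

Let Df := has_deriveP v df.

Lemma derive_hopf1 : has_derive x v (fun z => hopf1 (f z)) (hopf1 ('D_v f x)).
Proof. by rewrite /hopf1; has_derive_tac. Qed.

Lemma derive_hopf2 : has_derive x v (fun z => hopf2 (f z)) (hopf2 ('D_v f x)).
Proof. by rewrite /hopf2; has_derive_tac. Qed.

Lemma derive_hopf3 : has_derive x v (fun z => hopf3 (f z)) (hopf3 ('D_v f x)).
Proof. by rewrite /hopf3; has_derive_tac. Qed.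

End HopfDerivatives.

Section Lift.
Variables (R : realType) (eps : R).
Implicit Types (p : 'rV[R]_4) (w t : 'rV[R]_3).

(** The tangent vector of the sphere with frame components w, inverse to [hcoord] on tangent
    vectors. *)
Definition lift p w : 'rV[R]_4 := w 0 0 *: hopf1 p + w 0 1 *: hopf2 p + (w 0 2 / eps) *: hopf3 p.

Lemma liftD p w t : lift p (w + t) = lift p w + lift p t.
Proof. by rewrite /lift; move: (hopf1 p) (hopf2 p) (hopf3 p) => *; row4; vring. Qed.

Lemma liftZ p k w : lift p (k *: w) = k *: lift p w.
Proof. by rewrite /lift; move: (hopf1 p) (hopf2 p) (hopf3 p) => *; row4; vring. Qed.

Lemma lift0 p : lift p 0 = 0.
Proof. by rewrite -(scale0r 0) liftZ scale0r. Qed.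

Lemma lift_orth p w : dot (lift p w) p = 0.
Proof. by rewrite dot4E /lift /hopf1 /hopf2 /hopf3 !vecE; vring. Qed.

Lemma dot_lift p w t : dot p p = 1 -> eps ^+ 2 = 1 -> dot (lift p w) (lift p t) = dot w t.
Proof.
move=> pp e1; have -> : dot w t = dot p p * dot w t by rewrite pp mul1r.
have e2 : eps^-1 * eps^-1 = 1 by rewrite -invfM -expr2 e1 invr1.
transitivity (dot p p * (w 0 0 * t 0 0 + w 0 1 * t 0 1 + (eps^-1 * eps^-1) * (w 0 2 * t 0 2))).
  by rewrite !dot4E /lift /hopf1 /hopf2 /hopf3 !vecE; vring.
by rewrite e2 mul1r dot3E.
Qed.

(** The Gauss formula of the unit sphere in R^4: the flat derivative of the frame along [lift p t]
    is the Levi-Civita part plus a multiple of the position vector. *)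
Lemma lift_connection p w t : eps ^+ 2 = 1 ->
  w 0 0 *: hopf1 (lift p t) + w 0 1 *: hopf2 (lift p t) + (w 0 2 / eps) *: hopf3 (lift p t)
  = lift p (cross (diag3 eps eps (2 / eps - eps) t) w) - dot w t *: p.
Proof.
rewrite /lift /hopf1 /hopf2 /hopf3 => /eqP; rewrite sqrf_eq1 => /orP[] /eqP ->;
  by row4; rewrite /diag3 /cross ?dot3E ?vecE ?invrN ?invr1; vring.
Qed.

Lemma lift_hcoord p (a : 'rV[R]_4) : eps ^+ 2 = 1 -> dot p p = 1 ->
  a = dot a p *: p + lift p (hcoord eps p a).
Proof.
move=> e1 pp; have e0 : eps != 0 by apply: contra_eq_neq e1 => ->; rewrite expr0n eq_sym oner_eq0.
have E : dot p p *: a = dot a p *: p + (dot a (hopf1 p) *: hopf1 p + dot a (hopf2 p) *: hopf2 p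
     + dot a (hopf3 p) *: hopf3 p).
  by rewrite !dot4E; row4; rewrite /hopf1 /hopf2 /hopf3 ?vecE; vring.
move: E; rewrite pp scale1r /lift /hcoord !vecE => {1}->.
by rewrite [eps * _]mulrC mulfK.
Qed.

End Lift.

Section HopfBase.
Variable R : realType.
Implicit Types (p v w : 'rV[R]_4) (W : 'rV[R]_3).

Lemma dhopfC p v : dhopf p v = dhopf v p.
Proof. by rewrite /dhopf; row3; vring. Qed.

Lemma dhopf_diag p : dhopf p p = 2 *: hopf p.
Proof. by rewrite hopfE /dhopf; row3; rewrite ?vecE; gen_entries; field. Qed.

(** For p on the unit sphere this expands a vector of R^3 in an orthonormal frame: the images of the
    first two Hopf fields and the outward normal [2 *: hopf p] of the base sphere. *)
Definition base p a b c : 'rV[R]_3 :=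
  a *: dhopf p (hopf1 p) + b *: dhopf p (hopf2 p) + c *: dhopf p p.

Lemma dot_base p a b c a' b' c' : dot p p = 1 ->
  dot (base p a b c) (base p a' b' c') = a * a' + b * b' + c * c'.
Proof.
move=> pp; transitivity (dot p p ^+ 2 * (a * a' + b * b' + c * c')); last by rewrite pp; ring.
by rewrite dot3E /base /dhopf /hopf1 /hopf2 dot4E ?vecE; gen_entries; ring.
Qed.

Lemma hopf_base p : hopf p = base p 0 0 2^-1.
Proof. by rewrite /base dhopf_diag !scale0r !add0r scalerA mulVf ?pnatr_eq0 // scale1r. Qed.

Lemma base_coord p W : dot p p = 1 ->
  W = base p (dot W (dhopf p (hopf1 p))) (dot W (dhopf p (hopf2 p))) (2 * dot W (hopf p)).
Proof.
move=> pp; have -> : 2 * dot W (hopf p) = dot W (dhopf p p) by rewrite dhopf_diag dotZr.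
transitivity (dot p p ^+ 2 *: W); first by rewrite pp expr1n scale1r.
by rewrite !dot3E /base /dhopf /hopf1 /hopf2 dot4E ?vecE; row3; rewrite ?vecE; vring.
Qed.

Lemma dhopf_lift (eps : R) p (t : 'rV[R]_3) : dhopf p (lift eps p t) = base p (t 0 0) (t 0 1) 0.
Proof.
by rewrite /base /dhopf /lift /hopf1 /hopf2 /hopf3; row3; rewrite ?vecE; vring.
Qed.

Lemma dhopf_lift1 (eps : R) p (t : 'rV[R]_3) :
  dhopf (lift eps p t) (hopf1 p) + dhopf p (hopf1 (lift eps p t))
  = base p 0 (2 / eps * t 0 2) (- 2 * t 0 0).
Proof.
by rewrite /base /dhopf /lift /hopf1 /hopf2 /hopf3; row3; rewrite ?vecE; vring.
Qed.

Lemma dhopf_lift2 (eps : R) p (t : 'rV[R]_3) :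
  dhopf (lift eps p t) (hopf2 p) + dhopf p (hopf2 (lift eps p t))
  = base p (- (2 / eps * t 0 2)) 0 (- 2 * t 0 1).
Proof.
by rewrite /base /dhopf /lift /hopf1 /hopf2 /hopf3; row3; rewrite ?vecE; vring.
Qed.

End HopfBase.

(** * The round case, the Hopf case and their converses on a chart *)

Section SurfaceCases.
Variables (R : realType) (eps : R) (s : bool) (U : set 'rV[R]_2) (f : 'rV[R]_2 -> 'rV[R]_4).
Hypothesis eps0 : eps != 0.
Hypothesis openU : open U.
Hypothesis smoothf : Cinfv U f.
Hypothesis f_sphere : forall x, U x -> dot (f x) (f x) = 1.
Hypothesis f_dom : forall x, U x -> f x 0 3 != (-1) ^+ s.
Hypothesis f_immersion : forall x v, U x -> 'D_v f x = 0 -> v = 0.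

Let th := coframe eps f.
Let F := @stereo R s \o f.
Let H := @berger_coord_metric R eps s.
Let G := pullback_metric eps f.
Let e0 : 'rV[R]_2 := basis_vector R 0.
Let e1 : 'rV[R]_2 := basis_vector R 1.
Let l3 := 2 / eps - eps.
Let nu := unit_normal th.
Let h := mcurv eps eps l3 th.
Let gk := gauss_kronecker eps eps l3 th.
Local Notation "'N_ v w" := (nab eps eps l3 th v w) (at level 10, v at level 1, w at level 9).

Let cth := Cinfv_coframe eps openU smoothf.
Let indep := coframe_indep eps0 openU smoothf f_sphere f_immersion.
Let tors := surface_torsion eps0 openU smoothf f_sphere f_dom.
Let cnu : Cinfv U nu. Proof. exact: Cinfv_normal. Qed.
Let ch : Cinf U h. Proof. exact: Cinf_mcurv. Qed.
Let J0 x : U x -> area th x != 0. Proof. by move=> /(area_gt0 indep) /lt0r_neq0. Qed.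
Let nn x : U x -> dot (nu x) (nu x) = 1. Proof. exact: normal_unit. Qed.
Let df x : U x -> differentiable f x. Proof. exact: Cinfv_differentiable. Qed.

Let gE x : U x -> area th x * gk x = dot (nu x) (cross ('N_e0 nu x) ('N_e1 nu x)).
Proof. by move=> Ux; rewrite /gk /gauss_kronecker mulrA mulfV ?mul1r // J0. Qed.

Let thn v x : U x -> dot (th v x) (nu x) = 0.
Proof.
move=> Ux; have na : dot (nu x) (th e0 x) = 0 := normal_t1 indep Ux.
have nb : dot (nu x) (th e1 x) = 0 := normal_t2 indep Ux.
have : th v x = v 0 0 *: th e0 x + v 0 1 *: th e1 x := coframe_linear eps smoothf v Ux.
move: (th v x) (th e0 x) (th e1 x) (nu x) na nb => t a b n na nb ->.
by rewrite dotC !dot_lin na nb; ring.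
Qed.

Lemma derive_lift v x : U x -> 'D_v f x = lift eps (f x) (th v x).
Proof.
move=> Ux; rewrite {1}(hopf_basis (f_sphere Ux) (tangent_sphere openU smoothf f_sphere v Ux)).
by rewrite /lift /th /coframe /hcoord !vecE [eps * _]mulrC mulfK.
Qed.

Lemma sqr_const_derive (g : 'rV[R]_2 -> R) c : c != 0 -> Cinf U g ->
  (forall x, U x -> g x ^+ 2 = c) -> forall v x, U x -> 'D_v g x = 0.
Proof.
move=> c0 cg gc v x Ux; have dg := Cinf_differentiable cg Ux.
have := eq_on_derive openU v gc Ux; rewrite (derive_cst c).
rewrite (derive_mul v dg dg) mulrC -mulr2n => /eqP; rewrite mulrn_eq0 /= mulf_eq0.
have -> : (g x == 0) = false by apply: contraNF c0 => /eqP g0; rewrite -(gc _ Ux) g0 expr0n.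
by move/eqP.
Qed.

Lemma derive_lift_field v x (w : 'rV[R]_2 -> 'rV[R]_3) : eps ^+ 2 = 1 -> U x ->
  differentiable w x ->
  has_derive x v (fun z => lift eps (f z) (w z))
    (lift eps (f x) ('N_v w x) - dot (w x) (th v x) *: f x).
Proof.
move=> e1' Ux /(has_deriveP v) Dw.
have D1 := derive_hopf1 v (df Ux); have D2 := derive_hopf2 v (df Ux).
have D3 := derive_hopf3 v (df Ux).
have C := lift_connection (f x) (w x) (th v x) e1'.
have : has_derive x v (fun z => lift eps (f z) (w z)) (lift eps (f x) ('D_v w x)
    + (w x 0 0 *: hopf1 ('D_v f x) + w x 0 1 *: hopf2 ('D_v f x)
       + (w x 0 2 / eps) *: hopf3 ('D_v f x))).
  rewrite /lift; eapply has_derive_eq; first by has_derive_tac.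
  move: (hopf1 ('D_v f x)) (hopf2 ('D_v f x)) (hopf3 ('D_v f x)) => a1 a2 a3.
  move: (hopf1 (f x)) (hopf2 (f x)) (hopf3 (f x)) ('D_v w x) (w x) => b1 b2 b3 D W.
  by row4; vring.
by rewrite (derive_lift v Ux) C addrA -liftD => H2; exact: H2.
Qed.

Section Constant.
Variable hh : R.
Hypothesis hh0 : hh != 0.
Hypothesis h_sqr : forall x, U x -> h x ^+ 2 = hh.

Lemma mcurv_derive v x : U x -> 'D_v h x = 0.
Proof. exact: (sqr_const_derive hh0 ch h_sqr). Qed.

Let h0 x : U x -> h x != 0.
Proof. by move=> Ux; apply: contraNneq hh0 => hx; rewrite -(h_sqr Ux) hx expr0n. Qed.

Let Q := diag3 (- eps ^+ 2) (- eps ^+ 2) (ricci3 eps).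

Lemma biharmonic_equation x : U x -> bitension G H F x = 0 <->
  2 *: Q (nu x) = (h x ^+ 2 - 2 * gk x + dot (nu x) (Q (nu x)) + (eps ^+ 2 - 4)) *: nu x.
Proof.
move=> Ux; rewrite (bitension_surface eps0 openU smoothf f_sphere f_dom f_immersion mcurv_derive Ux).
rewrite -/th -/l3 -/nu -/h -/gk -/Q; split.
  rewrite -(mul0mx _ (frameE eps s (F x))) => /(frame_inj (frame_EC eps0 s)) /eqP.
  by rewrite scaler_eq0 (negbTE (h0 Ux)) /= subr_eq0 => /eqP.
by move=> ->; rewrite subrr scaler0 mul0mx.
Qed.

Section RoundCase.
Hypothesis eps1 : eps ^+ 2 = 1.
Hypothesis bih : forall x, U x -> bitension G H F x = 0.

Let QN u : Q u = - u.
Proof. by rewrite /Q /ricci3 eps1; row3; vring. Qed.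

Lemma round_umbilic x : U x -> [/\ hh = 4, 'N_e0 nu x = - (h x / 2) *: th e0 x &
  'N_e1 nu x = - (h x / 2) *: th e1 x].
Proof.
(* Here [Q] is minus the identity, and pairing the biharmonic equation with nu reads
   [- 2 = h^2 - 2 d - 1 - 3]. *)
have hg z : U z -> h z ^+ 2 - 2 * gk z = 2.
  move=> Uz; have := bih Uz; have := nn Uz.
  move=> nz /(biharmonic_equation Uz); rewrite !QN eps1.
  move: (nu z) (h z) (gk z) nz => n a b nz /(congr1 (dot n)).
  rewrite !dot_lin nz => /eqP; rewrite -subr_eq0 => /eqP E.
  by apply/eqP; rewrite -subr_eq0 -[_ - _]opprK oppr_eq0; apply/eqP; apply: etrans E; ring.
have curv w z : U z -> Cinfv U w ->
    'N_e0 ('N_e1 w) z - 'N_e1 ('N_e0 w) z = cross (- cross (th e0 z) (th e1 z)) (w z).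
  move=> Uz cw; rewrite -QN.
  exact: (surface_nab_curv eps0 openU smoothf f_sphere f_dom Uz cw).
exact: (umbilic openU cth tors curv indep hh0 h_sqr mcurv_derive hg).
Qed.

Definition pole x := 2 *: f x + h x *: lift eps (f x) (nu x).

(** By umbilicity the derivative is [2 - h^2 / 2] times that of f, and [h^2 = 4]; the term along f
    drops out because n is normal to the surface. *)
Lemma pole_cst v x : U x -> has_derive x v pole 0.
Proof.
move=> Ux; have [hh4 E0 E1] := round_umbilic Ux; have dnu := Cinfv_differentiable cnu Ux.
have Dh : has_derive x v h 0.
  by split; [exact: Cinf_differentiable ch Ux | exact: mcurv_derive].
have Df := has_deriveP v (df Ux); have Dl := derive_lift_field v eps1 Ux dnu.
rewrite /pole; eapply has_derive_eq; first by has_derive_tac.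
rewrite !scale0r !add0r [dot (nu x) _]dotC thn // scale0r subr0 derive_lift // -!liftZ -liftD.
have -> : 'N_v nu x = - (h x / 2) *: th v x.
  rewrite (nab_linear eps eps l3 (coframe_linear eps smoothf) v dnu Ux).
  rewrite /th (coframe_linear eps smoothf v Ux) -/th -/e0 -/e1 E0 E1.
  by move: (th e0 x) (th e1 x) (h x) => a b k; row3; vring.
have -> : 2 *: th v x + h x *: (- (h x / 2) *: th v x) = (2 - h x ^+ 2 / 2) *: th v x.
  by move: (th v x) (h x) => a k; row3; vring.
by rewrite h_sqr // hh4 (_ : 2 - 4 / 2 = 0 :> R) ?scale0r ?lift0 //; field.
Qed.

Lemma pole_plane x : U x -> dot (pole x) (f x) = 2 /\ dot (pole x) (pole x) = 8.
Proof.
move=> Ux; have [hh4 _ _] := round_umbilic Ux.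
have lf := lift_orth eps (f x) (nu x); have ll := dot_lift (nu x) (nu x) (f_sphere Ux) eps1.
rewrite nn // in ll; have ff := f_sphere Ux; have hx := h_sqr Ux; rewrite hh4 in hx.
rewrite /pole; move: (h x) (f x) (lift eps (f x) (nu x)) lf ll ff hx => k p l lp ll pp kk.
rewrite !dot_lin [dot p l]dotC lp ll pp; split; first by ring.
by move: kk; rewrite expr2 => kk; rewrite !mulr0 !addr0 !add0r !mulr1 kk; ring.
Qed.

(** Differentiating [dot W (f z) = 2] shows that the part of W tangent to the sphere is normal to
    the surface. Its squared length is [8 - 4 = h^2], so it is plus or minus h n. *)
Lemma pole_unique W x : (forall z, U z -> dot W (f z) = 2) -> dot W W = 8 -> U x ->
  W = pole x \/ W + pole x = 4 *: f x.
Proof.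
move=> Wf WW Ux; have [hh4 _ _] := round_umbilic Ux.
have WE := lift_hcoord W eps1 (f_sphere Ux); rewrite Wf // in WE.
set m := hcoord eps (f x) W in WE.
have mt v : dot m (th v x) = 0.
  have dc : differentiable (fun _ : 'rV[R]_2 => W) x by exact: differentiable_cst.
  have := derive_dot v dc (df Ux).
  rewrite (eq_on_derive openU v Wf Ux) (derive_cst (_ : R)) (derive_cst W) dot0l add0r.
  rewrite derive_lift // {1}WE; have := lift_orth eps (f x) (th v x).
  have := dot_lift m (th v x) (f_sphere Ux) eps1.
  move: (f x) (lift eps (f x) m) (lift eps (f x) (th v x)) => p k l kl lp.
  by rewrite dotDl dotZl kl dotC lp mulr0 add0r.
have mn := normal_line (J0 Ux) (area_normal indep Ux) (nn Ux) (mt e0) (mt e1).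
rewrite -/nu in mn.
have : dot m (nu x) ^+ 2 = h x ^+ 2.
  have lp := lift_orth eps (f x) m; have ll := dot_lift m m (f_sphere Ux) eps1.
  have mm : dot m m = dot m (nu x) ^+ 2.
    move: (nn Ux) mn; move: (nu x) (dot m (nu x)) => n a nn' ->.
    by rewrite !dot_lin nn' mulr1 expr2.
  rewrite -mm -ll h_sqr // hh4; have ff := f_sphere Ux; move: WW; rewrite WE.
  move: (f x) (lift eps (f x) m) lp ff => p l lp ff.
  by rewrite !dot_lin [dot p l]dotC lp ff => E; apply: (addrI (2 * 2)); apply: etrans (etrans E _); ring.
rewrite WE /pole; move: mn; move: (dot m (nu x)) => a ->.
move/eqP; rewrite eqf_sqr => /orP[] /eqP ->; [left|right]; rewrite liftZ //.
by move: (h x) (f x) (lift eps (f x) (nu x)) => b p l; row4; vring.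
Qed.

Lemma pole_ball c r : 0 < r -> U = ball c r -> exists V,
  [/\ dot V V = 8, forall z, U z -> dot V (f z) = 2 &
   forall W, dot W W = 8 -> (forall z, U z -> dot W (f z) = 2) -> W = V].
Proof.
move=> r0 UE; have Uc : U c by rewrite UE; exact: ballxx.
have cst z : U z -> pole z = pole c.
  rewrite UE => Bz; apply: (derive0_ball_cstV _ Bz) => y; rewrite -UE => Uy.
  by split=> [|v]; [exact: (pole_cst e0 Uy).1 | exact: (pole_cst v Uy).2].
exists (pole c); split; first by have [_ ->] := pole_plane Uc.
  by move=> z Uz; rewrite -(cst z Uz); have [-> _] := pole_plane Uz.
move=> W WW Wf; apply: contrapT => Wc.
have fE z : U z -> f z = 4^-1 *: (W + pole c).
  move=> Uz; have [E|E] := pole_unique Wf WW Uz; first by case: Wc; rewrite E cst.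
  by rewrite -(cst z Uz) E scalerA mulVf ?pnatr_eq0 // scale1r.
have := eq_on_deriveV openU e0 fE Uc; rewrite (derive_cst (_ : 'rV[R]_4)) => /(f_immersion Uc).
have [b00 _ _ _] := basis2E R.
by move=> /(congr1 (fun u : 'rV[R]_2 => u 0 0)); rewrite b00 mxE => /eqP; rewrite oner_eq0.
Qed.

End RoundCase.

End Constant.

Let dnu x : U x -> differentiable nu x. Proof. exact: Cinfv_differentiable. Qed.

Lemma derive_hopf_surface v x : U x ->
  has_derive x v (fun z => hopf (f z)) (base (f x) (th v x 0 0) (th v x 0 1) 0).
Proof.
move=> Ux; have Df := has_deriveP v (df Ux); have [d D] := has_derive_dhopf Df Df.
have dc : differentiable (fun _ : 'rV[R]_2 => 2^-1 : R) x by exact: differentiable_cst.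
have -> : (fun z => hopf (f z)) = fun z => 2^-1 *: dhopf (f z) (f z).
  by apply/funext => z; rewrite dhopf_diag scalerA mulVf ?scale1r ?pnatr_eq0.
split; first exact: differentiable_scale.
rewrite (deriveV_scale v dc d) (derive_cst (_ : R)) scale0r add0r D [dhopf ('D_v f x) _]dhopfC.
rewrite derive_lift // dhopf_lift; move: (base _ _ _ _) => b.
by row3; gen_entries; field.
Qed.

Lemma derive_base1 v x : U x -> has_derive x v (fun z => dhopf (f z) (hopf1 (f z)))
  (base (f x) 0 (2 / eps * th v x 0 2) (- 2 * th v x 0 0)).
Proof.
move=> Ux; have Df := has_deriveP v (df Ux).
have [d D] := has_derive_dhopf Df (derive_hopf1 v (df Ux)); split=> //.
by rewrite D derive_lift // dhopf_lift1.
Qed.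

Lemma derive_base2 v x : U x -> has_derive x v (fun z => dhopf (f z) (hopf2 (f z)))
  (base (f x) (- (2 / eps * th v x 0 2)) 0 (- 2 * th v x 0 1)).
Proof.
move=> Ux; have Df := has_deriveP v (df Ux).
have [d D] := has_derive_dhopf Df (derive_hopf2 v (df Ux)); split=> //.
by rewrite D derive_lift // dhopf_lift2.
Qed.

Section BasePlane.
Variables (W : 'rV[R]_3) (k w : R).
Hypothesis Wf : forall x, U x -> dot W (hopf (f x)) = k.
Hypothesis WW : dot W W = w.

Let c1 x := dot W (dhopf (f x) (hopf1 (f x))).
Let c2 x := dot W (dhopf (f x) (hopf2 (f x))).

Let WE x : U x -> W = base (f x) (c1 x) (c2 x) (2 * k).
Proof. by move=> Ux; rewrite {1}(base_coord W (f_sphere Ux)) Wf. Qed.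

(** Differentiating the equation of the plane makes [(c1, c2, 0)] orthogonal to all tangent vectors,
    hence [mu *: nu x]. Its zero third entry forces nu to be horizontal unless [mu = 0]. *)
Lemma base_plane_normal x : U x -> exists mu,
  [/\ c1 x = mu * nu x 0 0, c2 x = mu * nu x 0 1, mu * nu x 0 2 = 0,
      mu ^+ 2 + 4 * k ^+ 2 = w &
      W = base (f x) (mu * nu x 0 0) (mu * nu x 0 1) (2 * k)].
Proof.
move=> Ux; set m : 'rV[R]_3 := vec3 (c1 x) (c2 x) 0.
have mt v : dot m (th v x) = 0.
  have [d D] := derive_hopf_surface v Ux.
  have dc : differentiable (fun _ : 'rV[R]_2 => W) x by exact: differentiable_cst.
  have := derive_dot v dc d.
  rewrite (eq_on_derive openU v Wf Ux) (derive_cst (_ : R)) (derive_cst W) dot0l add0r D.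
  rewrite {1}(WE Ux) (dot_base _ _ _ _ _ _ (f_sphere Ux)) mulr0 addr0 => E.
  rewrite /m; move: (c1 x) (c2 x) (th v x) E => a b t E.
  by rewrite dot3E !vecE mul0r addr0 -E.
have := normal_line (J0 Ux) (area_normal indep Ux) (nn Ux) (mt e0) (mt e1).
rewrite -/nu; move: (dot m (nu x)) => mu mE; exists mu.
have E1 : c1 x = mu * nu x 0 0 by rewrite -scalevE -mE /m vecE.
have E2 : c2 x = mu * nu x 0 1 by rewrite -scalevE -mE /m vecE.
have E3 : mu * nu x 0 2 = 0 by rewrite -scalevE -mE /m vecE.
have E4 : W = base (f x) (mu * nu x 0 0) (mu * nu x 0 1) (2 * k) by rewrite -E1 -E2 -WE.
split=> //; rewrite -WW E4 (dot_base _ _ _ _ _ _ (f_sphere Ux)).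
have := nn Ux; rewrite dot3E => n1.
transitivity (mu ^+ 2 * (nu x 0 0 * nu x 0 0 + nu x 0 1 * nu x 0 1 + nu x 0 2 * nu x 0 2)
  + 4 * k ^+ 2); first by rewrite n1 mulr1.
transitivity (mu * nu x 0 0 * (mu * nu x 0 0) + mu * nu x 0 1 * (mu * nu x 0 1)
   + (mu * nu x 0 2) * (mu * nu x 0 2) + 2 * k * (2 * k)); first by vring.
by rewrite E3 mulr0 addr0.
Qed.

Lemma derive_base_plane v x : U x ->
  has_derive x v (fun z => vec3 (c1 z) (c2 z) 0 : 'rV[R]_3)
   (vec3 (2 / eps * th v x 0 2 * c2 x - 4 * k * th v x 0 0)
       (- (2 / eps * th v x 0 2) * c1 x - 4 * k * th v x 0 1) 0).
Proof.
move=> Ux; have dW : has_derive x v (fun _ : 'rV[R]_2 => W) 0.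
  by split; [exact: differentiable_cst | exact: derive_cst].
have dd g g' : has_derive x v g g' -> has_derive x v (fun z => dot W (g z) : R) (dot W g').
  move=> dg; rewrite (funext (fun z => dot3E W (g z))) dot3E.
  eapply has_derive_eq; first by has_derive_tac.
  by rewrite ?mxE; ring.
have D1 := dd _ _ (derive_base1 v Ux); have D2 := dd _ _ (derive_base2 v Ux).
have := has_derive_vec3 D1 D2 (has_derive_cst x v 0); rewrite -/c1 -/c2.
congr (has_derive _ _ _ _); have := WE Ux; move: (c1 x) (c2 x) => a b ->.
rewrite !(dot_base _ _ _ _ _ _ (f_sphere Ux)).
by move: (th v x) => t; row3; vring.
Qed.

End BasePlane.

Let un x : 'rV[R]_3 := vec3 (nu x 0 1) (- nu x 0 0) 0.

Section HorizontalNormal.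
Hypothesis hor : forall x, U x -> nu x 0 2 = 0.

Let hor_derive v x : U x -> 'D_v nu x = dot ('D_v nu x) (un x) *: un x.
Proof.
move=> Ux; have d := dnu Ux.
have Dn : dot ('D_v nu x) (nu x) = 0.
  have := derive_dot v d d; rewrite (eq_on_derive openU v nn Ux) (derive_cst (1 : R)).
  rewrite [dot (nu x) _]dotC => /esym /eqP; rewrite -mulr2n mulrn_eq0 /=; exact/eqP.
have D2 : ('D_v nu x) 0 2 = 0.
  by rewrite (derive_coord v 2 d) (eq_on_derive openU v hor Ux) (derive_cst (0 : R)).
by have := horizontal_split (nn Ux) (hor Ux) Dn; rewrite D2 scale0r addr0.
Qed.

(** A unit vector that stays horizontal turns along [un], so the covariant derivatives of nu have
    the form required by [horizontal_shape]. *)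
Lemma horizontal_normal x : U x -> gk x = - eps ^+ 2 /\ forall v,
  'D_v nu x = (2 / eps * th v x 0 2 - h x * dot (th v x) (un x)) *: un x.
Proof.
move=> Ux.
have N v : 'N_v nu x = dot ('D_v nu x) (un x) *: un x + cross (diag3 eps eps l3 (th v x)) (nu x).
  by rewrite /nab {1}(hor_derive v Ux).
have [d [a0 a1]] := horizontal_shape (J0 Ux) (area_normal indep Ux) (nn Ux)
  (N_symmetric openU cth tors indep Ux) (areaE eps eps l3 indep Ux) (gE Ux) (hor Ux) eps0
  (N e0) (N e1) (thn e0 Ux) (thn e1 Ux).
split=> // v; apply: etrans (hor_derive v Ux) _; congr (_ *: _).
have T : th v x = v 0 0 *: th e0 x + v 0 1 *: th e1 x := coframe_linear eps smoothf v Ux.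
rewrite (derive_basis v (dnu Ux)) -/e0 -/e1 T.
move: a0 a1; rewrite -/(un x) -/th -/h.
move: (th e0 x) (th e1 x) (h x) (un x) ('D_e0 nu x) ('D_e1 nu x) => a b k u D0 D1 a0 a1.
by rewrite !dot_lin a0 a1 addvE !scalevE; ring.
Qed.

(** Otherwise all tangent vectors would be vertical, hence linearly dependent. *)
Lemma horizontal_transverse x : U x -> exists v, dot (th v x) (un x) != 0.
Proof.
move=> Ux.
apply: contrapT => nv.
have Z v : dot (th v x) (un x) = 0 by apply/eqP/negPn/negP => nz; apply: nv; exists v.
have z0 := Z e0; have z1 := Z e1.
have T0 : th e0 x = dot (th e0 x) (un x) *: un x + th e0 x 0 2 *: vec3 0 0 1 :=
  horizontal_split (nn Ux) (hor Ux) (thn e0 Ux).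
have T1 : th e1 x = dot (th e1 x) (un x) *: un x + th e1 x 0 2 *: vec3 0 0 1 :=
  horizontal_split (nn Ux) (hor Ux) (thn e1 Ux).
have : cross (th e0 x) (th e1 x) != 0 := indep Ux.
move: z0 z1 T0 T1; move: (th e0 x) (th e1 x) (un x) => a b u z0 z1 Ta Tb.
by rewrite Ta Tb z0 z1 !scale0r !add0r crossZl crossZr crossvv !scaler0 eqxx.
Qed.

(** The factor [mu] is only given pointwise, so the relation to differentiate is that [(c1, c2, 0)]
    and nu have zero cross product. Along a direction with a horizontal component it gives
    [mu h = 4 k], and [mu^2 = w - 4 k^2]. *)
Lemma horizontal_mcurv W k w x : (forall z, U z -> dot W (hopf (f z)) = k) -> dot W W = w ->
  U x -> (w - 4 * k ^+ 2) * h x ^+ 2 = 16 * k ^+ 2.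
Proof.
move=> Wf WW Ux.
have [mu [m1 m2 m3 mw _]] := base_plane_normal Wf WW Ux.
have [v tv] := horizontal_transverse Ux.
have [dm Dm] := derive_base_plane Wf v Ux.
have cr z : U z -> cross (vec3 (dot W (dhopf (f z) (hopf1 (f z))))
    (dot W (dhopf (f z) (hopf2 (f z)))) 0) (nu z) = 0.
  move=> Uz; have [b [E1 E2 _ _ _]] := base_plane_normal Wf WW Uz.
  rewrite E1 E2; move: (nu z) (hor Uz) => n n2.
  by rewrite /cross; row3; rewrite ?n2; vring.
have [_ Dn] := horizontal_normal Ux.
have := (derive_cross v dm (dnu Ux)).2; rewrite (eq_on_deriveV openU v cr Ux) (derive_cst (0 : 'rV[R]_3)).
rewrite Dm Dn m1 m2 => /rowP /(_ 2).
have tE : dot (th v x) (un x) = th v x 0 0 * nu x 0 1 - th v x 0 1 * nu x 0 0.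
  by rewrite dot3E /un; move: (th v x) (nu x) => t n; rewrite !vecE; vring.
have := nn Ux; have n2 := hor Ux; rewrite dot3E.
move: tv tE; move: (dot (th v x) (un x)) => q.
rewrite /cross /un; move: (h x) (nu x) (th v x) n2 => hx n t n2 q0 qE n1.
rewrite n2 mulr0 addr0 in n1.
have E : n 0 0 * n 0 0 = 1 - n 0 1 * n 0 1 by rewrite -n1; ring.
rewrite addvE !vecE => X.
have {X} : 0 = (n 0 0 * n 0 0 + n 0 1 * n 0 1) * mu * hx * q
    - 4 * k * (t 0 0 * n 0 1 - t 0 1 * n 0 0) by rewrite [LHS]X; ring.
rewrite n1 -qE mul1r -mulrBl => /esym /eqP.
rewrite mulf_eq0 (negbTE q0) orbF subr_eq0 => /eqP mh.
have -> : w - 4 * k ^+ 2 = mu ^+ 2 by rewrite -mw addrK.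
by rewrite -exprMn mh; ring.
Qed.

End HorizontalNormal.

Section HopfCase.
Variable hh : R.
Hypothesis hh0 : hh != 0.
Hypothesis h_sqr : forall x, U x -> h x ^+ 2 = hh.
Hypothesis eps1 : eps ^+ 2 != 1.
Hypothesis bih : forall x, U x -> bitension G H F x = 0.

Let Q := diag3 (- eps ^+ 2) (- eps ^+ 2) (ricci3 eps).

Let eqn x : U x ->
  2 *: Q (nu x) = (h x ^+ 2 - 2 * gk x + dot (nu x) (Q (nu x)) + (eps ^+ 2 - 4)) *: nu x.
Proof. by move=> Ux; exact: (biharmonic_equation hh0 h_sqr Ux).1 (bih Ux). Qed.

Lemma biharmonic_horizontal x : U x -> nu x 0 2 = 0.
Proof.
move=> Ux; apply/eqP/negPn/negP => n2.
(* Where the third entry of nu is non-zero, the multiplier equals [2 * ricci3 eps]. The first two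
   entries are then killed by its difference from [- 2 eps^2], which is [8 (1 - eps^2)] up to
   sign. *)
have vert z : U z -> nu z 0 2 != 0 -> nu z 0 0 = 0 /\ nu z 0 1 = 0.
  move=> Uz; have := eqn Uz; move: (_ + (eps ^+ 2 - 4)) => K; move: (nu z) => n /rowP E m2.
  have := E 2; rewrite !scalevE vecE => E2.
  have KE : K = 2 * ricci3 eps by apply: (mulIf m2); rewrite -E2 mulrA.
  have k8 : 8 * (1 - eps ^+ 2) != 0 by rewrite mulf_neq0 ?pnatr_eq0 // subr_eq0 eq_sym.
  split; apply: (mulfI k8); rewrite mulr0.
    have := E 0; rewrite !scalevE vecE KE /ricci3 => E0.
    by move: E0 => /eqP; rewrite -subr_eq0 => /eqP E0; apply: etrans E0; ring.
  have := E 1; rewrite !scalevE vecE KE /ricci3 => E0.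
  by move: E0 => /eqP; rewrite -subr_eq0 => /eqP E0; apply: etrans E0; ring.
have th2 v z : U z -> nu z 0 2 != 0 -> th v z 0 2 = 0.
  move=> Uz m2; have [m0 m1] := vert z Uz m2; have := thn v Uz; rewrite dot3E m0 m1 !mulr0 !add0r.
  by move=> /eqP; rewrite mulf_eq0 (negbTE m2) orbF => /eqP.
(* The condition is open, so the vanishing of the third coframe component holds on a neighbourhood
   and can be differentiated. *)
have near2 : \forall z \near x, nu z 0 2 != 0.
  have c2 : {for x, continuous (fun z => nu z 0 2)}.
    exact/differentiable_continuous/differentiable_entry/dnu.
  exact: (cvgr_neq0 _ c2 n2).
have Dth v w : ('D_v (th w) x) 0 2 = 0.
  rewrite (derive_coord v 2 (Cinfv_differentiable (cth w) Ux)).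
  have E : \forall z \near x, th w z 0 2 = (fun=> 0 : R) z.
    near=> z; apply: th2; near: z; first exact: open_nbhs_nbhs.
    exact: near2.
  by rewrite (near_eq_derive v E) (derive_cst (0 : R)).
(* With horizontal tangent vectors the third entry of the structure equation reduces to [2 eps]
   times that of [cross a b]. *)
have alg (A B a b : 'rV[R]_3) : A 0 2 = 0 -> B 0 2 = 0 -> a 0 2 = 0 -> b 0 2 = 0 ->
    A - B + (cross (diag3 eps eps l3 a) b - cross (diag3 eps eps l3 b) a) = 0 -> cross a b = 0.
  move=> A2 B2 a2 b2 /rowP /(_ 2).
  rewrite !addvE !oppvE A2 B2 subrr add0r /diag3 /cross !vecE => E.
  have : 2 * eps * (a 0 0 * b 0 1 - a 0 1 * b 0 0) = 0 by rewrite -E; ring.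
  move=> /eqP; rewrite !mulf_eq0 pnatr_eq0 (negbTE eps0) /= => /eqP ab2.
  by rewrite a2 b2 ab2; row3; vring.
have SE : 'D_e0 (th e1) x - 'D_e1 (th e0) x + (cross (diag3 eps eps l3 (th e0 x)) (th e1 x)
    - cross (diag3 eps eps l3 (th e1 x)) (th e0 x)) = 0.
  exact: surface_structure eps0 openU smoothf f_sphere f_dom _ Ux.
have I : cross (th e0 x) (th e1 x) != 0 := indep Ux.
have := alg _ _ _ _ (Dth e0 e1) (Dth e1 e0) (th2 e0 x Ux n2) (th2 e1 x Ux n2) SE.
exact/eqP.
Unshelve. all: by end_near.
Qed.

Let hor := biharmonic_horizontal.

Lemma biharmonic_mcurv x : U x -> hh = 4 - 4 * eps ^+ 2.
Proof.
move=> Ux; have [gkE _] := horizontal_normal hor Ux; rewrite -(h_sqr Ux).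
have := eqn Ux; rewrite gkE; have := hor Ux; have := nn Ux; move: (nu x) (h x) => n k n1 n2.
have nQ : dot n (Q n) = - eps ^+ 2.
  rewrite -[RHS]mulr1 -n1 !dot3E !vecE n2; vring.
move=> /(congr1 (dot n)); rewrite !dot_lin nQ n1 => E.
by apply/eqP; rewrite -subr_eq0; apply/eqP; move/eqP: E; rewrite eq_sym -subr_eq0 => /eqP E;
  apply: etrans E; ring.
Qed.

Definition base_pole x := (h x * nu x 0 0) *: dhopf (f x) (hopf1 (f x))
  + (h x * nu x 0 1) *: dhopf (f x) (hopf2 (f x)) + hh *: hopf (f x).

Lemma base_poleE x : base_pole x = base (f x) (h x * nu x 0 0) (h x * nu x 0 1) (hh / 2).
Proof. by rewrite /base_pole /base dhopf_diag scalerA divfK ?pnatr_eq0. Qed.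

(** The part [2 / eps * th_3] of the rotation of nu cancels the rotation of the two frame vectors,
    the remaining term in [- h^2] cancels the derivative of [hh *: hopf], and the component along
    [hopf] vanishes because nu is normal. *)
Lemma base_pole_cst v x : U x -> has_derive x v base_pole 0.
Proof.
move=> Ux; have D1 := derive_base1 v Ux; have D2 := derive_base2 v Ux.
have D3 := derive_hopf_surface v Ux; have Dn := has_deriveP v (dnu Ux).
have Dh : has_derive x v h 0.
  by split; [exact: Cinf_differentiable ch Ux | exact: mcurv_derive hh0 h_sqr v x Ux].
rewrite /base_pole; eapply has_derive_eq; first by has_derive_tac.
have [_ ->] := horizontal_normal hor Ux; rewrite -(h_sqr Ux).
have := horizontal_split (nn Ux) (hor Ux) (thn v Ux); rewrite -/(un x).
have := hor Ux; have := nn Ux; rewrite /un /base.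
move: (dhopf (f x) (hopf1 (f x))) (dhopf (f x) (hopf2 (f x))) (dhopf (f x) (f x)) => b1 b2 b3.
move: (h x) (nu x) (th v x) => k n t n1 n2 /rowP tE.
have t0 := tE 0; have t1 := tE 1; rewrite !addvE !scalevE !vecE mulr0 addr0 in t0 t1.
move: t0 t1; move: (dot t _) => q t0 t1; rewrite !scalevE !vecE t0 t1.
by row3; vring.
Qed.

Lemma base_pole_plane x : U x -> dot (base_pole x) (hopf (f x)) = hh / 4 /\
  dot (base_pole x) (base_pole x) = hh + hh ^+ 2 / 4.
Proof.
move=> Ux; rewrite base_poleE hopf_base !(dot_base _ _ _ _ _ _ (f_sphere Ux)); split; first by field.
have := nn Ux; rewrite dot3E (hor Ux) mulr0 addr0 => n1; rewrite -(h_sqr Ux).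
transitivity (h x ^+ 2 * (nu x 0 0 * nu x 0 0 + nu x 0 1 * nu x 0 1) + (h x ^+ 2) ^+ 2 / 4).
  by field.
by rewrite n1 mulr1.
Qed.

(** The prescribed norm and height satisfy [w - 4 k^2 = hh], so [base_plane_normal] leaves only
    [mu = h] and [mu = - h]. *)
Lemma base_pole_unique W x : (forall z, U z -> dot W (hopf (f z)) = hh / 4) ->
  dot W W = hh + hh ^+ 2 / 4 -> U x ->
  W = base_pole x \/ W + base_pole x = (2 * hh) *: hopf (f x).
Proof.
move=> Wf WW Ux; have [mu [_ _ _ mw WE]] := base_plane_normal Wf WW Ux.
have : mu ^+ 2 = h x ^+ 2.
  by rewrite h_sqr // -(addrK (4 * (hh / 4) ^+ 2) (mu ^+ 2)) mw; field.
have h2 : 2 * (hh / 4) = hh / 2 by field.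
move/eqP; rewrite eqf_sqr => /orP[] /eqP E; [left|right]; rewrite base_poleE WE E h2 //.
rewrite /base dhopf_diag.
move: (dhopf (f x) (hopf1 (f x))) (dhopf (f x) (hopf2 (f x))) (hopf (f x)) (h x) (nu x) => b1 b2 b3 k n.
by row3; gen_entries; field.
Qed.

Lemma base_pole_ball c r : 0 < r -> U = ball c r -> exists V,
  [/\ dot V V = hh + hh ^+ 2 / 4, forall z, U z -> dot V (hopf (f z)) = hh / 4 &
   forall W, dot W W = hh + hh ^+ 2 / 4 -> (forall z, U z -> dot W (hopf (f z)) = hh / 4) -> W = V].
Proof.
move=> r0 UE; have Uc : U c by rewrite UE; exact: ballxx.
have cst z : U z -> base_pole z = base_pole c.
  rewrite UE => Bz; apply: (derive0_ball_cstV _ Bz) => y; rewrite -UE => Uy.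
  by split=> [|v]; [exact: (base_pole_cst e0 Uy).1 | exact: (base_pole_cst v Uy).2].
exists (base_pole c); split; first by have [_ ->] := base_pole_plane Uc.
  by move=> z Uz; rewrite -(cst z Uz); have [-> _] := base_pole_plane Uz.
move=> W WW Wf; apply: contrapT => Wc.
have h2 : 2 * hh != 0 by rewrite mulf_neq0 ?pnatr_eq0.
have fE z : U z -> hopf (f z) = (2 * hh)^-1 *: (W + base_pole c).
  move=> Uz; have [E|E] := base_pole_unique Wf WW Uz; first by case: Wc; rewrite E cst.
  by rewrite -(cst z Uz) E scalerA mulVf // scale1r.
(* f may still move along the fibre; the contradiction needs a direction in which [hopf] of f
   moves. *)
have [v /negP[]] := horizontal_transverse hor Uc.
have [_] := derive_hopf_surface v Uc.
rewrite (eq_on_deriveV openU v fE Uc) (derive_cst (_ : 'rV[R]_3)) => /esym B.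
have := dot_base (th v c 0 0) (th v c 0 1) 0 (nu c 0 1) (- nu c 0 0) 0 (f_sphere Uc).
by rewrite B dot0l dot3E /un; move: (th v c) (nu c) => t n; rewrite !vecE !mulr0 => <-.
Qed.

End HopfCase.

Lemma tension_surface_eq0 x : U x -> tension G H F x = 0 <-> h x = 0.
Proof.
move=> Ux; rewrite (tension_surface eps0 openU smoothf f_sphere f_dom f_immersion Ux).
have -> : tension_vec eps eps (2 / eps - eps) (coframe eps f) x = h x *: nu x.
  exact: (tension_vecE eps eps l3 openU cth indep Ux).
split; last by move=> ->; rewrite scale0r mul0mx.
rewrite -(mul0mx _ (frameE eps s (F x))) => /(frame_inj (frame_EC eps0 s)) /eqP.
rewrite scaler_eq0 => /orP[/eqP // | /eqP n0].
by have := nn Ux; rewrite n0 dot0l => /esym /eqP; rewrite oner_eq0.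
Qed.

(** The tangential part of W is [b *: nu] with [b^2 = 1 - k^2 = 1/2]. Since W is constant,
    [k th_v + b nabla_v nu = 0]: the surface is umbilic with curvature [k / b], of square 1, so
    [h^2 = 4] and [d = 1]. *)
Lemma proper_round (W : 'rV[R]_4) k x : eps ^+ 2 = 1 -> (forall z, U z -> dot W (f z) = k) ->
  dot W W = 1 -> k ^+ 2 = 2^-1 -> U x -> bitension G H F x = 0 /\ tension G H F x <> 0.
Proof.
move=> eps1 Wf WW k2 Ux; pose m z := hcoord eps (f z) W.
have WE z : U z -> W = k *: f z + lift eps (f z) (m z).
  by move=> Uz; rewrite {1}(lift_hcoord W eps1 (f_sphere Uz)) Wf.
have mt v z : U z -> dot (m z) (th v z) = 0.
  move=> Uz; have dc : differentiable (fun _ : 'rV[R]_2 => W) z by exact: differentiable_cst.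
  have := derive_dot v dc (df Uz).
  rewrite (eq_on_derive openU v Wf Uz) (derive_cst (_ : R)) (derive_cst W) dot0l add0r.
  rewrite derive_lift // {1}(WE z Uz); have := lift_orth eps (f z) (th v z).
  have := dot_lift (m z) (th v z) (f_sphere Uz) eps1.
  move: (f z) (lift eps (f z) (m z)) (lift eps (f z) (th v z)) => p a l kl lp.
  by rewrite dotDl dotZl kl dotC lp mulr0 add0r.
pose b z := dot (m z) (nu z).
have mn z : U z -> m z = b z *: nu z.
  by move=> Uz; have := normal_line (J0 Uz) (area_normal indep Uz) (nn Uz) (mt e0 z Uz) (mt e1 z Uz).
have cm : Cinfv U m.
  have [c1 c2 c3] := Cinfv_hopf openU smoothf; have cW : Cinfv U (fun _ : 'rV[R]_2 => W) by exact: Cinfv_cst.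
  rewrite /m /hcoord; apply: Cinfv_vec3 => //; try exact: Cinf_dot.
  by apply: Cinf_mul => //; [exact: Cinf_cst | exact: Cinf_dot].
have cb : Cinf U b by exact: Cinf_dot.
have b2 z : U z -> b z ^+ 2 = 2^-1.
  move=> Uz; have lp := lift_orth eps (f z) (m z).
  have ll := dot_lift (m z) (m z) (f_sphere Uz) eps1; have ff := f_sphere Uz.
  have mm : dot (m z) (m z) = b z ^+ 2.
    by move: (nn Uz) (mn z Uz); move: (nu z) (b z) (m z) => n a c n1 ->; rewrite !dot_lin n1 mulr1 expr2.
  rewrite -mm -ll; move: WW; rewrite (WE z Uz).
  move: (f z) (lift eps (f z) (m z)) lp ff => p l lp ff.
  rewrite !dot_lin [dot p l]dotC lp ff !mulr0 addr0 add0r mulr1 -expr2 k2 => E.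
  by apply: (addrI 2^-1); rewrite E; field.
have h2 : 2^-1 != 0 :> R by rewrite invr_eq0 pnatr_eq0.
have Db v z (Uz : U z) : 'D_v b z = 0 := sqr_const_derive h2 cb b2 v Uz.
have b0 z : U z -> b z != 0.
  by move=> Uz; apply: contraNneq h2 => bz; rewrite -(b2 z Uz) bz expr0n.
have N v z : U z -> 'N_v nu z = - (k / b z) *: th v z.
  move=> Uz; have dm := Cinfv_differentiable cm Uz; have dn := dnu Uz.
  have Nm : 'N_v m z = b z *: 'N_v nu z.
    rewrite /nab (eq_on_deriveV openU v mn Uz) (deriveV_scale v (Cinf_differentiable cb Uz) dn).
    rewrite (Db v z Uz) scale0r add0r mn //; move: ('D_v nu z) (nu z) (th v z) (b z) => D n t a.
    by rewrite crossZr -scalerDr.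
  have Df := has_deriveP v (df Uz); have Dl := derive_lift_field v eps1 Uz dm.
  have [_ D] : has_derive z v (fun y => k *: f y + lift eps (f y) (m y))
      (lift eps (f z) (k *: th v z + b z *: 'N_v nu z)).
    eapply has_derive_eq; first by has_derive_tac.
    by rewrite mt // !scale0r add0r subr0 derive_lift // -liftZ -liftD Nm.
  have := eq_on_deriveV openU v WE Uz; rewrite (derive_cst W) D => /esym L.
  have := dot_lift (k *: th v z + b z *: 'N_v nu z) (k *: th v z + b z *: 'N_v nu z) (f_sphere Uz) eps1.
  rewrite L dot0l => /esym /eqP; rewrite dot_eq0.
  move: (b0 z Uz); move: ('N_v nu z) (th v z) (b z) => n t a a0 /eqP E.
  have -> : n = a^-1 *: (k *: t + a *: n) - (k / a) *: t.
    by apply/rowP => i; rewrite !(addvE, oppvE, scalevE); gen_entries; field.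
  by rewrite E scaler0 sub0r scaleNr.
have hg z (Uz : U z) : h z = 2 * (k / b z) /\ gk z = (k / b z) ^+ 2 := umbilic_trace (J0 Uz) (area_normal indep Uz) (nn Uz)
  (areaE eps eps l3 indep Uz) (gE Uz) (N e0 z Uz) (N e1 z Uz).
have q2 z : U z -> (k / b z) ^+ 2 = 1.
  by move=> Uz; rewrite expr_div_n k2 b2 // divff.
have hh z : U z -> h z ^+ 2 = 4.
  by move=> Uz; rewrite (hg z Uz).1 exprMn q2 // mulr1; ring.
have h4 : 4 != 0 :> R by rewrite pnatr_eq0.
split.
  apply/(biharmonic_equation h4 hh Ux); rewrite (hg x Ux).2 hh // q2 // /ricci3 eps1.
  have := nn Ux; move: (nu x) => n n1.
  have -> : diag3 (- 1) (- 1) (3 * 1 - 4) n = - n by row3; vring.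
  by rewrite dot_lin n1; row3; vring.
by rewrite tension_surface_eq0 // => hx; case/eqP: h4; rewrite -(hh x Ux) hx expr0n.
Qed.

(** The radius condition says [1 - 4 k^2 = 1 / (2 - eps^2)]. This is [mu^2], hence non-zero and nu
    is horizontal; [horizontal_mcurv] then gives [h^2 = 4 - 4 eps^2], non-zero since [eps^2 < 1]. *)
Lemma proper_hopf (W : 'rV[R]_3) k x : eps ^+ 2 < 1 ->
  (forall z, U z -> dot W (hopf (f z)) = k) -> dot W W = 1 ->
  4 * (2 - eps ^+ 2) * (4^-1 - k ^+ 2) = 1 -> U x ->
  bitension G H F x = 0 /\ tension G H F x <> 0.
Proof.
move=> eps1 Wf WW k2 Ux; have e2 : 2 - eps ^+ 2 != 0.
  by rewrite subr_eq0 gt_eqF // (lt_trans eps1) // ltr1n.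
have k4 : 1 - 4 * k ^+ 2 = (2 - eps ^+ 2)^-1.
  by apply: (mulfI e2); rewrite mulfV //; apply: etrans _ k2; field.
have hor z : U z -> nu z 0 2 = 0.
  move=> Uz; have [mu [_ _ /eqP + mw _]] := base_plane_normal Wf WW Uz.
  rewrite mulf_eq0 => /orP[/eqP m0|/eqP //].
  have : 1 - 4 * k ^+ 2 = 0 by move: mw; rewrite m0 expr0n add0r => ->; rewrite subrr.
  by move/eqP; rewrite k4 invr_eq0 (negbTE e2).
have hh z : U z -> h z ^+ 2 = 4 - 4 * eps ^+ 2.
  move=> Uz; have := horizontal_mcurv hor Wf WW Uz; rewrite k4 => E.
  have -> : h z ^+ 2 = (2 - eps ^+ 2) * ((2 - eps ^+ 2)^-1 * h z ^+ 2) by rewrite mulVKf.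
  rewrite E; have -> : 16 * k ^+ 2 = 4 * (1 - (1 - 4 * k ^+ 2)) by ring.
  by rewrite k4; field.
have h4 : 4 - 4 * eps ^+ 2 != 0.
  by rewrite (_ : _ - _ = 4 * (1 - eps ^+ 2)) ?mulf_neq0 ?pnatr_eq0 ?subr_eq0 ?gt_eqF //; ring.
split.
  apply/(biharmonic_equation h4 hh Ux); rewrite (horizontal_normal hor Ux).1 hh //.
  have := nn Ux; have := hor x Ux; move: (nu x) => n n2 n1.
  have -> : diag3 (- eps ^+ 2) (- eps ^+ 2) (ricci3 eps) n = - eps ^+ 2 *: n.
    by row3; rewrite ?vecE ?n2; vring.
  by rewrite dot_lin n1; row3; vring.
by rewrite tension_surface_eq0 // => hx; case/eqP: h4; rewrite -(hh x Ux) hx expr0n.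
Qed.
End SurfaceCases.

(** * Globalisation *)

Section SmoothOn.
Variables (R : realType) (U : set 'rV[R]_2).
Hypothesis openU : open U.

Lemma smooth_Cinf (g : 'rV[R]_2 -> R) :
  (forall (l : seq 'I_2) x, U x ->
     differentiable (foldr (fun i g => 'D_(basis_vector R i) g) g l) x) -> Cinf U g.
Proof.
move=> sg n; elim: n g sg => [//|n IH] g sg; split=> [x Ux|v]; first exact: sg [::] x Ux.
have D i : Ck U n ('D_(basis_vector R i) g).
  (* [foldr] applies the last index of the list first, so the innermost derivative is split off with
     [rcons]. *)
  by apply: IH => l x Ux; have := sg (rcons l i) x Ux; rewrite foldr_rcons.
apply: (Ck_ext openU (f := fun z => v 0 0 * 'D_(basis_vector R 0) g z
    + v 0 1 * 'D_(basis_vector R 1) g z)) => [z Uz|].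
  by rewrite (derive_basis v (sg [::] z Uz)).
have C k : Ck U n (fun _ : 'rV[R]_2 => v 0 k) by exact: Ck_cst.
by apply: (Ck_add openU); apply: (Ck_mul openU).
Qed.

Lemma smooth_on_Cinfv n (W : 'rV[R]_2 -> 'rV[R]_n) : smooth_on U W -> Cinfv U W.
Proof.
move=> sW k; apply: smooth_Cinf => l x Ux.
have E l' z : U z -> foldr (fun i g => 'D_(basis_vector R i) g) W l' z 0 k
    = foldr (fun i g => 'D_(basis_vector R i) g) (fun y => W y 0 k : R) l' z.
  elim: l' z => [//|i l' IH] z Uz /=.
  by rewrite (derive_coord _ k (sW l' z Uz)); exact: (eq_on_derive openU _ IH Uz).
apply: near_eq_differentiable (differentiable_entry k (sW l x Ux)).
by apply: (near_open openU Ux) => z Uz; exact: E.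
Qed.

End SmoothOn.

Section Globalize.
Variables (R : realType) (M : topologicalType) (n : nat) (g : M -> 'rV[R]_n) (a b : R).
Hypothesis M0 : [set: M] !=set0.
Hypothesis Mc : connected [set: M].
Hypothesis loc : forall (p : M) (N : set M), nbhs p N -> exists (O : set M) (V : 'rV[R]_n),
  [/\ nbhs p O, O `<=` N, dot V V = b, forall q, O q -> dot V (g q) = a &
   forall W, dot W W = b -> (forall q, O q -> dot W (g q) = a) -> W = V].

(** Uniqueness on arbitrarily small sets makes the local vectors agree on overlaps; the points near
    which a fixed one works then form an open and closed set. *)
Lemma globalize : exists V, dot V V = b /\ forall p, dot V (g p) = a.
Proof.
have [p0 _] := M0; have [B [V [Bp _ VV Vg _]]] := loc (filterT (F := nbhs p0)).
exists V; split=> // p; pose Z : set M := [set q | \near q, dot V (g q) = a].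
suff ZT : Z = setT.
  have Zp : Z p by rewrite ZT.
  exact: (nbhs_singleton Zp).
have Zo : open Z by rewrite openE => q /= /near_join.
(* If points of [Z] accumulate at q, some small set lies both in the neighbourhood of q served by W
   and in a region where V works; uniqueness there gives [V = W], so q is in [Z]. *)
have Zc : closed Z.
  rewrite -[Z]setCK closedC openE => q Zq; have [B1 [W [Bq _ WW Wg Wu]]] := loc (filterT (F := nbhs q)).
  have Oo : nbhs q (interior B1) by exact: nbhs_interior.
  apply: filterS Oo => y Oy Zy; apply: Zq.
  have [B2 [W' [_ O'N W'W' _ W'u]]] := loc (filterI Zy Oy).
  have VW' : V = W' by apply: W'u => // z /O'N [].
  have WW' : W = W' by apply: W'u => // z /O'N [_ /Wg].
  by apply: filterS Bq => z /Wg; rewrite VW' -WW'.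
apply: Mc; [|by exists Z; rewrite ?setTI|by exists Z; rewrite ?setTI].
by exists p0; apply: filterS Bp => q /Vg.
Qed.

End Globalize.

Section Charts.
Variables (R : realType) (M : topologicalType) (A : set (chart R M 2)) (phi : M -> 'rV[R]_4).
Hypothesis atlas : smooth_atlas A.
Hypothesis imm : immersion_in_S3 A phi.

Let dom (x : chart R M 2) s := chart_cod x `&` (phi \o chart_inv x) @^-1` stereo_dom s.

Lemma chart_surface x (U : set 'rV[R]_2) s : A x -> open U -> U `<=` dom x s ->
  [/\ Cinfv U (phi \o chart_inv x),
      forall z, U z -> dot ((phi \o chart_inv x) z) ((phi \o chart_inv x) z) = 1,
      forall z, U z -> (phi \o chart_inv x) z 0 3 != (-1) ^+ s &
      forall z v, U z -> 'D_v (phi \o chart_inv x) z = 0 -> v = 0].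
Proof.
have [ps sm inj] := imm; move=> Ax oU Us; split.
- by apply: smooth_on_Cinfv => // l z /Us [cz _]; exact: sm.
- by move=> z /Us [_ [/sphereP -> //]]; rewrite expr1n.
- by move=> z /Us [_ [_]]; rewrite ord_maxE.
- move=> z v /Us [cz _]; rewrite deriveE; last exact: sm Ax [::] z cz.
  by rewrite -(linear0 ('d (phi \o chart_inv x) z)) => /(inj x z Ax cz).
Qed.

Lemma stereo_cover p : exists s, stereo_dom s (phi p).
Proof.
have [ps _ _] := imm; have [e|e] := eqVneq (phi p 0 ord_max) 1.
  by exists true; split=> //; rewrite e expr1 -subr_eq0 opprK -mulr2n pnatr_eq0.
by exists false; split=> //; rewrite expr0.
Qed.

(** Balls, because constancy is deduced from vanishing derivatives along segments issuing from the
    centre. *)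
Lemma chart_ball (p : M) (N : set M) : nbhs p N -> exists x s (u : 'rV[R]_2) (r : R),
  [/\ A x, 0 < r, ball u r `<=` dom x s, nbhs p (chart_inv x @` ball u r) &
      chart_inv x @` ball u r `<=` N].
Proof.
move=> Np; have [charts cover _] := atlas; have [ps sm inj] := imm.
have [x Ax xp] := cover p; have [od oc mK cm ci] := charts x Ax.
have [s sp] := stereo_cover p; pose u := chart_map x p.
have cu : chart_cod x u by exists p.
have Nc : nbhs u (chart_cod x) by exact: open_nbhs_nbhs.
have ci' : {for u, continuous (chart_inv x)}.
  by move: ci; rewrite (continuous_open_subspace _ oc); apply; rewrite inE.
have cm' : {for p, continuous (chart_map x)}.
  by move: cm; rewrite (continuous_open_subspace _ od); apply; rewrite inE.
have NN : nbhs u (chart_inv x @^-1` N) by apply: ci'; rewrite mK.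
have df : differentiable (phi \o chart_inv x) u by exact: sm Ax [::] u cu.
have Ns : \forall z \near u, (phi \o chart_inv x) z 0 3 != (-1) ^+ s.
  have c3 : {for u, continuous (fun z => (phi \o chart_inv x) z 0 3 - (-1) ^+ s)}.
    apply: differentiable_continuous; apply: differentiable_add; first exact: differentiable_entry.
    exact: differentiable_cst.
  have /(cvgr_neq0 _ c3) : (phi \o chart_inv x) u 0 3 - (-1) ^+ s != 0.
    by rewrite subr_eq0 /= mK //; case: sp => _; rewrite ord_maxE.
  by apply: filterS => z; rewrite subr_eq0.
have [r r0 Br] := (nbhs_ballP _ _).1 (filterI Nc (filterI NN Ns)).
exists x, s, u, r; split=> //.
- move=> z /Br [cz [_ nz]]; split=> //; split; first exact: ps.
  by rewrite ord_maxE.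
- have : nbhs p (chart_dom x `&` chart_map x @^-1` ball u r).
    by apply: filterI; [exact: open_nbhs_nbhs | apply: cm'; exact: nbhsx_ballx].
  by apply: filterS => q [dq bq]; exists (chart_map x q) => //; exact: mK.
- by move=> _ [z /Br [_ [Nz _]] <-].
Qed.

Lemma globalize_charts n (g : 'rV[R]_4 -> 'rV[R]_n) a b :
  [set: M] !=set0 -> connected [set: M] ->
  (forall x s (u : 'rV[R]_2) (r : R), A x -> 0 < r -> ball u r `<=` dom x s -> exists V,
    [/\ dot V V = b, forall z, ball u r z -> dot V (g ((phi \o chart_inv x) z)) = a &
     forall W, dot W W = b ->
       (forall z, ball u r z -> dot W (g ((phi \o chart_inv x) z)) = a) -> W = V]) ->
  exists V, dot V V = b /\ forall p, dot V (g (phi p)) = a.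
Proof.
move=> M0 Mc loc; apply: (globalize (g := g \o phi) M0 Mc) => p N.
move=> /chart_ball[x [s [u [r [Ax r0 Bs Bp BN]]]]]; have [V [VV Vf Vu]] := loc x s u r Ax r0 Bs.
exists (chart_inv x @` ball u r), V; split=> //; first by move=> _ [z Bz <-]; exact: Vf.
by move=> W WW Wf; apply: Vu => // z Bz; apply: Wf; exists z.
Qed.

End Charts.

(** * Round spheres as plane sections *)

Section RoundSpheres.
Variables (R : realType) (n : nat).
Implicit Types (V W c x : 'rV[R]_n).

Lemma enormP x r : 0 <= r -> enorm x = r <-> dot x x = r ^+ 2.
Proof. exact: sphereP. Qed.

Lemma round_sphere_section V a r rho : V != 0 -> 0 <= r -> 0 <= rho ->
  r ^+ 2 = rho ^+ 2 - a ^+ 2 / dot V V ->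
  exists S, [/\ round_sphere r S, S `<=` sphere rho &
    forall x, dot V x = a -> dot x x = rho ^+ 2 -> S x].
Proof.
move=> V0 r0 rho0 rE; have VV : dot V V != 0 by rewrite dot_eq0.
(* The centre is the foot of the perpendicular from the origin to the plane. *)
have [c cE] : exists c, c = (a / dot V V) *: V by exists ((a / dot V V) *: V).
have cV : dot c V = a by rewrite cE dotZl divfK.
have Vc : dot V c = a by rewrite dotC.
have cc : dot c c = a ^+ 2 / dot V V by rewrite {1}cE dotZl Vc expr2 mulrAC.
exists [set x | dot (x - c) V = 0 /\ enorm (x - c) = r]; split; first by exists c, V.
  move=> x [xV /(enormP _ r0)]; rewrite !dot_lin => xc; apply/(sphereP _ rho0).
  have xc0 : dot (x - c) c = 0 by rewrite {2}cE dotZr xV mulr0.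
  move: xc0; rewrite !dot_lin => xc0.
  have cx : dot c x = dot x c by rewrite dotC.
  move: xc xc0; rewrite cx rE -cc => /eqP; rewrite -subr_eq0 => /eqP xc /eqP.
  rewrite subr_eq0 => /eqP xc0; rewrite xc0 in xc.
  by apply/eqP; rewrite -subr_eq0; apply/eqP; apply: etrans xc; ring.
move=> x xV xx; split; first by rewrite dotDl dotNl cV dotC xV subrr.
apply/(enormP _ r0); rewrite !dot_lin xx rE -cc [dot c x]dotC.
have -> : dot x c = dot c c by rewrite cc cE dotZr dotC xV expr2 mulrAC.
by ring.
Qed.

(** The centre c lies on the normal line of the plane through the origin: if its component w within
    the plane were non-zero, the two antipodal points of [S] in the direction w would have different
    distances from the origin. *)
Lemma round_sphere_plane r rho S x0 : 0 < r -> 0 <= rho -> round_sphere r S ->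
  S `<=` sphere rho -> S x0 ->
  exists W k, [/\ dot W W = 1, k ^+ 2 = rho ^+ 2 - r ^+ 2 & forall x, S x -> dot W x = k].
Proof.
move=> r0 rho0 [c [nu [nu0 ->]]] Srho Sx0.
have nn : 0 < dot nu nu by rewrite dot_gt0.
have [W WE] : exists W, W = (Num.sqrt (dot nu nu))^-1 *: nu by eexists.
have sq : Num.sqrt (dot nu nu) ^+ 2 = dot nu nu by rewrite sqr_sqrtr // ltW.
have s0 : Num.sqrt (dot nu nu) != 0 by rewrite sqrtr_eq0 -ltNge.
have WW : dot W W = 1.
  rewrite WE dotZl dotZr; move: sq s0; move: (Num.sqrt _) => q <- q0; by field.
have nuW : nu = Num.sqrt (dot nu nu) *: W by rewrite WE scalerA divff // scale1r.
have [k kE] : exists k, dot W c = k by exists (dot W c).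
have [w wE] : exists w, w = c - k *: W by exists (c - k *: W).
have ww : dot w w = dot c w.
  by rewrite wE !dot_lin WW [dot c W]dotC kE; ring.
have wW : dot w W = 0 by rewrite wE !dot_lin WW dotC kE mulr1 subrr.
have w0 : w = 0.
  apply/eqP/negPn/negP => wn; have wp : 0 < dot w w by rewrite dot_gt0.
  have [t tE] : exists t, t = r / Num.sqrt (dot w w) by exists (r / Num.sqrt (dot w w)).
  have t0 : t != 0 by rewrite tE mulf_neq0 ?lt0r_neq0 // invr_gt0 sqrtr_gt0.
  have tt : t ^+ 2 * dot w w = r ^+ 2.
    by rewrite tE expr_div_n sqr_sqrtr ?ltW // divfK // lt0r_neq0.
  have P (e : R) : e ^+ 2 = 1 -> dot (c + (e * t) *: w) (c + (e * t) *: w) = rho ^+ 2.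
    move=> e1; apply/(sphereP _ rho0)/Srho; rewrite /= addrC addKr; split.
      by rewrite dotZl nuW dotZr wW !mulr0.
    by apply/(enormP _ (ltW r0)); rewrite dotZl dotZr mulrA -expr2 exprMn e1 mul1r.
  have := P 1 (expr1n _ _); rewrite -(P (- 1)) ?sqrrN ?expr1n //.
  rewrite !dot_lin [dot w c]dotC -ww => /eqP; rewrite -subr_eq0 => /eqP E.
  have : 4 * t * dot w w = 0 by rewrite -E; ring.
  by apply/eqP; rewrite !mulf_neq0 ?pnatr_eq0 // lt0r_neq0.
have cE : c = k *: W by apply/eqP; rewrite -subr_eq0 -wE w0.
exists W, k; have onS x : dot (x - c) nu = 0 -> dot W x = k.
  rewrite nuW dotZr => /eqP; rewrite mulf_eq0 (negbTE s0) /= dotDl dotNl subr_eq0 => /eqP.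
  by rewrite [dot x W]dotC [dot c W]dotC kE.
split=> // [|x [/onS //]].
have := Srho _ Sx0 => /(sphereP _ rho0) <-; case: Sx0 => /onS Wx.
move=> /(enormP _ (ltW r0)) <-; rewrite cE !dot_lin WW [dot x0 W]dotC Wx; ring.
Qed.

End RoundSpheres.

Theorem theorem2p2 (R : realType) (eps : R) (M : topologicalType)
    (A : set (chart R M 2)) (phi : M -> 'rV[R]_4) :
  eps != 0 ->
  smooth_manifold A ->
  [set: M] !=set0 ->
  connected [set: M] ->
  immersion_in_S3 A phi ->
  constant_mean_curvature eps A phi ->
  (proper_biharmonic eps A phi <->
   (eps ^+ 2 = 1 /\
    exists S : set 'rV[R]_4,
      [/\ round_sphere (Num.sqrt 2)^-1 S, S `<=` sphere 1 &
          range phi `<=` S]) \/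
   (eps ^+ 2 < 1 /\
    exists C : set 'rV[R]_3,
      [/\ round_sphere (2 * Num.sqrt (2 - eps ^+ 2))^-1 C,
          C `<=` sphere 2^-1 &
          range phi `<=` @hopf R @^-1` C])).
Proof.
move=> eps0 [_ _ atlas] M0 Mc imm [c cmc].
pose dom (x : chart R M 2) s := chart_cod x `&` (phi \o chart_inv x) @^-1` stereo_dom s.
have surface x s u : A x -> dom x s u -> exists U, [/\ open U, U u, U `<=` dom x s &
    mcurv eps eps (2 / eps - eps) (coframe eps (phi \o chart_inv x)) u ^+ 2 = (2 * c) ^+ 2].
  move=> Ax du; have [U [xi [oU Uu Us _ Hxi]]] := cmc x s u Ax du; exists U; split=> //.
  have [cf fs fd fi] := chart_surface imm Ax oU Us; have [n m] := Hxi u Uu.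
  by have E := mean_curvature_surface eps0 oU cf fs fd fi Uu n m; exact: E.
(* Since M is non-empty, a chart point exists at which the tension field can be tested. *)
have nonharmonic : (forall x s u, A x -> dom x s u ->
    bitension (pullback_metric eps (phi \o chart_inv x)) (berger_coord_metric eps s)
      (stereo s \o (phi \o chart_inv x)) u = 0 /\
    tension (pullback_metric eps (phi \o chart_inv x)) (berger_coord_metric eps s)
      (stereo s \o (phi \o chart_inv x)) u <> 0) -> proper_biharmonic eps A phi.
  move=> H; split=> [? ? ? x s u Ax du|harm]; first by have [] := H x s u Ax du.
  have [p _] := M0; have [x [s [u [r [Ax r0 Bs _ _]]]]] := chart_ball atlas imm (filterT (F := nbhs p)).
  have du := Bs u (ballxx u r0).
  by have [_] := H x s u Ax du; apply; exact: harm.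
split=> [[bih nharm]|].
  (* With [c = 0] the function h vanishes in all charts and the surface is harmonic. *)
  have c0 : (2 * c) ^+ 2 != 0.
    apply: contra_notN nharm => /eqP c0 ? ? ? x s u Ax du; have [U [oU Uu Us hc]] := surface x s u Ax du.
    have [cf fs fd fi] := chart_surface imm Ax oU Us.
    apply/(tension_surface_eq0 eps0 oU cf fs fd fi Uu); apply/eqP.
    by rewrite -sqrf_eq0 hc c0.
  have mc x s u r : A x -> ball u r `<=` dom x s -> forall z, ball u r z ->
      mcurv eps eps (2 / eps - eps) (coframe eps (phi \o chart_inv x)) z ^+ 2 = (2 * c) ^+ 2.
    by move=> Ax Bs z Bz; have [U []] := surface x s z Ax (Bs z Bz).
  have [e1|e1] := eqVneq (eps ^+ 2) 1; [left|right].
    (* The values 2 and 8 are those of [pole_plane]; the plane is at squared distance [4 / 8] from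
       the origin, which leaves the radius [1 / sqrt 2]. *)
    split=> //; have [|V [VV Vphi]] := globalize_charts atlas imm (g := id) (a := 2) (b := 8) M0 Mc.
      move=> x s u r Ax r0 Bs; have [cf fs fd fi] := chart_surface imm Ax (ball_open u r) Bs.
      exact: (pole_ball eps0 (ball_open u r) cf fs fd fi c0 (mc x s u r Ax Bs) e1
        (fun z Bz => bih x s z Ax (Bs z Bz)) r0 erefl).
    have V0 : V != 0 by apply/eqP => V0; move/eqP: VV; rewrite V0 dot0l eq_sym pnatr_eq0.
    have [||| S [rS Ss SP]] := @round_sphere_section R 4 V 2 (Num.sqrt 2)^-1 1 V0.
    - by rewrite invr_ge0 sqrtr_ge0.
    - exact: ler01.
    - by rewrite exprVn sqr_sqrtr ?ler0n // VV; field.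
    exists S; split=> // _ [p _ <-]; apply: SP => //.
    by have [ps _ _] := imm; apply/(sphereP _ ler01); exact: ps.
  have hc : (2 * c) ^+ 2 = 4 - 4 * eps ^+ 2.
    have [p _] := M0; have [x [s [u [r [Ax r0 Bs _ _]]]]] := chart_ball atlas imm (filterT (F := nbhs p)).
    have [cf fs fd fi] := chart_surface imm Ax (ball_open u r) Bs.
    exact: (biharmonic_mcurv eps0 (ball_open u r) cf fs fd fi c0 (mc x s u r Ax Bs) e1
      (fun z Bz => bih x s z Ax (Bs z Bz)) (ballxx u r0)).
  have hp : 0 < (2 * c) ^+ 2 by rewrite lt_neqAle eq_sym c0 sqr_ge0.
  split; first by move: hp; rewrite hc; lra.
  set hh := (2 * c) ^+ 2 in c0 hc hp mc *.
  have [|V [VV Vphi]] := globalize_charts atlas imm (g := @hopf R) (a := hh / 4)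
      (b := hh + hh ^+ 2 / 4) M0 Mc.
    move=> x s u r Ax r0 Bs; have [cf fs fd fi] := chart_surface imm Ax (ball_open u r) Bs.
    exact: (base_pole_ball eps0 (ball_open u r) cf fs fd fi c0 (mc x s u r Ax Bs) e1
      (fun z Bz => bih x s z Ax (Bs z Bz)) r0 erefl).
  have bp : 0 < hh + hh ^+ 2 / 4 by apply: addr_gt0 => //; apply: divr_gt0; [exact: exprn_gt0 | rewrite ltr0n].
  have V0 : V != 0 by apply/eqP => V0; move: bp; rewrite -VV V0 dot0l ltxx.
  have [||| S [rS Ss SP]] := @round_sphere_section R 3 V (hh / 4) (2 * Num.sqrt (2 - eps ^+ 2))^-1 2^-1 V0.
  - by rewrite invr_ge0 mulr_ge0 ?sqrtr_ge0 ?ler0n.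
  - by rewrite invr_ge0 ler0n.
  (* The section has [r^2 = 1/4 - (hh/4)^2 / (hh + hh^2/4) = 1 / (4 + hh)], and
     [4 + hh = 4 (2 - eps^2)]. *)
  - rewrite exprVn exprMn sqr_sqrtr; last by move: hp; rewrite hc; lra.
    have -> : eps ^+ 2 = 1 - hh / 4 by rewrite hc; field.
    have h2 : 0 < hh ^+ 2 by exact: exprn_gt0.
    by rewrite VV; field; apply/andP; split; apply: lt0r_neq0; move: hp h2; move: (hh) => a; lra.
  exists S; split=> // _ [p _ <-]; apply: SP => //.
  have [ps _ _] := imm; have pp : dot (phi p) (phi p) = 1 by rewrite (sphereP _ ler01).1 // expr1n.
  by rewrite hopf_base dot_base // !mulr0 !add0r expr2.
case=> [[e1 [S [rS Ss Sphi]]]|[e1 [S [rS Ss Sphi]]]]; apply: nonharmonic => x s u Ax du;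
  have [U [oU Uu Us _]] := surface x s u Ax du; have [cf fs fd fi] := chart_surface imm Ax oU Us.
- have s2 : 0 < (Num.sqrt 2)^-1 :> R by rewrite invr_gt0 sqrtr_gt0 ltr0n.
  have [p _] := M0; have Sp : S (phi p) by apply: Sphi; exists p.
  have [W [k [WW k2 Wk]]] := round_sphere_plane s2 ler01 rS Ss Sp.
  apply: (proper_round eps0 oU cf fs fd fi (W := W) (k := k)) => //.
    by move=> z _; apply: Wk; apply: Sphi; exists (chart_inv x z).
  by rewrite k2 exprVn sqr_sqrtr ?ler0n //; field.
- have s2 : 0 < 2 - eps ^+ 2 by lra.
  have r0 : 0 < (2 * Num.sqrt (2 - eps ^+ 2))^-1.
    by rewrite invr_gt0 mulr_gt0 ?sqrtr_gt0 ?ltr0n.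
  have h0 : 0 <= 2^-1 :> R by rewrite invr_ge0 ler0n.
  have [p _] := M0; have Sp : S (hopf (phi p)) by apply: Sphi; exists p.
  have [W [k [WW k2 Wk]]] := round_sphere_plane r0 h0 rS Ss Sp.
  apply: (proper_hopf eps0 oU cf fs fd fi (W := W) (k := k)) => //.
    by move=> z _; apply: Wk; apply: Sphi; exists (chart_inv x z).
  by rewrite k2 exprVn exprVn exprMn sqr_sqrtr ?ltW //; field; rewrite lt0r_neq0.
Qed.
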